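(* Let $\sigma>0$, let $k\ge1$ be an integer, and let $(x_i)_{i\in\mathbb{Z}}$ be a sequence of real numbers with $x_i<x_{i+1}$ for all $i$, $\bigcup_{i\in\mathbb{Z}}[x_i,x_{i+1}]=\mathbb{R}$, and $\delta:=\sup_{i}(x_{i+1}-x_i)<\frac{\nu_k}{\sigma}$. Then any $f\in\mathcal{B}_\sigma$ can be reconstructed from the sample values $\{f^{(j)}(x_i):j=0,1,\dots,k-1,\ i\in\mathbb{Z}\}$ using the following iteration algorithm. Set $$f_0=Af^{(k-1)}=P\Big(\sum_{i\in\mathbb{Z}}H_{2k-1}^{(k-1)}(x_i,x_{i+1},f;\cdot)\,\chi_{[x_i,x_{i+1}]}\Big),$$ $$f_{n+1}=f_n+\widetilde A\big(f^{(k-1)}-f_n\big),\qquad n\ge0.$$ Then $\lim_{n\to\infty}f_n=f^{(k-1)}$ in $L^2(\mathbb{R})$, and the error after $n$ iterations satisfies $$\|f^{(k-1)}-f_n\|_2\le\Big(\frac{\delta\sigma}{\nu_k}\Big)^{n+1}\|f^{(k-1)}\|_2 .$$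
   Context: The Fourier transform is $\widehat f(w)=\int_{\mathbb{R}} f(x)e^{-2\pi i w x}\,\mathrm{d}x$, extended to $L^2(\mathbb{R})$. For $\sigma>0$, $\mathcal{B}_\sigma=\{f\in L^2(\mathbb{R}):\operatorname{supp}\widehat f\subseteq[-\frac{\sigma}{2\pi},\frac{\sigma}{2\pi}]\}$; its elements are identified with entire functions of exponential type $\le\sigma$ that are square integrable on the real axis. The constant $\nu_k>0$ (Wirtinger-Cimmino constant): $\nu_k^2$ is the first (smallest) eigenvalue $\lambda>0$ of the boundary value problem $$u^{(2k)}(x)+\lambda u^{(2k-2)}(x)=0,\ x\in[0,1],\qquad u^{(l)}(0)=u^{(l)}(1)=0,\ 0\le l\le k-1,\qquad u\in C^{2k}[0,1],$$ i.e. the smallest $\lambda>0$ for which a non-zero solution $u$ exists. (For instance $\nu_1=\pi$ and $\nu_2=2\pi$.) For $\xi<\eta$, $H_{2k-1}(\xi,\eta,f;\cdot)$ is the Hermite interpolation polynomial of $f$: the unique polynomial of degree at most $2k-1$ with $H_{2k-1}^{(j)}(\xi,\eta,f;y)=f^{(j)}(y)$ for $y\in\{\xi,\eta\}$ and $0\le j\le k-1$; $H_{2k-1}^{(k-1)}$ denotes its $(k-1)$-th derivative. Let $\mathcal{D}$ be the differentiation operator on $\mathcal{B}_\sigma$ and $\mathcal{B}_\sigma^{k-1}:=\mathcal{D}^{k-1}(\mathcal{B}_\sigma)$, a (not necessarily closed) subspace of $L^2(\mathbb{R})$ with closure $\overline{\mathcal{B}_\sigma^{k-1}}$. $P$ is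 the orthogonal projection of $L^2(\mathbb{R})$ onto $\overline{\mathcal{B}_\sigma^{k-1}}$, and $\chi_E$ is the characteristic function of $E$. The approximation operator $A$ on $\mathcal{B}_\sigma^{k-1}$ is defined, for $f\in\mathcal{B}_\sigma$, by $$A[f^{(k-1)}]=P\Big(\sum_{i\in\mathbb{Z}}H_{2k-1}^{(k-1)}(x_i,x_{i+1},f;\cdot)\,\chi_{[x_i,x_{i+1}]}\Big).$$ It is a bounded operator on $\mathcal{B}_\sigma^{k-1}$, and $\widetilde A$ denotes its unique bounded extension to $\overline{\mathcal{B}_\sigma^{k-1}}$. *)

(* Defs.v *)
From mathcomp Require Import all_boot all_order all_algebra.
From mathcomp Require Import all_classical all_reals all_analysis.
From mathcomp Require Import complex.

Set Implicit Arguments.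
Unset Strict Implicit.
Unset Printing Implicit Defensive.

Import Order.TTheory GRing.Theory Num.Theory.
Import numFieldNormedType.Exports.

Local Open Scope classical_set_scope.
Local Open Scope complex_scope.
Local Open Scope ring_scope.

Section ComplexValuedFunctions.
Context {R : realType}.
Local Notation mu := (@lebesgue_measure R).
Implicit Types f g h F : R -> R[i].

(* Complex-valued functions of a real variable are continuous, integrable,
   square integrable, ... when their real and imaginary parts are; the elements
   of L^2(R) are represented by functions, considered up to equality a.e. *)

Definition ccontinuous f :=
  continuous (fun t => complex.Re (f t)) /\
  continuous (fun t => complex.Im (f t)).

Definition cderiv (n : nat) f : R -> R[i] := fun t =>
  derive1n n (fun s => complex.Re (f s)) t +i*
  derive1n n (fun s => complex.Im (f s)) t.

Definition cintegrable f :=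
  mu.-integrable [set: R] (fun t => (complex.Re (f t))%:E) /\
  mu.-integrable [set: R] (fun t => (complex.Im (f t))%:E).

Definition cintegral f : R[i] :=
  Rintegral mu [set: R] (fun t => complex.Re (f t)) +i*
  Rintegral mu [set: R] (fun t => complex.Im (f t)).

Definition cL2 f :=
  (fun t => complex.Re (f t)) \in Lfun mu 2%:E /\
  (fun t => complex.Im (f t)) \in Lfun mu 2%:E.

Definition norm2 f : \bar R := Lnorm mu 2%:E (fun t => (Normc.normc (f t))%:E).

Definition inner f g : R[i] := cintegral (fun t => f t * conjc (g t)).

Definition eq_ae f g := {ae mu, forall t, f t = g t}.

Definition cvg_L2 (u : nat -> R -> R[i]) f :=
  [/\ forall n, cL2 (u n), cL2 f &
      (fun n => norm2 (fun t => u n t - f t)) @ \oo --> 0%E].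

Definition cexpi (t : R) : R[i] := cos t +i* sin t.

Definition fourier f : R -> R[i] :=
  fun w => cintegral (fun t => f t * cexpi (- (2 * pi * w * t))).

(* F is the Fourier transform of f in L^2, obtained by continuous extension of
   the integral formula from the dense subspace of integrable functions. *)
Definition is_fourier_L2 f F :=
  exists u : nat -> R -> R[i],
    [/\ forall n, cintegrable (u n), cvg_L2 u f &
        cvg_L2 (fun n => fourier (u n)) F].

(* A class in L^2(R) with compactly supported Fourier transform contains exactly
   one continuous function, namely the restriction to the real axis of the
   entire function with which it is identified; point values and derivatives
   are those of this representative. *)
Definition bandlimited (sigma : R) f :=
  [/\ ccontinuous f, cL2 f &
      exists2 F, is_fourier_L2 f F &
        {ae mu, forall w : R,
           w \notin `[- (sigma / (2 * pi)), sigma / (2 * pi)] -> F w = 0}].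

Definition bandlimited_deriv_closure (sigma : R) (m : nat) : set (R -> R[i]) :=
  [set g | cL2 g /\ forall e : R, 0 < e ->
     exists2 f, bandlimited sigma f &
       (norm2 (fun t => g t - cderiv m f t)%R < e%:E)%E].

Definition is_orth_proj (M : set (R -> R[i])) g p :=
  M p /\ forall h, M h -> inner (fun t => g t - p t) h = 0.

Definition orth_proj (M : set (R -> R[i])) g : R -> R[i] :=
  xget (fun=> 0) [set p | is_orth_proj M g p].

End ComplexValuedFunctions.

Section WirtingerCimmino.
Context {R : realType}.

Definition is_deriv_within (D : set R) (u : R -> R) (x l : R) :=
  (fun y => (u y - u x) / (y - x)) @ within D (x^') --> l.

(* u 0 is of class C^m on [0, 1] (one-sided derivatives at the end points), with
   successive derivatives u 1, ..., u m. *)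
Definition C_derivs01 (m : nat) (u : nat -> R -> R) :=
  (forall (l : nat) (x : R), (l < m)%N -> x \in `[0, 1] ->
     is_deriv_within `[0, 1] (u l) x (u l.+1 x)) /\
  {within `[0, 1], continuous (u m)}.

Definition is_eigenvalue (k : nat) (lambda : R) :=
  exists u : nat -> R -> R,
    [/\ C_derivs01 (2 * k) u,
        forall x : R, x \in `[0, 1] ->
          u (2 * k)%N x + lambda * u (2 * k - 2)%N x = 0,
        forall l, (l < k)%N -> u l 0 = 0 /\ u l 1 = 0 &
        exists2 x : R, x \in `[0, 1] & u 0%N x != 0].

Definition is_wirtinger_cimmino (k : nat) (nu : R) :=
  [/\ 0 < nu, is_eigenvalue k (nu ^+ 2) &
      forall lambda, 0 < lambda -> is_eigenvalue k lambda -> nu ^+ 2 <= lambda].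

End WirtingerCimmino.

Section Reconstruction.
Context {R : realType}.
Implicit Types f g : R -> R[i].

Definition is_hermite (k : nat) (xi eta : R) f (p : {poly R[i]}) :=
  (size p <= 2 * k)%N /\
  forall j, (j < k)%N -> p^`(j).[xi%:C] = cderiv j f xi /\
                         p^`(j).[eta%:C] = cderiv j f eta.

Definition hermite (k : nat) (xi eta : R) f : {poly R[i]} :=
  xget 0 [set p | is_hermite k xi eta f p].

Definition hermite_sum (k : nat) (x : int -> R) f : R -> R[i] := fun t =>
  \sum_(i \in [set: int])
     (hermite k (x i) (x (i + 1)) f)^`(k.-1).[t%:C] *
     (\1_(`[x i, x (i + 1)]) t)%:C.

(* The operator A, as a function of f rather than of f^(k-1), which determines
   f when f is band-limited. *)
Definition approx_op (sigma : R) (k : nat) (x : int -> R) f : R -> R[i] :=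
  orth_proj (bandlimited_deriv_closure sigma k.-1) (hermite_sum k x f).

Definition is_bounded_ext (sigma : R) (k : nat) (x : int -> R)
    (T : (R -> R[i]) -> (R -> R[i])) :=
  let M := bandlimited_deriv_closure sigma k.-1 in
  [/\ forall g, M g -> M (T g),
      forall (c : R[i]) g h, M g -> M h ->
        eq_ae (T (fun t => c * g t + h t)) (fun t => c * T g t + T h t),
      exists C : R, forall g, M g -> (norm2 (T g) <= C%:E * norm2 g)%E &
      forall f, bandlimited sigma f ->
        eq_ae (T (cderiv k.-1 f)) (approx_op sigma k x f)].

Definition approx_op_ext (sigma : R) (k : nat) (x : int -> R) :
    (R -> R[i]) -> (R -> R[i]) :=
  xget (fun _ _ => 0) [set T | is_bounded_ext sigma k x T].

Fixpoint recon (sigma : R) (k : nat) (x : int -> R) f (n : nat) : R -> R[i] :=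
  if n is m.+1 then
    let fm := recon sigma k x f m in
    fun t => fm t + approx_op_ext sigma k x (fun s => cderiv k.-1 f s - fm s) t
  else approx_op sigma k x f.

End Reconstruction.

(* Main.v *)
(* Let E = f^(K) - S, where K = k - 1 and S is the K-th derivative of the
   piecewise Hermite interpolant. On [x_i, x_(i+1)] the difference between f and
   its Hermite polynomial has vanishing derivatives of order <= K at both ends,
   and its (K+1)-st derivative is f^(K+1) minus a polynomial of degree <= K to
   which it is orthogonal. The Wirtinger-Cimmino inequality and a summation over i
   give ||E|| <= (delta/nu) ||f^(K+1)||, and Bernstein's inequality bounds this by
   q ||f^(K)|| with q = delta sigma / nu < 1. As P is a contraction fixing f^(K),
   ||f^(K) - A f^(K)|| <= q ||f^(K)||; by density I - A~ has norm <= q on the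
   closure, and f^(K) - f_(n+1) = (I - A~)(f^(K) - f_n). If all samples of f
   vanish, then S = 0, so f^(K) = 0 and hence f = 0.

   The Wirtinger-Cimmino inequality, which involves no spectral theory here, is
   Picone's identity: for lambda < nu^2 / (b - a)^2 the solutions V, V', ..., V^(K)
   of y^(2k) + lambda y^(2k-2) = 0 with zeros of order >= k slightly to the left
   of a have an invertible Wronskian matrix on [a, b], since a singular one yields
   an eigenfunction for an eigenvalue < nu^2; completing squares with these
   solutions gives lambda ||u^(K)||^2 <= ||u^(K+1)||^2.

   Bernstein's inequality comes from log-convexity. Up to an error due to the
   integrable weight 1 / (1 + (a t)^2), the numbers ||f^(m)||^2 are log-convex in
   m, so a first ratio above sigma forces a growth faster than C sigma^m,
   contradicting the sup bound on f^(m) given by Fourier inversion; the latter is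
   obtained by smoothing with the Poisson kernel. *)
Require Import Defs.
From mathcomp Require Import all_boot all_order all_algebra.
From mathcomp Require Import all_classical all_reals all_analysis.
From mathcomp Require Import complex.
From mathcomp Require Import measurable_realfun.
From mathcomp Require Import ring lra zify.
Import Order.TTheory GRing.Theory Num.Theory.
Import numFieldNormedType.Exports.
Local Open Scope classical_set_scope.
Local Open Scope complex_scope.
Local Open Scope ring_scope.
Set Implicit Arguments.
Unset Strict Implicit.
Unset Printing Implicit Defensive.

(** Three obstacles shape the proof. Only f itself is known to be square integrable, so in
    Bernstein's inequality neither the norms of the derivatives nor vanishing boundary terms are
    available at the start. The weight supplies both; its logarithmic derivative is at most a, so
    each step loses at most a in the ratio, and a = eta / N makes N steps affordable. Next, the
    transform of f is only an L^2 limit, so f cannot be recovered by testing against bare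
    exponentials. Damped exponentials and their transforms, the Poisson kernels, are in L^2 and can
    be paired with such limits. Finally, [orth_proj] and [approx_op_ext] pick representatives that
    are determined up to null sets only. The error bound is therefore proved for every pair in the
    closed graph of f^(K) |-> A f, and every bounded extension is shown to have its graph there. In
    Picone's identity the common zero of the solutions lies strictly left of a because their
    Wronskian matrix is singular at that zero; the strict bound on lambda leaves room for the
    shift. *)

Section RealIntegrals.
Context {R : realType}.
Local Notation mu := (@lebesgue_measure R).
Implicit Types (f g F G : R -> R) (a b c t : R).

Lemma is_derive_continuous F f : (forall t, is_derive t 1 F (f t)) -> continuous F.
Proof.
move=> dF t; apply/differentiable_continuous; rewrite -derivable1_diffP.
by have [] := dF t.
Qed.

Lemma continuous_integrable_itv f a b :
  continuous f -> mu.-integrable `[a, b] (EFin \o f).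
Proof.
move=> cf; apply: continuous_compact_integrable; first exact: segment_compact.
exact: continuous_subspaceT.
Qed.

Lemma continuous_measurable f (D : set R) : continuous f -> measurable_fun D f.
Proof. by move=> cf; apply: measurable_funTS; exact: continuous_measurable_fun. Qed.

Lemma Rintegral_FTC_in F f a b :
  (forall t, t \in `[a, b] -> is_derive t 1 F (f t)) ->
  (forall t, t \in `[a, b] -> {for t, continuous f}) -> a <= b ->
  \int[mu]_(t in `[a, b]) f t = F b - F a.
Proof.
move=> dF cf; rewrite le_eqVlt => /predU1P[->|ab].
  by rewrite set_itv1 Rintegral_set1 subrr.
have cF t : t \in `[a, b] -> {for t, continuous F}.
  move=> /dF[+ _]; rewrite derivable1_diffP; exact: differentiable_continuous.
have oc t : t \in `]a, b[ -> t \in `[a, b] by apply: subset_itv_oo_cc.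
rewrite /Rintegral (@continuous_FTC2 _ f F)//.
- by apply: continuous_in_subspaceT => t /[!inE]; exact: cf.
- split.
  + by move=> x /oc /dF[].
  + by apply: cvg_at_right_filter; apply: cF; rewrite in_itv/= lexx ltW.
  + by apply: cvg_at_left_filter; apply: cF; rewrite in_itv/= lexx ltW.
- by move=> x /oc /dF[_]; rewrite derive1E.
Qed.

Lemma Rintegral_FTC F f a b : (forall t, is_derive t 1 F (f t)) ->
  continuous f -> a <= b -> \int[mu]_(t in `[a, b]) f t = F b - F a.
Proof.
by move=> dF cf ab; apply: Rintegral_FTC_in => // t _; exact: cf.
Qed.

Lemma windows_cover : \bigcup_n `[- n%:R, n%:R]%classic = [set: R].
Proof.
rewrite -subTset => t _; exists (Num.truncn `|t|).+1 => //=.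
have := ltW (truncnS_gt `|t|).
by rewrite in_itv/= ler_norml.
Qed.

Lemma windows_homo : nondecreasing_seq (fun n => `[- n%:R, n%:R]%classic : set R).
Proof.
move=> n m nm; apply/subsetPset => t /=; rewrite !in_itv/= => /andP[h1 h2].
have nmR : (n%:R : R) <= m%:R by rewrite ler_nat.
by rewrite (le_trans _ h1) ?lerN2// (le_trans h2).
Qed.

Lemma ge0_cvg_windows f : measurable_fun [set: R] f -> (forall t, 0 <= f t) ->
  (\int[mu]_(t in `[(- n%:R)%R, n%:R%R]) (f t)%:E @[n --> \oo] --> \int[mu]_t (f t)%:E)%E.
Proof.
move=> mf f0; rewrite -windows_cover.
pose F (n : nat) : set (measurableTypeR R) := `[- n%:R, n%:R]%classic.
apply: (@ge0_nondecreasing_set_cvg_integral _ _ _ F (EFin \o f) mu).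
- exact: windows_homo.
- by move=> i; exact: measurable_itv.
- by move=> i; apply/measurable_EFinP; exact: measurable_funTS.
- by move=> i x _; rewrite lee_fin.
Qed.

Lemma ge0_windows_le f (c : R) : measurable_fun [set: R] f -> (forall t, 0 <= f t) ->
  (forall n : nat, \int[mu]_(t in `[(- n%:R)%R, n%:R%R]) (f t)%:E <= c%:E)%E ->
  (\int[mu]_t (f t)%:E <= c%:E)%E.
Proof.
move=> mf f0 fc; have cvgf := ge0_cvg_windows mf f0.
rewrite -(cvg_lim _ cvgf)//; apply: lime_le; first by apply/cvg_ex; eexists; exact: cvgf.
by apply: nearW => n; exact: fc.
Qed.

(** Uniform bounds on the windows [-n, n], where the fundamental theorem of calculus applies, yield
    integrability on the line. The kernels and the square of the first derivative in Bernstein's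
    inequality are shown integrable this way. *)
Lemma ge0_windows_integrable f (c : R) :
  measurable_fun [set: R] f -> (forall t, 0 <= f t) ->
  (forall n : nat, \int[mu]_(t in `[(- n%:R)%R, n%:R%R]) (f t)%:E <= c%:E)%E ->
  mu.-integrable [set: R] (EFin \o f).
Proof.
move=> mf f0 fc; apply/integrableP; split; first exact/measurable_EFinP.
apply: le_lt_trans (ltry c).
under eq_integral do rewrite /= ger0_norm//.
exact: ge0_windows_le.
Qed.

Lemma cvg_windows f : mu.-integrable [set: R] (EFin \o f) ->
  \int[mu]_(t in `[- n%:R, n%:R]) f t @[n --> \oo] --> \int[mu]_t f t.
Proof.
move=> itf.
apply: fine_cvg; rewrite fineK; last exact: integrable_fin_num.
under eq_fun do rewrite integral_mkcond.
have mf : measurable_fun [set: R] (EFin \o f) by exact: (measurable_int mu).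
apply: (@dominated_cvg _ _ _ mu setT measurableT
  (fun n => (EFin \o f) \_ `[- n%:R, n%:R]) (EFin \o f) (abse \o (EFin \o f))).
- by move=> n; apply/(measurable_restrictT _ _).1 => //; exact: measurable_funTS.
- move=> t _; apply: cvg_near_cst; exists (Num.truncn `|t|).+1 => //= n tn.
  rewrite patchE mem_set//= in_itv/= -ler_norml.
  by rewrite (le_trans (ltW (truncnS_gt `|t|)))// ler_nat.
- by [].
- exact: integrable_abse.
- move=> n t _; rewrite patchE; case: ifPn => //= _; rewrite normr0.
  by rewrite lee_fin.
Qed.

Lemma RintegralT_FTC F f (l m : R) : (forall t, is_derive t 1 F (f t)) -> continuous f ->
  mu.-integrable [set: R] (EFin \o f) ->
  F t @[t --> +oo] --> l -> F t @[t --> -oo] --> m ->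
  \int[mu]_t f t = l - m.
Proof.
move=> dF cf itf Fl Fm; have := cvg_windows itf.
move=> /cvg_lim <-//; apply/cvg_lim => //.
under eq_fun.
  move=> n; rewrite (Rintegral_FTC dF cf); last by rewrite ge0_cp ?ler0n.
  over.
apply: cvgB.
  by apply: cvg_comp Fl; exact: cvgr_idn.
move/cvgNy_compNP : Fm => Fm.
have -> : (fun n : nat => F (- n%:R)) = (F \o -%R) \o (fun n => n%:R) by [].
by apply: cvg_comp Fm; exact: cvgr_idn.
Qed.

End RealIntegrals.

(** * The Wirtinger-Cimmino inequality *)

Section Towers.
Context {R : realType}.
Implicit Types (f g : R -> R) (U V : nat -> R -> R) (a b c t : R).

(** Carrying all derivatives as data makes sums, shifts and rescalings of smooth functions
    immediate; [tower_derive1n] gives the link with iterated derivatives. *)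
Definition tower U := forall n t, is_derive t 1 (U n) (U n.+1 t).

Lemma is_derive_addf f g t (df dg : R) : is_derive t 1 f df -> is_derive t 1 g dg ->
  is_derive t 1 (fun s => f s + g s) (df + dg).
Proof. exact: is_deriveD. Qed.

Lemma is_derive_mulf f g t (df dg : R) : is_derive t 1 f df -> is_derive t 1 g dg ->
  is_derive t 1 (fun s => f s * g s) (df * g t + f t * dg).
Proof.
move=> df' dg'; have /is_derive_eq := is_deriveM df' dg'; apply.
by rewrite addrC /GRing.scale/= mulrC.
Qed.

Lemma is_derive_oppf f t (df : R) : is_derive t 1 f df ->
  is_derive t 1 (fun s => - f s) (- df).
Proof. exact: is_deriveN. Qed.

Lemma is_derive_scalef c f t (df : R) : is_derive t 1 f df ->
  is_derive t 1 (fun s => c * f s) (c * df).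
Proof.
move=> df'; have /is_derive_eq := is_derive_mulf (is_derive_cst c t 1) df'; apply.
by rewrite mul0r add0r.
Qed.

Lemma is_derive_exprf n t :
  is_derive t 1 (fun s : R => s ^+ n.+1) (n.+1%:R * t ^+ n).
Proof.
elim: n => [|n ih].
  have -> : (fun s : R => s ^+ 1) = id by rewrite funeqE => s; rewrite expr1.
  by rewrite expr0 mulr1; exact: is_derive_id.
have := is_derive_mulf (is_derive_id t 1) ih.
under eq_fun do rewrite -exprS.
move=> /is_derive_eq; apply.
by rewrite !exprS !mulrS; ring.
Qed.

Lemma is_derive_sumf n (h : 'I_n -> R -> R) t (dh : 'I_n -> R) :
  (forall i, is_derive t 1 (h i) (dh i)) ->
  is_derive t 1 (fun s => \sum_(i < n) h i s) (\sum_(i < n) dh i).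
Proof.
move=> hh; have := is_derive_sum hh.
by rewrite (_ : \sum_(i < n) h i = (fun s => \sum_(i < n) h i s))// funeqE => s; rewrite fct_sumE.
Qed.

Lemma is_derive_affine f c d t (df : R) : is_derive (c * t + d) 1 f df ->
  is_derive t 1 (fun s => f (c * s + d)) (c * df).
Proof.
move=> df'.
have h : is_derive t 1 (fun s => c * s + d) c.
  have /is_derive_eq := is_derive_addf (is_derive_scalef c (is_derive_id t 1)) (is_derive_cst d t 1).
  by apply; rewrite mulr1 addr0.
have /is_derive_eq := @is_derive1_comp _ f (fun s => c * s + d) t _ _ df' h.
by apply; rewrite mulrC.
Qed.

Lemma derivable_prodf (I : Type) (r : seq I) (P : pred I) (F : I -> R -> R) t :
  (forall i, derivable (F i) t 1) ->
  derivable (fun s => \prod_(i <- r | P i) F i s) t 1.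
Proof.
move=> dF; elim: r => [|i r ih].
  by under eq_fun do rewrite big_nil; exact: derivable_cst.
under eq_fun do rewrite big_cons; case: (P i); last exact: ih.
by have := derivableM (dF i) ih.
Qed.

Lemma derivable_sumf (I : Type) (r : seq I) (P : pred I) (F : I -> R -> R) t :
  (forall i, derivable (F i) t 1) ->
  derivable (fun s => \sum_(i <- r | P i) F i s) t 1.
Proof.
move=> dF; elim: r => [|i r ih].
  by under eq_fun do rewrite big_nil; exact: derivable_cst.
under eq_fun do rewrite big_cons; case: (P i); last exact: ih.
by have := derivableD (dF i) ih.
Qed.

Lemma derivable_det n (A : R -> 'M[R]_n) t :
  (forall i j, derivable (fun s => A s i j) t 1) ->
  derivable (fun s => \det (A s)) t 1.
Proof.
move=> dA; rewrite /determinant; apply: derivable_sumf => p.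
apply: derivableM => //; exact: derivable_prodf.
Qed.

(** The cofactor formula describes [invmx] only at invertible matrices, hence a hypothesis on a
    neighbourhood of [t]. *)
Lemma derivable_invmx n (A : R -> 'M[R]_n) t i j :
  (forall i j, derivable (fun s => A s i j) t 1) ->
  (\near t, A t \in unitmx) -> derivable (fun s => (invmx (A s)) i j) t 1.
Proof.
move=> dA uA.
have dt0 : \det (A t) != 0.
  by have := nbhs_singleton uA; rewrite unitmxE unitfE.
apply: (@near_eq_derivable _ _ _ (fun s => (\det (A s))^-1 * cofactor (A s) j i)).
- near=> s; have us : A s \in unitmx by near: s.
  by rewrite /invmx us !mxE.
- apply: derivableM; first by apply: derivableV => //; exact: derivable_det.
  apply: derivableM => //; apply: derivable_det => k l.
  by under eq_fun do rewrite !mxE; exact: dA.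
Unshelve. all: by end_near. Qed.

Lemma tower_continuous U n : tower U -> continuous (U n).
Proof. move=> tU; apply: is_derive_continuous => t; exact: tU. Qed.

Lemma tower_derive1n U n : tower U -> derive1n n (U 0%N) = U n.
Proof.
move=> tU; elim: n => [//|n ih]; rewrite derive1nS ih funeqE => t.
by rewrite derive1E; have [_] := tU n t.
Qed.

Lemma tower_shift U m : tower U -> tower (fun n => U (n + m)%N).
Proof. by move=> tU n t; exact: tU. Qed.

Lemma tower_lin c U V : tower U -> tower V -> tower (fun n t => c * U n t + V n t).
Proof.
by move=> tU tV n t; apply: is_derive_addf => //; exact: is_derive_scalef.
Qed.

Lemma tower_affine U c d : tower U -> tower (fun n t => c ^+ n * U n (c * t + d)).
Proof.
move=> tU n t; have := is_derive_scalef (c ^+ n) (is_derive_affine (tU n (c * t + d))).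
by rewrite mulrA -exprSr.
Qed.

Lemma tower_sum m (V : 'I_m -> nat -> R -> R) (c : 'I_m -> R) :
  (forall i, tower (V i)) -> tower (fun n t => \sum_(i < m) c i * V i n t).
Proof.
by move=> tV n t; apply: is_derive_sumf => i; apply: is_derive_scalef; exact: tV.
Qed.

End Towers.

(** * A solution of y^(2K+2) + lambda y^(2K) = 0 with a zero of order 2K+1 at 0 *)

Section FundamentalSolution.
Context {R : realType}.
Variables (K : nat) (lam : R).
Hypothesis lam0 : 0 < lam.
Implicit Types t : R.
Let w := Num.sqrt lam.
Let ww : w * w = lam. Proof. by rewrite -expr2 sqr_sqrtr// ltW. Qed.
Let w0 : 0 < w. Proof. by rewrite sqrtr_gt0. Qed.

(* [iterint j] is the [j]-fold iterated integral from [0] of [cos (w t)]. *)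
Fixpoint iterint (j : nat) (t : R) : R :=
  match j with
  | 0 => cos (w * t)
  | 1 => sin (w * t) / w
  | j'.+2 => (t ^+ j' / j'`!%:R - iterint j' t) / lam
  end.

Let is_derive_cosw t : is_derive t 1 (fun s => cos (w * s)) (- (w * sin (w * t))).
Proof.
have := @is_derive_affine _ cos w 0 t (- sin (w * t)).
under eq_fun do rewrite addr0.
by rewrite addr0 mulrN; apply; exact: is_derive_cos.
Qed.

Let is_derive_sinw t : is_derive t 1 (fun s => sin (w * s)) (w * cos (w * t)).
Proof.
have := @is_derive_affine _ sin w 0 t (cos (w * t)).
under eq_fun do rewrite addr0.
by rewrite addr0; apply; exact: is_derive_sin.
Qed.

Lemma is_derive_monomial (j : nat) (t : R) :
  is_derive t 1 (fun s : R => s ^+ j.+1 / j.+1`!%:R) (t ^+ j / j`!%:R).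
Proof.
under eq_fun do rewrite mulrC.
have /is_derive_eq := is_derive_scalef (j.+1`!%:R^-1) (is_derive_exprf j t).
apply; rewrite factS natrM.
have f0 : (j`!%:R : R) != 0 by rewrite pnatr_eq0 -lt0n fact_gt0.
by field; rewrite f0 nat1r pnatr_eq0.
Qed.

(** The recursion by two comes from cos(w t)'' = - lam cos(w t): with I_j for [iterint j], j + 2
    integrations from 0 give lam I_(j+2) = t^j / j! - I_j, the monomial being the j-fold integral of
    1. *)
Lemma is_derive_iterint j t : is_derive t 1 (iterint j.+1) (iterint j t).
Proof.
elim/ltn_ind: j t => -[_ t|[_ t|j ih t]] /=.
- have := is_derive_scalef w^-1 (is_derive_sinw t).
  rewrite mulrA mulVf ?gt_eqF// mul1r.
  by under eq_fun do rewrite mulrC.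
- have h := is_derive_addf (is_derive_cst (1 : R) t 1) (is_derive_oppf (is_derive_cosw t)).
  rewrite [X in is_derive _ _ X](_ : _ = fun s => lam^-1 * (cst 1 s - cos (w * s))).
    have /is_derive_eq := is_derive_scalef lam^-1 h; apply.
    by rewrite add0r opprK -ww; field; rewrite gt_eqF.
  by rewrite funeqE => s; rewrite expr0 fact0 divr1 mulrC.
- have h := is_derive_addf (is_derive_monomial j t) (is_derive_oppf (ih j (ltnW (ltnSn _)) t)).
  rewrite [X in is_derive _ _ X](_ : _ = fun s => lam^-1 * (s ^+ j.+1 / j.+1`!%:R - iterint j.+1 s)).
    by rewrite [X in is_derive _ _ _ X]mulrC; exact: is_derive_scalef.
  by rewrite funeqE => s; rewrite mulrC.
Qed.

Lemma iterint0 j : (0 < j)%N -> iterint j 0 = 0.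
Proof.
elim/ltn_ind: j => -[//|[_ _|j ih _]] /=; first by rewrite mulr0 sin0 mul0r.
case: j ih => [|j] ih; first by rewrite /= mulr0 cos0 expr0 fact0 divr1 subrr mul0r.
by rewrite ih// expr0n/= mul0r subr0 mul0r.
Qed.

Fixpoint cosw_deriv (m : nat) (t : R) : R :=
  match m with
  | 0 => cos (w * t)
  | 1 => - (w * sin (w * t))
  | m'.+2 => - lam * cosw_deriv m' t
  end.

Lemma is_derive_cosw_deriv m t : is_derive t 1 (cosw_deriv m) (cosw_deriv m.+1 t).
Proof.
elim/ltn_ind: m t => -[_ t|[_ t|m ih t]] //=.
- have h := is_derive_oppf (is_derive_scalef w (is_derive_sinw t)).
  by rewrite mulrA ww -mulNr in h.
- exact: is_derive_scalef (ih m (ltnW (ltnSn _)) t).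
Qed.

(** The n-th derivative of the (2K+1)-fold integral of the cosine: up to index 2K+1 integrations are
    undone, beyond it the cosine is differentiated. *)
Definition fundsol (n : nat) (t : R) : R :=
  if (n <= K.*2.+1)%N then iterint (K.*2.+1 - n) t else cosw_deriv (n - K.*2.+1) t.

Lemma tower_fundsol : tower fundsol.
Proof.
move=> n t; rewrite /fundsol; have [nK|nK] := ltnP n K.*2.+1.
  rewrite (ltnW nK) -(subnSK nK); exact: is_derive_iterint.
have [->|nK'] := eqVneq n K.*2.+1.
  by rewrite leqnn subnn subSnn; exact: (is_derive_cosw_deriv 0).
have nK2 : (n <= K.*2.+1)%N = false by apply/negbTE; rewrite -ltnNge ltn_neqAle eq_sym nK'.
by rewrite nK2 subSn//; exact: is_derive_cosw_deriv.
Qed.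

Lemma fundsol_ode n t : fundsol (n + K.*2.+2) t = - lam * fundsol (n + K.*2) t.
Proof.
rewrite /fundsol.
rewrite [X in if X then _ else _](_ : _ = false); last by lia.
have -> : (n + K.*2.+2 - K.*2.+1)%N = n.+1 by lia.
case: n => [|[|n]] /=.
- rewrite add0n leqnSn subSnn /= -ww.
  by field; rewrite gt_eqF.
- by rewrite add1n leqnn subnn.
rewrite [X in if X then _ else _](_ : _ = false); last by lia.
by have -> : (n.+2 + K.*2 - K.*2.+1)%N = n.+1 by lia.
Qed.

Lemma fundsol0 n : (n <= K.*2)%N -> fundsol n 0 = 0.
Proof. by move=> nK; rewrite /fundsol leqW// iterint0// subn_gt0. Qed.

Lemma fundsol1 : fundsol K.*2.+1 0 = 1.
Proof. by rewrite /fundsol leqnn subnn /= mulr0 cos0. Qed.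

End FundamentalSolution.

(** * Picone's identity for the functional of the Wirtinger-Cimmino inequality *)

Section Picone.
Context {R : realType}.
Implicit Types (u y V : nat -> R -> R) (a b t : R).
Variables (K : nat) (lam : R).

(* The momentum conjugate to [u l] for the functional
   [int (u K.+1)^2 - lam * (u K)^2]. *)
Definition momentum y (l : nat) : R -> R := fun t =>
  (-1) ^+ (K - l) * (y (K.*2.+1 - l)%N t + (l < K)%:R * (lam * y (K.*2 - l.+1)%N t)).

Definition lagrange_form u y : R -> R :=
  fun t => \sum_(l < K.+1) u l t * momentum y l t.

(** The equation is imposed on every derivative, so that a derivative of a solution is again a
    solution. *)
Definition ode_solution y :=
  tower y /\ forall n t, y (n + K.*2.+2)%N t = - lam * y (n + K.*2)%N t.

Lemma momentum_last y t : momentum y K t = y K.+1 t.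
Proof.
rewrite /momentum subnn expr0 mul1r ltnn mul0r addr0.
by congr (y _ _); lia.
Qed.

(** The Hamilton equation of the lowest momentum. The indicator is there because the function of
    index 0 enters the functional undifferentiated exactly when [K] is 0. *)
Lemma is_derive_momentum0 y t : ode_solution y ->
  is_derive t 1 (momentum y 0) (- ((0 == K)%:R * (lam * y K t))).
Proof.
move=> [ty oy]; rewrite /momentum.
have h := is_derive_addf (ty (K.*2.+1 - 0)%N t) (is_derive_scalef (0 < K)%:R (is_derive_scalef lam (ty (K.*2 - 1)%N t))).
have /is_derive_eq := is_derive_scalef ((-1) ^+ (K - 0)) h; apply.
have := oy 0%N t; rewrite !add0n subn0 => ->.
have [K0|K0] := posnP K.
  by rewrite K0 /= expr0 mulr0n mulr1n; ring.
rewrite (_ : (K.*2 - 1).+1 = K.*2)%N; last lia.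
by rewrite eq_sym gtn_eqF// mulr1n mulr0n; ring.
Qed.

Lemma is_derive_momentumS y l t : ode_solution y -> (l < K)%N ->
  is_derive t 1 (momentum y l.+1)
    (- momentum y l t - (l.+1 == K)%:R * (lam * y K t)).
Proof.
move=> [ty oy] lK; rewrite /momentum.
have h := is_derive_addf (ty (K.*2.+1 - l.+1)%N t) (is_derive_scalef (l.+1 < K)%:R (is_derive_scalef lam (ty (K.*2 - l.+2)%N t))).
have /is_derive_eq := is_derive_scalef ((-1) ^+ (K - l.+1)) h; apply.
rewrite lK -(subnSK lK) exprS.
have -> : (K.*2.+1 - l.+1).+1 = (K.*2.+1 - l)%N by lia.
have [lK'|lK'|<-] := ltngtP l.+1 K.
- rewrite (_ : (K.*2 - l.+2).+1 = (K.*2 - l.+1)%N); last lia.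
  by rewrite mulr1n mulr0n; ring.
- by move: lK lK'; lia.
- rewrite subnn expr0 (_ : (l.+1.*2 - l.+1)%N = l.+1); last lia.
  by rewrite mulr1n mulr0n; ring.
Qed.

(** Each momentum has minus the preceding one as its derivative, up to the lambda term at index [K];
    the sum telescopes and leaves the polarised integrand. *)
Lemma is_derive_lagrange u y t : tower u -> ode_solution y ->
  is_derive t 1 (lagrange_form u y) (u K.+1 t * y K.+1 t - lam * (u K t * y K t)).
Proof.
move=> tu sy.
pose dm l := - (if l is l'.+1 then momentum y l' t else 0) - (l == K)%:R * (lam * y K t).
have dmE (l : 'I_K.+1) : is_derive t 1 (momentum y l) (dm l).
  case: l => -[|l] /= lK; rewrite /dm.
    by rewrite oppr0 add0r; exact: is_derive_momentum0.
  exact: is_derive_momentumS.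
have h := @is_derive_sumf _ _ (fun l : 'I_K.+1 => fun s => u l s * momentum y l s) t _
  (fun l => is_derive_mulf (tu l t) (dmE l)).
apply: (is_derive_eq h); rewrite big_split/=.
rewrite big_ord_recr/= momentum_last.
rewrite [X in _ + X](_ : _ = \sum_(l < K.+1) - (u l t * (if l : nat is l'.+1 then momentum y l' t else 0))
   - \sum_(l < K.+1) (l == K :> nat)%:R * (u l t * (lam * y K t))); last first.
  rewrite -sumrN -big_split/=; apply: eq_bigr => l _; rewrite /dm.
  by rewrite mulrBr mulrN mulrCA.
rewrite big_ord_recl/= mulr0 oppr0 add0r.
rewrite [X in _ - X]big_ord_recr/= eqxx mul1r.
rewrite [X in _ - (X + _)]big1 ?add0r; last first.
  by move=> l _; rewrite ltn_eqF ?mul0r.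
rewrite sumrN; ring.
Qed.

Lemma lagrange_form0 u y t : (forall l, (l <= K)%N -> u l t = 0) ->
  lagrange_form u y t = 0.
Proof. by move=> u0; apply: big1 => l _; rewrite u0 ?mul0r// -ltnS. Qed.

(** The polarised integrand is symmetric, so the two sides have the same derivative, and both vanish
    at 0. In symplectic terms, solutions with a zero of order > K at 0 form an isotropic space. *)
Lemma lagrange_symmetric y z t : ode_solution y -> ode_solution z ->
  (forall l, (l <= K)%N -> y l 0 = 0) -> (forall l, (l <= K)%N -> z l 0 = 0) ->
  lagrange_form y z t = lagrange_form z y t.
Proof.
move=> sy sz y0 z0.
pose D s := lagrange_form y z s - lagrange_form z y s.
have dD (s : R) : is_derive s 1 D 0.
  have /is_derive_eq := is_derive_addf (is_derive_lagrange s sy.1 sz) (is_derive_oppf (is_derive_lagrange s sz.1 sy)).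
  by apply; ring.
have D0 : D 0 = 0 by rewrite /D !lagrange_form0 ?subrr.
have := is_derive_0_is_cst t 0 dD; rewrite D0 /D => /eqP.
by rewrite subr_eq0 => /eqP.
Qed.

Lemma ode_solution_shift y m : ode_solution y -> ode_solution (fun n => y (n + m)%N).
Proof.
move=> [ty oy]; split; first exact: tower_shift.
by move=> n t; rewrite addnAC oy addnAC.
Qed.

(* The Wronskian matrix of the solutions [V, V', ..., V^(K)]. *)
Definition hankel V (t : R) : 'M[R]_K.+1 := \matrix_(i, j) V (i + j)%N t.

(** The solutions V, V', ..., V^(K) serve as a moving frame for the jet of [u]. The quadratic form
    [S] in that jet vanishes at both ends, and its derivative is the integrand minus a square. The
    larger interval ]p, q[ makes everything differentiable at [a] and [b] too. *)
Lemma picone u V (a b p q : R) : p < a -> a <= b -> b < q ->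
  tower u -> (forall l, (l <= K)%N -> u l a = 0 /\ u l b = 0) ->
  ode_solution V ->
  (forall i j t, (i <= K)%N -> (j <= K)%N ->
    lagrange_form (fun n => V (n + i)%N) (fun n => V (n + j)%N) t =
    lagrange_form (fun n => V (n + j)%N) (fun n => V (n + i)%N) t) ->
  (forall t, t \in `]p, q[ -> hankel V t \in unitmx) ->
  lam * \int[lebesgue_measure]_(t in `[a, b]) (u K t ^+ 2) <=
  \int[lebesgue_measure]_(t in `[a, b]) (u K.+1 t ^+ 2).
Proof.
move=> pa ab bq tu u0 sV symV unitV.
pose c (i : 'I_K.+1) s := \sum_(j < K.+1) invmx (hankel V s) i j * u j s.
have uc (l : 'I_K.+1) s : s \in `]p, q[ ->
    u l s = \sum_(i < K.+1) c i s * V (i + l)%N s.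
  move=> /unitV uV; pose uv : 'cV[R]_K.+1 := \col_j u j s.
  have : (hankel V s *m (invmx (hankel V s) *m uv)) l 0 = uv l 0 by rewrite mulKVmx.
  rewrite !mxE => <-; apply: eq_bigr => i _; rewrite !mxE mulrC addnC; congr (_ * _).
  by apply: eq_bigr => j _; rewrite mxE.
have dc i s : s \in `]p, q[ -> is_derive s 1 (c i) (derive1 (c i) s).
  move=> spq; rewrite derive1E; apply: DeriveDef => //.
  apply: derivable_sumf => j; apply: derivableM; last by have [] := tu j s.
  apply: derivable_invmx => [i' j'|].
    by under eq_fun do rewrite mxE; have [] := sV.1 (i' + j')%N s.
  near=> z; apply: unitV; near: z; exact: near_in_itvoo.
clearbody c.
(* Only the frame is differentiated here, not the coefficients. For l <= K this is [u l], by [uc];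
   the first discrepancy is [r], at order K+1. *)
pose v l s := \sum_(i < K.+1) c i s * V (i + l)%N s.
pose r s := u K.+1 s - v K.+1 s.
(* Variation of constants: differentiating [uc] at l and comparing with [uc] at l + 1 cancels the
   terms in the derivatives of the frame. The last index has no successor, which leaves [r]. *)
have rel (l : 'I_K.+1) s : s \in `]p, q[ ->
    \sum_(i < K.+1) derive1 (c i) s * V (i + l)%N s = (l == ord_max)%:R * r s.
  move=> spq.
  have h := @is_derive_sumf _ _ (fun i : 'I_K.+1 => fun z => c i z * V (i + l)%N z) s _
    (fun i => is_derive_mulf (dc i s spq) (sV.1 (i + l)%N s)).
  have : u l.+1 s = \sum_(i < K.+1) (derive1 (c i) s * V (i + l)%N s + c i s * V (i + l).+1 s).
    have [_ <-] := tu l s; have [_ <-] := h.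
    apply: near_eq_derive; near=> z; apply: uc; near: z; exact: near_in_itvoo.
  rewrite big_split/= => /eqP; rewrite -subr_eq => /eqP <-.
  under eq_bigr do rewrite -addnS.
  have [->|lK] := eqVneq l ord_max; first by rewrite mul1r.
  have lK' : (l.+1 < K.+1)%N by rewrite ltn_neqAle ltn_ord -val_eqE/= eqSS in lK *; rewrite lK.
  by rewrite mul0r (uc (Ordinal lK') s spq) subrr.
pose S s := \sum_(i < K.+1) c i s * lagrange_form u (fun n => V (n + i)%N) s.
pose f s := u K.+1 s ^+ 2 - lam * u K s ^+ 2 - r s ^+ 2.
have dS s : s \in `]p, q[ -> is_derive s 1 S (f s).
  move=> spq.
  have h := @is_derive_sumf _ _ (fun i : 'I_K.+1 => fun z =>
      c i z * lagrange_form u (fun n => V (n + i)%N) z) s _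
    (fun i => is_derive_mulf (dc i s spq) (is_derive_lagrange s tu (ode_solution_shift i sV))).
  apply: (is_derive_eq h); rewrite big_split/=.
  (* After expanding [u] in the frame, the symmetry [symV] moves the derivatives of the coefficients
     from the momenta to the functions, where [rel] cancels every index but the last. *)
  have -> : \sum_(i < K.+1) derive1 (c i) s * lagrange_form u (fun n => V (n + i)%N) s =
      r s * v K.+1 s.
    transitivity (\sum_(i < K.+1) \sum_(j < K.+1) derive1 (c i) s * c j s *
        lagrange_form (fun n => V (n + j)%N) (fun n => V (n + i)%N) s).
      apply: eq_bigr => i _; rewrite /lagrange_form mulr_sumr.
      under [RHS]eq_bigr do rewrite mulr_sumr.
      rewrite exchange_big/=; apply: eq_bigr => l _.
      rewrite (uc l s spq) mulr_suml mulr_sumr; apply: eq_bigr => j _.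
      by rewrite addnC; ring.
    rewrite exchange_big/= mulr_sumr; apply: eq_bigr => j _.
    transitivity (c j s * \sum_(l < K.+1) (\sum_(i < K.+1) derive1 (c i) s * V (i + l)%N s) *
        momentum (fun n => V (n + j)%N) l s).
      rewrite mulr_sumr; under [RHS]eq_bigr do rewrite mulr_suml mulr_sumr.
      rewrite exchange_big/=; apply: eq_bigr => i _.
      rewrite symV -1?ltnS// /lagrange_form mulr_sumr; apply: eq_bigr => l _.
      by rewrite addnC; ring.
    rewrite (bigD1 ord_max)//= [X in _ * (_ + X)]big1 ?addr0; last first.
      by move=> l /negbTE lK; rewrite rel// lK !mul0r.
    by have /= -> := rel ord_max s spq; rewrite eqxx mul1r momentum_last addnC; ring.
  have -> : \sum_(i < K.+1) c i s * (u K.+1 s * V (K.+1 + i)%N s - lam * (u K s * V (K + i)%N s)) =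
      u K.+1 s * v K.+1 s - lam * u K s ^+ 2.
    have uK : u K s = v K s := uc ord_max s spq.
    rewrite expr2 {3}uK /v !mulr_sumr -sumrB; apply: eq_bigr => i _.
    by rewrite addnC (addnC K); ring.
  (* Completing the square at order K+1: with r = u - v, one has r v + u v = u^2 - r^2. *)
  by rewrite /f /r; ring.
have Sab : S a = 0 /\ S b = 0.
  by split; apply: big1 => i _; rewrite lagrange_form0 ?mulr0// => l /u0[].
have cf s : s \in `]p, q[ -> {for s, continuous f}.
  move=> spq; rewrite /f /r /v.
  have cu n : {for s, continuous (u n)} by exact: tower_continuous.
  have cv : {for s, continuous (v K.+1)}.
    have [dv _] := @is_derive_sumf _ _ (fun i : 'I_K.+1 => fun z => c i z * V (i + K.+1)%N z) s _
      (fun i => is_derive_mulf (dc i s spq) (sV.1 (i + K.+1)%N s)).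
    by apply/differentiable_continuous; rewrite -derivable1_diffP.
  apply: cvgB; last by apply: cvgM; apply: cvgB => //; exact: cu.
  apply: cvgB; first by apply: cvgM; exact: cu.
  by apply: cvgM; [exact: cvg_cst|apply: cvgM; exact: cu].
have abpq s : s \in `[a, b] -> s \in `]p, q[.
  by rewrite !in_itv/= => /andP[as_ sb]; rewrite (lt_le_trans pa)//= (le_lt_trans sb).
clearbody S.
have intf : \int[lebesgue_measure]_(t in `[a, b]) f t = 0.
  rewrite (@Rintegral_FTC_in _ S f a b (fun s hs => dS s (abpq s hs))
    (fun s hs => cf s (abpq s hs)) ab).
  by case: Sab => -> ->; rewrite subrr.
have cu n : continuous (fun s => u n s ^+ 2).
  by move=> s; apply: cvgM; exact: tower_continuous.
have iu n := @continuous_integrable_itv _ _ a b (cu n).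
have ilu : lebesgue_measure.-integrable `[a, b] (EFin \o (fun s => lam * u K s ^+ 2)).
  by apply: continuous_integrable_itv => s; apply: cvgM; [exact: cvg_cst|exact: cu].
rewrite -RintegralZl// -subr_ge0 -RintegralB// -intf.
apply: le_Rintegral => //.
- apply: continuous_compact_integrable; first exact: segment_compact.
  by apply: continuous_in_subspaceT => s /[!inE] /abpq; exact: cf.
- apply: continuous_integrable_itv => s; apply: cvgB; first exact: cu.
  by apply: cvgM; [exact: cvg_cst|exact: cu].
- by move=> s _; rewrite /f gerBl sqr_ge0.
Unshelve. all: by end_near. Qed.

End Picone.

(** * From eigenvalues to the inequality on an arbitrary interval *)

Section Wirtinger.
Context {R : realType}.
Implicit Types (u V : nat -> R -> R) (a b t nu lam : R).

Lemma is_derive_within (D : set R) (f : R -> R) t l :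
  is_derive t 1 f l -> is_deriv_within D f t l.
Proof.
move=> /is_derive1_caratheodory[g [fg cg <-]].
rewrite /is_deriv_within.
have h : (fun y => (f y - f t) / (y - t)) @ t^' --> g t.
  apply: (@cvg_trans _ (g @ t^')); last exact: (continuous_withinNx _ _).1.
  apply: near_eq_cvg; near=> y.
  rewrite fg mulfK// subr_eq0; near: y; exact: nbhs_dnbhs_neq.
apply: cvg_trans h; apply: cvg_app; exact: cvg_within.
Unshelve. all: by end_near. Qed.

(** Used in contrapositive form: one nonzero derivative at the left end shows that a candidate
    eigenfunction is not identically zero. *)
Lemma tower_zero_on V a b n : tower V -> a < b ->
  (forall t, t \in `]a, b[ -> V 0%N t = 0) -> V n a = 0.
Proof.
move=> tV ab V0.
have Vn t : t \in `]a, b[ -> V n t = 0.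
  elim: n t => [//|n ih] t tab; have [_ <-] := tV n t.
  rewrite (@near_eq_derive _ _ _ _ (cst 0) t 1); first by rewrite derive_cst.
  near=> z; apply: ih; near: z; exact: near_in_itvoo.
have cV : V n t @[t --> a^'+] --> V n a.
  by apply: cvg_at_right_filter; exact: tower_continuous.
have /cvg_unique : V n t @[t --> a^'+] --> 0.
  apply: (@cvg_trans _ (cst (0:R) @ a^'+)); last exact: cvg_cst.
  apply: near_eq_cvg; near=> z; rewrite Vn// in_itv/=.
  by apply/andP; split; near: z; [exact: nbhs_right_gt|exact: nbhs_right_lt].
by move=> /(_ _ _ cV) ->.
Unshelve. all: by end_near. Qed.

(** The substitution t |-> b t maps [0, 1] onto [0, b] and multiplies lambda by b^2. *)
Lemma eigenvalue_of_tower k lam b V : 0 < b -> tower V ->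
  (forall t, V (k * 2)%N t + lam * V (k * 2 - 2)%N t = 0) ->
  (forall l, (l < k)%N -> V l 0 = 0 /\ V l b = 0) -> (0 < k)%N ->
  (exists n, V n 0 != 0) -> is_eigenvalue k (lam * b ^+ 2).
Proof.
move=> b0 tV oV V0 k0 [n Vn].
have tU := tower_affine b 0 tV.
exists (fun n t => b ^+ n * V n (b * t + 0)); split.
- split=> [l t _ _|]; first exact: is_derive_within.
  by apply: continuous_subspaceT; exact: (@tower_continuous _ _ (2 * k)%N tU).
- move=> t _; have := oV (b * t + 0); rewrite mulnC => /eqP; rewrite addr_eq0 => /eqP ->.
  rewrite (_ : (2 * k) = (2 * k - 2).+2)%N; last by lia.
  by rewrite !exprS (_ : (2 * k - 2).+2 = 2 * k)%N ?[(2 * k)%N]mulnC; [ring|lia].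
- move=> l /V0[h0 h1]; rewrite mulr0 addr0 h0 mulr1 addr0 h1 mulr0.
  by [].
- apply: contrapT => /forall2NP VF.
  move: Vn; rewrite (tower_zero_on _ tV b0) ?eqxx// => t.
  rewrite in_itv/= => /andP[t0 tb]; have [|/negP] := VF (t / b).
    have tb1 : t / b <= 1 by rewrite ler_pdivrMr// mul1r ltW.
    by case; rewrite in_itv/= tb1 andbT divr_ge0 ?ltW.
  by rewrite negbK expr0 mul1r addr0 (mulrC b) divfK ?(gt_eqF b0)// => /eqP.
Qed.

(** A kernel vector of the matrix gives a combination of the derivatives of [fundsol] that vanishes
    to order K+1 at b; each of them does so at 0 already. *)
Lemma hankel_fundsol_unit K nu lam b : 0 < lam -> is_wirtinger_cimmino K.+1 nu ->
  0 < b -> lam * b ^+ 2 < nu ^+ 2 -> hankel K (fundsol K lam) b \in unitmx.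
Proof.
move=> lam0 [nu0 _ nuP] b0; apply: contraTT; rewrite unitmxE unitfE negbK -leNgt.
move=> /det0P[v v0 vA]; apply: nuP; first by rewrite mulr_gt0// exprn_gt0.
pose V n t := \sum_(i < K.+1) v 0 i * fundsol K lam (n + i)%N t.
have tF := tower_fundsol K lam0.
have tV : tower V.
  apply: (@tower_sum _ _ (fun (i : 'I_K.+1) n => fundsol K lam (n + i)%N)) => i.
  exact: tower_shift.
apply: (eigenvalue_of_tower b0 tV) => //.
- move=> t; rewrite /V mulr_sumr -big_split/= big1// => i _.
  rewrite (_ : K.+1 * 2 + i = i + K.*2.+2)%N; last lia.
  by rewrite fundsol_ode// (_ : K.+1 * 2 - 2 + i = i + K.*2)%N; [ring|lia].
- move=> l lK; split.
    apply: big1 => i _; rewrite fundsol0 ?mulr0//.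
    by have := ltn_ord i; lia.
  have := congr1 (fun A : 'rV_K.+1 => A 0 (Ordinal lK)) vA.
  by rewrite !mxE => <-; apply: eq_bigr => i _; rewrite mxE addnC.
(* With [i] the largest index of a nonzero coefficient, the derivative of order 2K+1-i at 0 picks
   out v_i: the terms of lower index only involve derivatives of [fundsol] of order <= 2K, which
   vanish. *)
- have [i vi imax] : exists2 i : 'I_K.+1, v 0 i != 0 & forall j : 'I_K.+1, v 0 j != 0 -> (j <= i)%N.
    have [i0 vi0] : exists i, v 0 i != 0.
      apply/existsP; apply: contra_neqT v0; rewrite negb_exists => /forallP v0.
      by apply/rowP => i; rewrite mxE; apply/eqP; have := v0 i; rewrite negbK.
    have [i vi imax] := @arg_maxnP _ i0 (fun i => v 0 i != 0) (@nat_of_ord _) vi0.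
    by exists i.
  exists (K.*2.+1 - i)%N; rewrite /V (bigD1 i)//= big1 ?addr0.
    rewrite subnK ?fundsol1 ?mulr1//; by have := ltn_ord i; lia.
  move=> j ji; have [->|vj] := eqVneq (v 0 j) 0; first by rewrite mul0r.
  have := imax _ vj; rewrite leq_eqVlt (negbTE ji : (j == i :> nat) = false)/= => jlti.
  rewrite fundsol0 ?mulr0//; have := ltn_ord i; lia.
Qed.

Theorem wirtinger_inequality K nu a b u : is_wirtinger_cimmino K.+1 nu -> a < b ->
  tower u -> (forall l, (l <= K)%N -> u l a = 0 /\ u l b = 0) ->
  nu ^+ 2 * \int[lebesgue_measure]_(t in `[a, b]) (u K t ^+ 2) <=
  (b - a) ^+ 2 * \int[lebesgue_measure]_(t in `[a, b]) (u K.+1 t ^+ 2).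
Proof.
move=> wn ab tu u0; have [nu0 _ _] := wn.
set I := Rintegral _ _ _; set J := Rintegral _ _ _.
have I0 : 0 <= I by apply: Rintegral_ge0 => t _; exact: sqr_ge0.
have J0 : 0 <= J by apply: Rintegral_ge0 => t _; exact: sqr_ge0.
set L := b - a; have L0 : 0 < L by rewrite subr_gt0.
rewrite leNgt; apply/negP => IJ.
have Ip : 0 < I.
  by rewrite lt_neqAle I0 andbT; apply: contraTneq IJ => <-; rewrite mulr0 -leNgt mulr_ge0 ?sqr_ge0.
have key lam : 0 < lam -> lam * L ^+ 2 < nu ^+ 2 -> lam * I <= J.
  move=> lam0 lamL; pose w := Num.sqrt lam; have w0 : 0 < w by rewrite sqrtr_gt0.
  have ww : lam = w ^+ 2 by rewrite sqr_sqrtr// ltW.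
  have wL : w * L < nu.
    by rewrite -(@ltr_pXn2r _ 2)// ?nnegrE ?mulr_ge0// ?(ltW w0) ?(ltW L0) ?(ltW nu0)// exprMn -ww.
  (* A quarter of the slack in w L < nu, as a length. Enlarging [a, b] by [d] on both sides keeps w
     times the length below nu, and the zero of [V] at a - d stays outside the open window. *)
  pose d := (nu - w * L) / w / 2 / 2.
  have d0 : 0 < d by rewrite !divr_gt0// subr_gt0.
  have wd : w * (L + d + d) < nu.
    have -> : w * (L + d + d) = w * L + (nu - w * L) / 2 by rewrite /d; field; rewrite gt_eqF.
    lra.
  pose V n t := fundsol K lam n (t - (a - d)).
  have tV : tower V.
    move=> n t; have := is_derive_affine (tower_fundsol K lam0 n (1 * t - (a - d))).
    by under eq_fun do rewrite mul1r; rewrite !mul1r.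
  have sV : ode_solution K lam V by split=> // n t; rewrite /V fundsol_ode.
  apply: (@picone _ K lam u V a b (a - d) (b + d)) => //.
  - by rewrite gtrBl.
  - exact: ltW.
  - by rewrite ltrDl.
  - move=> i j t iK jK.
    have sF : ode_solution K lam (fundsol K lam).
      by split=> [|n s]; [exact: tower_fundsol|exact: fundsol_ode].
    have := @lagrange_symmetric _ K lam _ _ (t - (a - d)) (ode_solution_shift i sF) (ode_solution_shift j sF).
    by apply=> l lK; rewrite fundsol0// -addnn leq_add.
  - move=> t; rewrite in_itv/= => /andP[t1 t2].
    apply: (@hankel_fundsol_unit K nu lam (t - (a - d))) => //; first by rewrite subr_gt0.
    rewrite ww -exprMn ltr_pXn2r// ?nnegrE ?mulr_ge0 ?subr_ge0 ?(ltW t1) ?(ltW w0) ?(ltW nu0)//.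
    apply: lt_trans wd; rewrite ltr_pM2l// /L; lra.
have L2 : 0 < L ^+ 2 by rewrite exprn_gt0.
(* If the inequality failed, J / I would lie below nu^2 / L^2; their midpoint is an admissible
   lambda that contradicts [key]. *)
pose lam := (J / I + nu ^+ 2 / L ^+ 2) / 2.
have JI : J / I < nu ^+ 2 / L ^+ 2.
  by rewrite ltr_pdivrMr// mulrAC ltr_pdivlMr// mulrC.
have JI0 : 0 <= J / I by rewrite divr_ge0.
have : lam * I <= J.
  apply: key; first by rewrite /lam; lra.
  by rewrite -ltr_pdivlMr// /lam; lra.
by rewrite -ler_pdivlMr// /lam; lra.
Qed.

End Wirtinger.

(** * Bernstein's inequality in L2 *)

Section IntegrableReal.
Context {R : realType}.
Local Notation mu := (@lebesgue_measure R).
Local Notation itg f := (mu.-integrable [set: R] (EFin \o f)).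
Implicit Types (f g w : R -> R) (a b c t : R).

Lemma itg_measurable f : itg f -> measurable_fun [set: R] f.
Proof. by move=> /measurable_int/measurable_EFinP. Qed.

Lemma itg_le f g : measurable_fun [set: R] f -> (forall t, `|f t| <= g t) ->
  itg g -> itg f.
Proof.
move=> mf fg; apply: le_integrable => //; first exact/measurable_EFinP.
by move=> t _; rewrite /= lee_fin (le_trans (fg t))// ler_norm.
Qed.

Lemma itgD f g : itg f -> itg g -> itg (fun t => f t + g t).
Proof.
move=> hf hg; have := @integrableD _ _ _ mu setT measurableT _ _ hf hg.
by apply: eq_integrable => // t _.
Qed.

Lemma itgZ c f : itg f -> itg (fun t => c * f t).
Proof.
move=> hf; have := @integrableZl _ _ _ mu setT measurableT c _ hf.
by apply: eq_integrable => // t _.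
Qed.

Lemma itgN f : itg f -> itg (fun t => - f t).
Proof.
by move=> /(itgZ (-1)); apply: eq_integrable => // t _; rewrite /= mulN1r.
Qed.

Lemma itgB f g : itg f -> itg g -> itg (fun t => f t - g t).
Proof. by move=> hf /itgN; exact: itgD. Qed.

Lemma itg_norm f : itg f -> itg (fun t => `|f t|).
Proof.
move=> hf; apply: (@le_integrable _ _ _ mu _ measurableT _ (EFin \o f)) => //.
  by apply/measurable_EFinP; apply: measurableT_comp => //; exact: itg_measurable.
by move=> t _; rewrite /= normr_id.
Qed.

Lemma ge0_itgP f : measurable_fun [set: R] f -> (forall t, 0 <= f t) ->
  itg f <-> (\int[mu]_t (f t)%:E < +oo)%E.
Proof.
move=> mf f0; split=> [/integrableP[_]|fy].
  by under eq_integral do rewrite /= ger0_norm//.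
apply/integrableP; split; first exact/measurable_EFinP.
by under eq_integral do rewrite /= ger0_norm//.
Qed.

Lemma itg_fineK f : itg f -> (\int[mu]_t (f t)%:E = (\int[mu]_t f t)%:E)%E.
Proof. by move=> hf; rewrite /Rintegral fineK//; exact: integrable_fin_num. Qed.

Lemma RintD f g : itg f -> itg g ->
  \int[mu]_t (f t + g t) = \int[mu]_t f t + \int[mu]_t g t.
Proof. by move=> hf hg; rewrite RintegralD. Qed.

Lemma RintB f g : itg f -> itg g ->
  \int[mu]_t (f t - g t) = \int[mu]_t f t - \int[mu]_t g t.
Proof. by move=> hf hg; rewrite RintegralB. Qed.

Lemma RintZ c f : itg f -> \int[mu]_t (c * f t) = c * \int[mu]_t f t.
Proof. by move=> hf; rewrite RintegralZl. Qed.

Lemma ler_Rint f g : itg f -> itg g -> (forall t, f t <= g t) ->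
  \int[mu]_t f t <= \int[mu]_t g t.
Proof. by move=> hf hg fg; apply: le_Rintegral. Qed.

Lemma itg_subset f (D : set R) : measurable D -> itg f -> mu.-integrable D (EFin \o f).
Proof. by move=> mD; apply: integrableS. Qed.

Lemma ge0_Rintegral_subset f (D : set R) : measurable D -> itg f ->
  (forall t, 0 <= f t) -> \int[mu]_(t in D) f t <= \int[mu]_t f t.
Proof.
move=> mD hf f0; rewrite /Rintegral fine_le//.
- by apply: integrable_fin_num => //; exact: itg_subset.
- exact: integrable_fin_num.
- apply: ge0_subset_integral => //; first exact: (measurable_int mu).
  by move=> t _; rewrite lee_fin.
Qed.

(** Gives the Cauchy-Schwarz inequalities below and, with [A] = 0, the orthogonality of the nearest
    point. *)
Lemma quadratic_discriminant (A B C : R) :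
  (forall s : R, 0 <= A + 2 * s * B + s ^+ 2 * C) -> B ^+ 2 <= A * C.
Proof.
move=> h; have A0 : 0 <= A by have := h 0; rewrite mulr0 mul0r expr0n/= mul0r !addr0.
have [C0|C0] := leP C 0.
  have B0 : B = 0.
    apply/eqP; apply: contraT => B0.
    (* This choice makes the linear term -2 (A + 1), more than [A] can compensate. *)
    have := h (- (A + 1) / B).
    have -> : 2 * (- (A + 1) / B) * B = - 2 * (A + 1) by field.
    have : (- (A + 1) / B) ^+ 2 * C <= 0 by rewrite mulr_ge0_le0 ?sqr_ge0.
    by lra.
  have [C1|C1] := eqVneq C 0; first by rewrite B0 C1 expr0n mulr0.
  have Cn : C < 0 by rewrite lt_neqAle C1.
  pose s := 1 - A / C.
  have AC : A / C <= 0 by rewrite mulr_ge0_le0// invr_le0.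
  have s1 : 1 <= s by rewrite /s lerBrDl gerDr.
  have := h s; rewrite B0 mulr0 addr0.
  have : s ^+ 2 * C <= s * C by rewrite ler_nM2r// expr2 ler_peMr// (le_trans _ s1).
  have -> : s * C = C - A by rewrite /s mulrBl mul1r divfK.
  by lra.
have := h (- B / C).
have -> : A + 2 * (- B / C) * B + (- B / C) ^+ 2 * C = (A * C - B ^+ 2) / C by field; rewrite gt_eqF.
by rewrite pmulr_lge0 ?invr_gt0// subr_ge0.
Qed.

Lemma weighted_cauchy_schwarz f g w : (forall t, 0 <= w t) ->
  itg (fun t => f t ^+ 2 * w t) -> itg (fun t => g t ^+ 2 * w t) ->
  itg (fun t => f t * g t * w t) ->
  (\int[mu]_t (f t * g t * w t)) ^+ 2 <=
  \int[mu]_t (f t ^+ 2 * w t) * \int[mu]_t (g t ^+ 2 * w t).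
Proof.
move=> w0 hf hg hfg; apply: quadratic_discriminant => s.
rewrite -!RintegralZl// -?RintegralD//; try exact: itgZ.
  apply: Rintegral_ge0 => t _.
  have -> : f t ^+ 2 * w t + 2 * s * (f t * g t * w t) + s ^+ 2 * (g t ^+ 2 * w t) =
    (f t + s * g t) ^+ 2 * w t by ring.
  by rewrite mulr_ge0 ?sqr_ge0.
by apply: itgD => //; exact: itgZ.
Qed.

Lemma measurable_funMM f g : measurable_fun [set: R] f -> measurable_fun [set: R] g ->
  measurable_fun [set: R] (fun t => f t * g t).
Proof. exact: measurable_funM. Qed.

Lemma itg_mul_weighted f g w : measurable_fun [set: R] (fun t => f t * g t * w t) ->
  (forall t, 0 <= w t) ->
  itg (fun t => f t ^+ 2 * w t) -> itg (fun t => g t ^+ 2 * w t) ->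
  itg (fun t => f t * g t * w t).
Proof.
move=> mfg w0 hf hg; apply: itg_le mfg _ (itgD hf hg) => t.
rewrite !normrM (ger0_norm (w0 t)) -mulrDl ler_wpM2r//.
rewrite -(real_normK (num_real (f t))) -(real_normK (num_real (g t))).
by have := normr_ge0 (f t); have := normr_ge0 (g t); nra.
Qed.

End IntegrableReal.

(** * The kernel 1 / (1 + b^2 (s - c)^2) *)

Section CauchyKernel.
Context {R : realType}.
Local Notation mu := (@lebesgue_measure R).
Implicit Types (a b c s t : R).

(** One family with two uses: centred at 0 it is the weight in Bernstein's inequality, and rescaled
    to mass 1 it is the Poisson kernel. *)
Definition cauchy_kernel b c s : R := (1 + (b * (s - c)) ^+ 2)^-1.

Lemma cauchy_kernelV_gt0 b c t : 0 < 1 + (b * (t - c)) ^+ 2.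
Proof. by rewrite ltr_pwDl// sqr_ge0. Qed.

Lemma cauchy_kernel_gt0 b c t : 0 < cauchy_kernel b c t.
Proof. by rewrite invr_gt0 cauchy_kernelV_gt0. Qed.

Lemma is_derive_cauchy_primitive b c t : 0 < b ->
  is_derive t 1 (fun s => b^-1 * atan (b * (s - c))) (cauchy_kernel b c t).
Proof.
move=> b0; have h := @is_derive_affine _ atan b (- (b * c)) t _ (is_derive1_atan (b * t + - (b * c))).
have := is_derive_scalef b^-1 h; rewrite mulKf ?gt_eqF// /cauchy_kernel mulrBr.
by under eq_fun do rewrite -mulrBr.
Qed.

Lemma continuous_cauchy_kernel b c : continuous (cauchy_kernel b c).
Proof.
move=> t; rewrite /cauchy_kernel; apply: cvgV; first exact/lt0r_neq0/cauchy_kernelV_gt0.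
apply: cvgD; first exact: cvg_cst.
have h : (b * (x - c)) @[x --> t] --> b * (t - c).
  by apply: cvgM; [exact: cvg_cst|apply: cvgB; [exact: cvg_id|exact: cvg_cst]].
by apply: cvgM.
Qed.

Lemma itg_cauchy_kernel b c : 0 < b ->
  mu.-integrable [set: R] (EFin \o cauchy_kernel b c).
Proof.
move=> b0; have ck := @continuous_cauchy_kernel b c.
apply: (@ge0_windows_integrable _ _ (pi / b)).
- exact: continuous_measurable.
- by move=> t; exact: ltW (cauchy_kernel_gt0 b c t).
- move=> n; have i := continuous_integrable_itv (- n%:R) n%:R ck.
  rewrite -[leLHS]fineK ?integrable_fin_num// lee_fin -/(Rintegral _ _ _).
  rewrite (Rintegral_FTC (fun t => is_derive_cauchy_primitive c t b0) ck); last first.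
    by rewrite ge0_cp// ler0n.
  rewrite -mulrBr mulrC ler_pM2r ?invr_gt0//.
  have := atan_ltpi2 (b * (n%:R - c)); have := atan_gtNpi2 (b * (- n%:R - c)).
  by lra.
Qed.

Lemma Rint_cauchy_kernel b c : 0 < b -> \int[mu]_t cauchy_kernel b c t = pi / b.
Proof.
move=> b0; have ck := @continuous_cauchy_kernel b c.
have vy : b * (t - c) @[t --> +oo] --> +oo.
  apply/cvgryPge => A; near=> t.
  rewrite mulrC -ler_pdivrMr// lerBrDr; near: t; apply: nbhs_pinfty_ge; exact: num_real.
have ly : b^-1 * atan (b * (t - c)) @[t --> +oo] --> b^-1 * (pi / 2).
  by apply: cvgM; [exact: cvg_cst|exact: (@cvg_comp _ _ _ (fun t => b * (t - c)) atan _ _ _ vy (@cvgy_atan R))].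
have lNy : b^-1 * atan (b * (t - c)) @[t --> -oo] --> b^-1 * (- (pi / 2)).
  apply: cvgM; [exact: cvg_cst|]; apply/cvgNy_compNP.
  rewrite (_ : _ \o _ = (fun t => - atan (b * (t + c)))); last first.
    by rewrite funeqE => t; rewrite /= -atanN; congr atan; ring.
  apply: cvgN; have vy' : b * (t + c) @[t --> +oo] --> +oo.
    apply/cvgryPge => A; near=> t.
    rewrite mulrC -ler_pdivrMr// -lerBlDr; near: t; apply: nbhs_pinfty_ge; exact: num_real.
  exact: (@cvg_comp _ _ _ (fun t => b * (t + c)) atan _ _ _ vy' (@cvgy_atan R)).
rewrite (RintegralT_FTC (fun t => is_derive_cauchy_primitive c t b0) ck (itg_cauchy_kernel c b0) ly lNy).
by field; rewrite gt_eqF.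
Unshelve. all: by end_near. Qed.

End CauchyKernel.

(** * Bernstein's inequality for real towers with exponential bounds *)

Section Bernstein.
Context {R : realType}.
Local Notation mu := (@lebesgue_measure R).
Local Notation itg f := (mu.-integrable [set: R] (EFin \o f)).
Implicit Types (U : nat -> R -> R) (a c s t : R).

(** The weight makes squares of bounded functions integrable, tends to 1 as a tends to 0, and
    satisfies |rho'| <= a rho because 2 a |t| <= 1 + (a t)^2. *)
Let rho a t : R := (1 + (a * t) ^+ 2)^-1.

Let rhoV_gt0 a t : 0 < 1 + (a * t) ^+ 2.
Proof. by rewrite ltr_pwDl// sqr_ge0. Qed.

Let rho_gt0 a t : 0 < rho a t. Proof. by rewrite invr_gt0. Qed.

Let dr a t := - (rho a t ^+ 2) * (a ^+ 2 * (2 * t)).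

Let is_derive_rho a t : is_derive t 1 (rho a) (dr a t).
Proof.
have h : is_derive t 1 (fun s : R => 1 + (a * s) ^+ 2) (a ^+ 2 * (2 * t)).
  under eq_fun do rewrite exprMn.
  have := is_derive_addf (is_derive_cst (1 : R) t 1) (is_derive_scalef (a ^+ 2) (is_derive_exprf 1 t)).
  by rewrite add0r expr1.
have := @is_deriveV _ (fun s => 1 + (a * s) ^+ 2) t _ 1 (lt0r_neq0 (rhoV_gt0 a t)) h.
by rewrite -exprVn.
Qed.

Let crho a : continuous (rho a).
Proof. exact: is_derive_continuous (is_derive_rho a). Qed.

Let dr_le a t : 0 < a -> `|dr a t| <= a * rho a t.
Proof.
move=> a0.
have -> : `|dr a t| = rho a t * (rho a t * (a ^+ 2 * (2 * `|t|))).
  rewrite /dr normrM normrN (ger0_norm (sqr_ge0 _)).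
  by rewrite !normrM (gtr0_norm a0) (ger0_norm (ler0n _ 2)); ring.
rewrite mulrC ler_wpM2r ?(ltW (rho_gt0 a t))//.
rewrite /rho ler_pdivrMl// exprMn -(real_normK (num_real t)); set y := `|t|.
rewrite -subr_ge0; have -> : (1 + a ^+ 2 * y ^+ 2) * a - a ^+ 2 * (2 * y) = a * (1 - a * y) ^+ 2 by ring.
by rewrite mulr_ge0 ?sqr_ge0// ltW.
Qed.

Let mrho a : measurable_fun [set: R] (rho a).
Proof. by apply: continuous_measurable; exact: crho. Qed.

Let rhoE a : rho a = cauchy_kernel a 0.
Proof. by rewrite funeqE => t; rewrite /cauchy_kernel subr0. Qed.

Let itg_rho a : 0 < a -> itg (rho a).
Proof. by move=> a0; rewrite rhoE; exact: itg_cauchy_kernel. Qed.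

Let int_rho_le a : 0 < a -> \int[mu]_t rho a t <= pi / a.
Proof. by move=> a0; rewrite rhoE Rint_cauchy_kernel. Qed.

Variables (U : nat -> R -> R) (C sigma : R).
Hypotheses (tU : tower U) (sigma0 : 0 < sigma) (C0 : 0 <= C).
Hypothesis UC : forall m t, `|U m t| <= C * sigma ^+ m.
Hypothesis itgU0 : itg (fun t => U 0%N t ^+ 2).

Let mU n : measurable_fun [set: R] (U n).
Proof. by apply: continuous_measurable; exact: tower_continuous. Qed.

Let U2C m t : U m t ^+ 2 <= C ^+ 2 * sigma ^+ (2 * m).
Proof.
rewrite mulnC exprM -exprMn -(real_normK (num_real (U m t))).
by rewrite ler_pXn2r ?nnegrE ?mulr_ge0 ?exprn_ge0// ltW.
Qed.

Let J a m := \int[mu]_t (U m t ^+ 2 * rho a t).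

Let itgJ a m : 0 < a -> itg (fun t => U m t ^+ 2 * rho a t).
Proof.
move=> a0; apply: (itg_le _ _ (itgZ (C ^+ 2 * sigma ^+ (2 * m)) (itg_rho a0))).
  by apply: measurable_funMM => //; exact: measurable_funX.
move=> t; rewrite ger0_norm ?(mulr_ge0 (sqr_ge0 _) (ltW (rho_gt0 a t)))//.
by rewrite ler_wpM2r ?(ltW (rho_gt0 _ _)).
Qed.

Let J_le a m : 0 < a -> J a m <= C ^+ 2 * sigma ^+ (2 * m) * (pi / a).
Proof.
move=> a0; apply: (@le_trans _ _ (C ^+ 2 * sigma ^+ (2 * m) * \int[mu]_t rho a t)).
  rewrite -RintZ ?itg_rho//; apply: ler_Rint; first exact: itgJ.
    by apply: itgZ; exact: itg_rho.
  by move=> t; rewrite ler_wpM2r ?(ltW (rho_gt0 _ _)).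
by rewrite ler_wpM2l ?int_rho_le// (mulr_ge0 (sqr_ge0 _) (exprn_ge0 _ (ltW sigma0))).
Qed.

Let J_ge0 a m : 0 <= J a m.
Proof. by apply: Rintegral_ge0 => t _; rewrite mulr_ge0 ?sqr_ge0// ltW. Qed.

Let x a m := Num.sqrt (J a m).

Let rho_cvg0 a : 0 < a -> (rho a t @[t --> +oo] --> 0) /\ (rho a t @[t --> -oo] --> 0).
Proof.
move=> a0; have h : rho a t @[t --> +oo] --> 0.
  apply/cvgrPdist_le => e e0; near=> t.
  rewrite sub0r normrN ger0_norm ?(ltW (rho_gt0 a t))// /rho invf_ple ?posrE//.
  have t1 : e^-1 / a <= t by near: t; apply: nbhs_pinfty_ge; exact: num_real.
  have at1 : e^-1 <= a * t by rewrite mulrC -ler_pdivrMr.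
  by have := sqr_ge0 (a * t - 1); nra.
split=> //; apply/cvgNy_compNP.
by rewrite (_ : _ \o _ = rho a)// funeqE => t; rewrite /= /rho mulrN sqrrN.
Unshelve. all: by end_near. Qed.

(** Integrate the derivative of U_m U_(m+1) rho over the line: the boundary terms vanish since the U
    are bounded, and Cauchy-Schwarz bounds the rest. Where x is positive this says that the ratio
    x_(m+1) / x_m drops by at most [a] when m increases by one. *)
Let J_rec a m : 0 < a -> x a m.+1 ^+ 2 <= x a m * x a m.+2 + a * x a m * x a m.+1.
Proof.
move=> a0.
(* The logarithmic derivative of the weight: with rho' = k rho, the error term is again a pairing
   with weight [rho]. *)
pose k t := - (rho a t * (a ^+ 2 * (2 * t))).
have drE t : dr a t = k t * rho a t by rewrite /dr /k expr2; ring.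
have k2 t : k t ^+ 2 <= a ^+ 2.
  have := dr_le t a0; rewrite drE normrM (ger0_norm (ltW (rho_gt0 a t))) ler_pM2r//.
  move=> ka; rewrite -(real_normK (num_real (k t))).
  by rewrite ler_pXn2r ?nnegrE ?(ltW a0).
have ck : continuous k.
  move=> t; apply: cvgN; apply: cvgM; first exact: crho.
  by apply: cvgM; [exact: cvg_cst|apply: cvgM; [exact: cvg_cst|exact: cvg_id]].
have mk : measurable_fun [set: R] k by exact: continuous_measurable.
have i1 : itg (fun t => U m t * U m.+2 t * rho a t).
  apply: itg_mul_weighted; try exact: itgJ.
    by do 2 apply: measurable_funMM => //.
  by move=> t; exact: ltW.
pose v t := U m.+1 t * k t.
have iv : itg (fun t => v t ^+ 2 * rho a t).
  apply: (itg_le _ _ (itgZ (a ^+ 2) (itgJ m.+1 a0))).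
    by apply: measurable_funMM => //; apply: measurable_funX; exact: measurable_funMM.
  move=> t; rewrite ger0_norm ?(mulr_ge0 (sqr_ge0 _) (ltW (rho_gt0 a t)))//.
  rewrite mulrA ler_wpM2r ?(ltW (rho_gt0 a t))// /v exprMn mulrC.
  by rewrite ler_wpM2r// sqr_ge0.
have ivJ : \int[mu]_t (v t ^+ 2 * rho a t) <= a ^+ 2 * J a m.+1.
  have -> : a ^+ 2 * J a m.+1 = \int[mu]_t (a ^+ 2 * (U m.+1 t ^+ 2 * rho a t)).
    by rewrite RintegralZl//; exact: itgJ.
  apply: le_Rintegral => //; first by apply: itgZ; exact: itgJ.
  move=> t _; rewrite mulrA ler_wpM2r ?(ltW (rho_gt0 a t))// /v exprMn mulrC.
  by rewrite ler_wpM2r// sqr_ge0.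
have i2 : itg (fun t => U m t * v t * rho a t).
  apply: itg_mul_weighted => //; last exact: itgJ.
    by apply: measurable_funMM => //; apply: measurable_funMM => //; exact: measurable_funMM.
  by move=> t; exact: ltW.
have dF t : is_derive t 1 (fun s => U m s * U m.+1 s * rho a s)
    (U m.+1 t ^+ 2 * rho a t + U m t * U m.+2 t * rho a t + U m t * v t * rho a t).
  have h := is_derive_mulf (is_derive_mulf (tU m t) (tU m.+1 t)) (is_derive_rho a t).
  by apply: (is_derive_eq h); rewrite drE /v; ring.
have i12 := itgD (itgJ m.+1 a0) i1.
have U0 (F : set_system R) : Filter F -> rho a t @[t --> F] --> 0 ->
    U m t * U m.+1 t * rho a t @[t --> F] --> 0.
  move=> FF r0; pose D := C * sigma ^+ m * (C * sigma ^+ m.+1).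
  apply: (@squeeze_cvgr _ _ _ _ (fun t => - (D * rho a t)) (fun t => D * rho a t)).
  - apply: nearW => t; rewrite -ler_norml !normrM (ger0_norm (ltW (rho_gt0 a t))).
    by rewrite ler_wpM2r ?(ltW (rho_gt0 a t))// ler_pM.
  - by rewrite -[X in _ --> X]oppr0 -(mulr0 D); apply: cvgN; apply: cvgM => //; exact: cvg_cst.
  - by rewrite -[X in _ --> X](mulr0 D); apply: cvgM => //; exact: cvg_cst.
have [ry rNy] := rho_cvg0 a0.
have cU n : continuous (U n) by exact: tower_continuous.
have cF : continuous (fun t => U m.+1 t ^+ 2 * rho a t + U m t * U m.+2 t * rho a t +
    U m t * v t * rho a t).
  move=> t; do 2?apply: cvgD.
  - by apply: cvgM; [apply: cvgM; exact: cU|exact: crho].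
  - by apply: cvgM; [apply: cvgM; exact: cU|exact: crho].
  - by apply: cvgM; [apply: cvgM; [exact: cU|apply: cvgM; [exact: cU|exact: ck]]|exact: crho].
have := @RintegralT_FTC _ _ _ 0 0 dF cF (itgD i12 i2) (U0 _ _ ry) (U0 _ _ rNy).
rewrite subrr (RintD i12 i2) (RintD (itgJ m.+1 a0) i1) => eq0.
have {}eq0 : J a m.+1 = - (\int[mu]_t (U m t * U m.+2 t * rho a t)) - (\int[mu]_t (U m t * v t * rho a t)).
  by rewrite -opprD; apply/eqP; rewrite -addr_eq0 addrA; apply/eqP; exact: eq0.
have cs1 := weighted_cauchy_schwarz (fun t => ltW (rho_gt0 a t)) (itgJ m a0) (itgJ m.+2 a0) i1.
have cs2 := weighted_cauchy_schwarz (fun t => ltW (rho_gt0 a t)) (itgJ m a0) iv i2.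
have b1 : `|\int[mu]_t (U m t * U m.+2 t * rho a t)| <= x a m * x a m.+2.
  by rewrite -sqrtr_sqr /x -sqrtrM// ler_wsqrtr.
have b2 : `|\int[mu]_t (U m t * v t * rho a t)| <= a * x a m * x a m.+1.
  rewrite -sqrtr_sqr -{2}(sqr_sqrtr (ltW a0)).
  have -> : Num.sqrt a ^+ 2 = Num.sqrt (a ^+ 2) by rewrite sqr_sqrtr ?ltW// sqrtr_sqr gtr0_norm.
  rewrite /x -sqrtrM ?sqr_ge0// -sqrtrM ?(mulr_ge0 (sqr_ge0 _) (J_ge0 _ _))//.
  apply: ler_wsqrtr; apply: (le_trans cs2).
  by rewrite -/(J a m) mulrAC [leRHS]mulrC; apply: ler_wpM2l.
rewrite sqr_sqrtr// eq0 -opprD; apply: le_trans (ler_norm _) _.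
by rewrite normrN (le_trans (ler_normD _ _))// lerD.
Qed.

(* If [x 1 >= (sigma + 2 eta) x 0] with weight parameter [eta / N], the first [N]
   ratios [x (j + 1) / x j] stay above [sigma + eta]. *)
Let x_growth (eta : R) (N : nat) a : 0 < eta -> 0 < a -> a * N%:R <= eta ->
  0 < x a 0 -> (sigma + 2 * eta) * x a 0 <= x a 1 ->
  (sigma + eta) ^+ N * x a 0 <= x a N.
Proof.
move=> eta0 a0 aN x0 x1; have s0 := sigma0.
have h j : (j <= N)%N -> 0 < x a j /\ (sigma + 2 * eta - a * j%:R) * x a j <= x a j.+1.
  elim: j => [_|j ih jN]; first by rewrite mulr0 subr0.
  have [xj xj1] := ih (ltnW jN).
  have aj : a * j.+1%:R <= eta.
    by apply: le_trans aN; rewrite ler_pM2l// ler_nat.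
  have aj' : a * j%:R <= eta by apply: le_trans aj; rewrite ler_pM2l// ler_nat.
  have xj1p : 0 < x a j.+1.
    by apply: lt_le_trans xj1; rewrite mulr_gt0//; lra.
  split=> //; have rec := J_rec j a0.
  rewrite -(ler_pM2l xj); apply: (@le_trans _ _ (x a j.+1 ^+ 2 - a * x a j * x a j.+1)); last by lra.
  have -> : a * j.+1%:R = a * j%:R + a by rewrite -natr1 mulrDr mulr1.
  have : (sigma + 2 * eta - a * j%:R) * x a j * x a j.+1 <= x a j.+1 ^+ 2.
    by rewrite expr2 ler_pM2r.
  by lra.
elim: N aN h => [|N ih] aN h; first by rewrite expr0 mul1r.
have aN' : a * N%:R <= eta by apply: le_trans aN; rewrite ler_pM2l// ler_nat.
rewrite exprS -mulrA; apply: (@le_trans _ _ ((sigma + eta) * x a N)).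
  rewrite ler_pM2l ?addr_gt0//; apply: ih => // j jN; apply: h; exact: leqW.
have [xN xN1] := h N (leqnSn N); apply: le_trans xN1.
by rewrite ler_pM2r//; lra.
Qed.

Let x_zero a : 0 < a -> x a 0 = 0 -> x a 1 = 0.
Proof.
move=> a0 x0; have := J_rec 0 a0; rewrite x0 mulr0 !mul0r addr0 => h.
by apply/eqP; rewrite -sqrf_eq0 eq_le h sqr_ge0.
Qed.

Let J_mono a b m : 0 < a -> a <= b -> J b m <= J a m.
Proof.
move=> a0 ab; apply: ler_Rint => [||t]; first exact/itgJ/(lt_le_trans a0).
  exact: itgJ.
rewrite ler_wpM2l ?sqr_ge0// /rho lef_pV2 ?posrE// lerD2l !exprMn ler_wpM2r ?sqr_ge0//.
by rewrite ler_pXn2r ?nnegrE ?(ltW a0)// (le_trans (ltW a0)).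
Qed.

(** Otherwise, for every N >= N0 and a = eta / N, [x_growth] and [J_le] give (1 + eta / sigma)^(2N)
    J_0 <= C^2 pi / a. By Bernoulli's inequality the left side is at least N^2 (eta / sigma)^2 J_0,
    so N J_0 stays bounded. But J_0 only grows as a decreases, a contradiction. *)
Let J_ratio (eta : R) (N0 : nat) : 0 < eta -> (0 < N0)%N ->
  exists2 N, (N0 <= N)%N & J (eta / N%:R) 1 <= (sigma + 2 * eta) ^+ 2 * J (eta / N%:R) 0.
Proof.
move=> eta0 N00; apply: contrapT => /forall2NP nh.
have {}nh N : (N0 <= N)%N -> (sigma + 2 * eta) ^+ 2 * J (eta / N%:R) 0 < J (eta / N%:R) 1.
  by move=> NN; rewrite ltNge; apply/negP; have [] := nh N.
have se : 0 < sigma + 2 * eta by rewrite addr_gt0// mulr_gt0.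
have aN N : (N0 <= N)%N -> 0 < eta / N%:R.
  by move=> NN; rewrite divr_gt0// ltr0n (leq_trans N00).
have x0 N : (N0 <= N)%N -> 0 < J (eta / N%:R) 0.
  move=> NN; rewrite lt_neqAle J_ge0 andbT; apply/negP => /eqP J0.
  have := x_zero (aN _ NN); rewrite /x -J0 sqrtr0 => /(_ erefl) /eqP.
  rewrite sqrtr_eq0 => J1; have := nh _ NN; rewrite -J0 mulr0 => /lt_le_trans/(_ J1).
  by rewrite ltxx.
(* The bound on N J_0: the quantity C^2 pi / a with a = eta / N, divided by (eta / sigma)^2 N. *)
pose E := C ^+ 2 * pi * sigma ^+ 2 / eta ^+ 3.
have main N : (N0 <= N)%N -> N%:R * J (eta / N0%:R) 0 <= E.
  move=> NN; set a := eta / N%:R; have a0 : 0 < a by exact: aN.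
  have Np : (0 : R) < N%:R by rewrite ltr0n (leq_trans N00).
  have aNe : a * N%:R = eta by rewrite /a divfK// gt_eqF.
  have xp : 0 < x a 0 by rewrite sqrtr_gt0; exact: x0.
  have x1 : (sigma + 2 * eta) * x a 0 <= x a 1.
    rewrite /x -{1}(ger0_norm (ltW se)) -sqrtr_sqr -sqrtrM ?sqr_ge0//.
    by apply: ler_wsqrtr; apply: ltW; exact: nh.
  have := @x_growth eta N a eta0 a0; rewrite aNe lexx => /(_ isT xp x1) gr.
  have gr2 : (sigma + eta) ^+ (2 * N) * J a 0 <= C ^+ 2 * sigma ^+ (2 * N) * (pi / a).
    apply: le_trans (J_le N a0); rewrite mulnC exprM -{1}(sqr_sqrtr (J_ge0 a 0)) -exprMn.
    rewrite -[leRHS](sqr_sqrtr (J_ge0 a N)) ler_pXn2r ?nnegrE ?sqrtr_ge0//.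
    by rewrite mulr_ge0 ?sqrtr_ge0// exprn_ge0// addr_ge0// ltW.
  have bern : 1 + eta / sigma *+ N <= (1 + eta / sigma) ^+ N.
    have q0 : 0 <= eta / sigma by rewrite divr_ge0 ?ltW.
    elim: (N) => [|n ihn]; first by rewrite mulr0n addr0 expr0.
    rewrite exprS; apply: (@le_trans _ _ ((1 + eta / sigma) * (1 + eta / sigma *+ n))).
      rewrite mulrSr; have : 0 <= eta / sigma * (eta / sigma *+ n) by rewrite mulr_ge0// mulrn_wge0.
      by lra.
    by rewrite ler_pM2l// ltr_pwDl.
  have bern2 : (eta / sigma * N%:R) ^+ 2 * sigma ^+ (2 * N) <= (sigma + eta) ^+ (2 * N).
    have -> : sigma + eta = (1 + eta / sigma) * sigma by field; rewrite gt_eqF.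
    rewrite [leRHS]exprMn ler_pM2r ?exprn_gt0// mulnC exprM ler_pXn2r// ?nnegrE.
    - by apply: le_trans bern; rewrite mulr_natr lerDr.
    - by rewrite mulr_ge0 ?divr_ge0 ?ltW.
    - by rewrite exprn_ge0// addr_ge0// divr_ge0 ?ltW.
  have s2N : 0 < sigma ^+ (2 * N) by rewrite exprn_gt0.
  have gr3 : (eta / sigma * N%:R) ^+ 2 * J a 0 <= C ^+ 2 * (pi / a).
    rewrite -(ler_pM2r s2N) -[leRHS]mulrAC.
    by apply: le_trans gr2; rewrite mulrAC ler_wpM2r.
  have gr4 : N%:R * J a 0 <= E.
    rewrite -(ler_pM2l (_ : 0 < (eta / sigma) ^+ 2 * N%:R)); last first.
      by rewrite mulr_gt0// exprn_gt0// divr_gt0.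
    have -> : (eta / sigma) ^+ 2 * N%:R * E = C ^+ 2 * (pi / a).
      by rewrite /E /a; field; rewrite !gt_eqF.
    have -> : (eta / sigma) ^+ 2 * N%:R * (N%:R * J a 0) = (eta / sigma * N%:R) ^+ 2 * J a 0.
      by ring.
    exact: gr3.
  apply: le_trans gr4; rewrite ler_pM2l//; apply: J_mono => //.
  rewrite /a; apply: ler_wpM2l; first exact: ltW.
  have N0p : (0 : R) < N0%:R by rewrite ltr0n.
  by rewrite (lef_pV2 Np N0p) ler_nat.
have J0 := x0 _ (leqnn N0); set j := J (eta / N0%:R) 0 in J0 main.
have [N NE] : exists N : nat, E / j < N%:R.
  by exists (Num.truncn `|E / j|).+1; apply: le_lt_trans (ler_norm _) (truncnS_gt _).
have := main (maxn N N0) (leq_maxr _ _); rewrite leNgt => /negP; apply.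
rewrite -ltr_pdivrMr//; apply: lt_le_trans NE _; by rewrite ler_nat leq_maxl.
Qed.

Let J0_le a : 0 < a -> J a 0 <= \int[mu]_t (U 0%N t ^+ 2).
Proof.
move=> a0; apply: ler_Rint => // [|t]; first exact: itgJ.
by rewrite ler_piMr ?sqr_ge0// invf_le1// lerDl sqr_ge0.
Qed.

(** As soon as (a n)^2 <= eta, the factor (1 + eta) rho is at least 1 on the window. Taking N beyond
    eta n^2 in [J_ratio] ensures it for a = eta / N. *)
Let window_le (eta : R) (n : nat) : 0 < eta ->
  (\int[mu]_(t in `[(- n%:R)%R, n%:R%R]) (U 1%N t ^+ 2)%:E <=
   ((1 + eta) * ((sigma + 2 * eta) ^+ 2 * \int[mu]_t (U 0%N t ^+ 2)))%:E)%E.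
Proof.
move=> eta0.
have cU2 : continuous (fun t => U 1 t ^+ 2).
  by move=> t; apply: cvgM; exact: tower_continuous.
have [N NN JN] := J_ratio eta0 (ltn0Sn (Num.truncn (eta * n%:R ^+ 2))).
set a := eta / N%:R in JN.
have Np : (0 : R) < N%:R by rewrite ltr0n (leq_trans _ NN).
have a0 : 0 < a by rewrite divr_gt0.
have an : (a * n%:R) ^+ 2 <= eta.
  have : eta * n%:R ^+ 2 <= N%:R.
    by apply: le_trans (ltW (truncnS_gt _)) _; rewrite ler_nat.
  have N1 : (1 : R) <= N%:R by rewrite ler1n (leq_trans _ NN).
  move=> h; have -> : (a * n%:R) ^+ 2 = eta * (eta * n%:R ^+ 2 / N%:R ^+ 2).
    by rewrite /a; field; rewrite gt_eqF.
  rewrite ler_piMr ?(ltW eta0)// ler_pdivrMr ?exprn_gt0// mul1r.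
  by apply: (le_trans h); rewrite expr2 ler_peMr// ltW.
have i := continuous_integrable_itv (- n%:R) n%:R cU2.
rewrite -[leLHS]fineK ?integrable_fin_num// lee_fin -/(Rintegral _ _ _).
apply: (@le_trans _ _ (\int[mu]_(t in `[- n%:R, n%:R]) ((1 + eta) * (U 1%N t ^+ 2 * rho a t)))).
  apply: le_Rintegral => //.
    by apply: itg_subset => //; apply: itgZ; exact: itgJ.
  move=> t /=; rewrite in_itv/= -ler_norml => tn.
  have atn : (a * t) ^+ 2 <= eta.
    apply: le_trans an; rewrite -(real_normK (num_real (a * t))) normrM (gtr0_norm a0).
    by rewrite ler_pXn2r ?nnegrE ?(mulr_ge0 (ltW a0))// ler_pM2l.
  have r1 : 1 <= (1 + eta) * rho a t by rewrite /rho ler_pdivlMr// mul1r lerD2l.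
  by rewrite mulrCA ler_peMr ?sqr_ge0.
apply: (@le_trans _ _ (\int[mu]_t ((1 + eta) * (U 1%N t ^+ 2 * rho a t)))).
  apply: (ge0_Rintegral_subset (measurable_itv _) (itgZ _ (itgJ 1 a0))) => t.
  by rewrite mulr_ge0 ?addr_ge0 ?(ltW eta0)// (mulr_ge0 (sqr_ge0 _) (ltW (rho_gt0 _ _))).
rewrite RintZ ?itgJ// ler_pM2l ?addr_gt0//; apply: (le_trans JN).
by rewrite ler_pM2l ?J0_le// exprn_gt0// addr_gt0// mulr_gt0.
Qed.

Lemma bernstein_step : itg (fun t => U 1%N t ^+ 2) /\
  \int[mu]_t (U 1%N t ^+ 2) <= sigma ^+ 2 * \int[mu]_t (U 0%N t ^+ 2).
Proof.
have mU2 : measurable_fun [set: R] (fun t => U 1%N t ^+ 2) by exact: measurable_funX.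
have it : itg (fun t => U 1%N t ^+ 2).
  apply: (ge0_windows_integrable mU2); first by move=> t; exact: sqr_ge0.
  by move=> n; exact: (window_le n ltr01).
split=> //; set I := \int[mu]_t (U 0%N t ^+ 2).
have I0 : 0 <= I by apply: Rintegral_ge0 => t _; exact: sqr_ge0.
have le_eta eta : 0 < eta -> \int[mu]_t (U 1%N t ^+ 2) <= (1 + eta) * ((sigma + 2 * eta) ^+ 2 * I).
  move=> eta0; rewrite -lee_fin -itg_fineK//; apply: ge0_windows_le => //.
    by move=> t; exact: sqr_ge0.
  by move=> n; exact: window_le.
apply/ler_addgt0Pr => e e0.
(* For 0 < eta <= 1, the bound in [le_eta] exceeds sigma^2 I by at most eta D; the summand 1 keeps
   [D] positive. *)
pose D := 1 + (sigma + 2) ^+ 2 * I + (4 * sigma + 4) * I.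
have D0 : 0 < D.
  have s2 : 0 <= (sigma + 2) ^+ 2 * I by rewrite mulr_ge0 ?sqr_ge0.
  have s4 : 0 <= (4 * sigma + 4) * I by rewrite mulr_ge0// addr_ge0// mulr_ge0// ltW.
  by rewrite /D; lra.
pose eta := Num.min 1 (e / D).
have eta0 : 0 < eta by rewrite lt_min ltr01 divr_gt0.
have eta1 : eta <= 1 by rewrite ge_min lexx.
have etaD : eta * D <= e by rewrite -ler_pdivlMr// ge_min lexx orbT.
apply: (le_trans (le_eta eta eta0)); apply: le_trans (lerD (lexx _) etaD).
clearbody eta; have h1 : (sigma + 2 * eta) ^+ 2 <= (sigma + 2) ^+ 2.
  by have s0 := sigma0; rewrite ler_pXn2r// ?nnegrE; lra.
have h2 : (sigma + 2 * eta) ^+ 2 <= sigma ^+ 2 + eta * (4 * sigma + 4).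
  have := sigma0; nra.
have h1I := ler_wpM2r I0 h1; have h2I := ler_wpM2r I0 h2.
have h3 : eta * ((sigma + 2 * eta) ^+ 2 * I) <= eta * ((sigma + 2) ^+ 2 * I) by rewrite ler_pM2l.
by rewrite /D; lra.
Qed.

End Bernstein.

(** One step also gives square integrability of the next derivative, so the shifted tower satisfies
    the same hypotheses with constant C sigma. *)
Theorem bernstein {R : realType} (U : nat -> R -> R) (C sigma : R) n :
  tower U -> 0 < sigma -> 0 <= C -> (forall m t, `|U m t| <= C * sigma ^+ m) ->
  (@lebesgue_measure R).-integrable [set: R] (EFin \o (fun t => U 0%N t ^+ 2)) ->
  (@lebesgue_measure R).-integrable [set: R] (EFin \o (fun t => U n t ^+ 2)) /\
  \int[lebesgue_measure]_t (U n.+1 t ^+ 2) <=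
    sigma ^+ 2 * \int[lebesgue_measure]_t (U n t ^+ 2).
Proof.
elim: n U C => [|n ih] U C tU s0 C0 UC i0.
  by split=> //; exact: (bernstein_step tU s0 C0 UC i0).2.
have [i1 _] := bernstein_step tU s0 C0 UC i0.
apply: (ih (fun n => U n.+1) (C * sigma)) => //.
- by rewrite mulr_ge0// ltW.
- by move=> m t; rewrite -mulrA -exprS.
Qed.

(** * Band-limited functions and their derivatives *)

Section L2.
Context {R : realType}.
Local Notation mu := (@lebesgue_measure R).
Local Notation itg f := (mu.-integrable [set: R] (EFin \o f)).
Implicit Types (h p q : R -> R) (f g : R -> R[i]).

Definition sqint h := measurable_fun [set: R] h /\ itg (fun t => h t ^+ 2).

(** On [cL2] functions this is the square of [norm2], as a real number. *)
Definition energy f : R :=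
  \int[mu]_t (complex.Re (f t) ^+ 2 + complex.Im (f t) ^+ 2).

Let powR2 (x : R) : `|x| `^ 2 = x ^+ 2.
Proof. by rewrite powR_mulrn// real_normK// num_real. Qed.

Lemma Lnorm2E h : Lnorm mu 2%:E (EFin \o h) =
  ((\int[mu]_t (h t ^+ 2)%:E) `^ 2^-1)%E.
Proof.
rewrite unlock /Lnorm; congr (_ `^ _)%E; apply: eq_integral => t _ /=.
by rewrite powR2.
Qed.

Lemma sqintP h : h \in Lfun mu 2%:E <-> sqint h.
Proof.
rewrite !inE /=; split=> [/andP[/set_mem/= mh /set_mem/=]|[mh ih]].
  rewrite /finite_norm Lnorm2E => /lty_poweRy => /(_ (lt0r_neq0 _)) hy.
  split=> //; apply/ge0_itgP; first exact: measurable_funX.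
    by move=> t; exact: sqr_ge0.
  by apply: hy; rewrite invr_gt0.
apply/andP; split; first exact/mem_set.
apply/mem_set; rewrite /= /finite_norm Lnorm2E; apply: poweR_lty.
by apply/ge0_itgP => //; [exact: measurable_funX|move=> t; exact: sqr_ge0].
Qed.

Lemma cL2P f : cL2 f <->
  sqint (fun t => complex.Re (f t)) /\ sqint (fun t => complex.Im (f t)).
Proof. by split=> -[h1 h2]; split; exact/sqintP. Qed.

Lemma itg_energy f : cL2 f ->
  itg (fun t => complex.Re (f t) ^+ 2 + complex.Im (f t) ^+ 2).
Proof. by move=> /cL2P[[_ h1] [_ h2]]; exact: itgD. Qed.

Lemma energy_ge0 f : 0 <= energy f.
Proof. by apply: Rintegral_ge0 => t _; rewrite addr_ge0 ?sqr_ge0. Qed.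

Lemma norm2E f : cL2 f -> norm2 f = (Num.sqrt (energy f))%:E.
Proof.
move=> hf; rewrite /norm2.
rewrite (_ : (fun t => _) = EFin \o (fun t => Normc.normc (f t)))// Lnorm2E.
rewrite (_ : (\int[mu]_t _)%E = (energy f)%:E).
  by rewrite poweR_EFin powR12_sqrt// energy_ge0.
rewrite /energy -itg_fineK; last exact: itg_energy.
apply: eq_integral => t _; case: (f t) => a b /=.
by rewrite sqr_sqrtr// addr_ge0 ?sqr_ge0.
Qed.

Lemma sqint_mul p q : sqint p -> sqint q -> itg (fun t => p t * q t).
Proof.
move=> [mp ip] [mq iq]; apply: (itg_le (measurable_funMM mp mq) _ (itgD ip iq)) => t.
rewrite normrM -(real_normK (num_real (p t))) -(real_normK (num_real (q t))).
by have := normr_ge0 (p t); have := normr_ge0 (q t); nra.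
Qed.

Lemma cauchy_schwarz p q : sqint p -> sqint q ->
  (\int[mu]_t (p t * q t)) ^+ 2 <= \int[mu]_t (p t ^+ 2) * \int[mu]_t (q t ^+ 2).
Proof.
move=> hp hq; apply: quadratic_discriminant => s.
have hpq := sqint_mul hp hq; have [_ ip] := hp; have [_ iq] := hq.
rewrite -!RintZ// -!RintD//; try exact: itgZ.
  apply: Rintegral_ge0 => t _.
  have -> : p t ^+ 2 + 2 * s * (p t * q t) + s ^+ 2 * q t ^+ 2 = (p t + s * q t) ^+ 2 by ring.
  exact: sqr_ge0.
by apply: itgD => //; exact: itgZ.
Qed.

Lemma sqintD p q : sqint p -> sqint q -> sqint (fun t => p t + q t).
Proof.
move=> hp hq; have hpq := sqint_mul hp hq.
case: hp hq => mp ip [mq iq]; split; first exact: measurable_funD.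
have := itgD (itgD ip (itgZ 2 hpq)) iq.
by apply: eq_integrable => // t _ /=; congr EFin; ring.
Qed.

Lemma sqintZ (c : R) p : sqint p -> sqint (fun t => c * p t).
Proof.
case=> mp ip; split; first by apply: measurable_funMM => //; exact: measurable_cst.
by have := itgZ (c ^+ 2) ip; apply: eq_integrable => // t _ /=; rewrite exprMn.
Qed.

Lemma sqintB p q : sqint p -> sqint q -> sqint (fun t => p t - q t).
Proof.
move=> hp hq; have := sqintD hp (sqintZ (-1) hq).
by rewrite (_ : (fun t => _ + _) = (fun t => p t - q t))// funeqE => t; rewrite mulN1r.
Qed.

Lemma cL2_lin (c : R[i]) f g : cL2 f -> cL2 g -> cL2 (fun t => c * f t + g t).
Proof.
move=> /cL2P[rf jf] /cL2P[rg jg]; apply/cL2P; split.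
  have := sqintD (sqintB (sqintZ (complex.Re c) rf) (sqintZ (complex.Im c) jf)) rg.
  by congr sqint; rewrite funeqE => t; case: c (f t) (g t) => [? ?] [? ?] [? ?].
have := sqintD (sqintD (sqintZ (complex.Re c) jf) (sqintZ (complex.Im c) rf)) jg.
by congr sqint; rewrite funeqE => t; case: c (f t) (g t) => [? ?] [? ?] [? ?].
Qed.

Lemma cL2B f g : cL2 f -> cL2 g -> cL2 (fun t => f t - g t).
Proof.
move=> hf hg; have := cL2_lin (-1) hg hf.
by rewrite (_ : (fun t => _ + _) = (fun t => f t - g t))// funeqE => t; rewrite mulN1r addrC.
Qed.

Lemma cvg_L2_energy (u : nat -> R -> R[i]) f : cvg_L2 u f ->
  energy (fun t => u n t - f t) @[n --> \oo] --> 0.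
Proof.
case=> hu hf uf.
have e2 n : fine (norm2 (fun t => u n t - f t)) ^+ 2 = energy (fun t => u n t - f t).
  by rewrite norm2E ?sqr_sqrtr ?energy_ge0//; exact: cL2B.
pose v n := fine (norm2 (fun t => u n t - f t)).
have h : v n @[n --> \oo] --> 0 by exact: fine_cvg.
rewrite (_ : (fun n => energy _) = (fun n => v n * v n)); last first.
  by rewrite funeqE => n; rewrite -e2 expr2.
have := cvgM h h; rewrite mulr0; apply.
Qed.

Lemma energy_Re_le f : cL2 f -> \int[mu]_t (complex.Re (f t) ^+ 2) <= energy f.
Proof.
move=> hf; have /cL2P[[_ h] _] := hf; apply: ler_Rint => //; first exact: itg_energy.
by move=> t; rewrite lerDl sqr_ge0.
Qed.

Lemma energy_Im_le f : cL2 f -> \int[mu]_t (complex.Im (f t) ^+ 2) <= energy f.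
Proof.
move=> hf; have /cL2P[_ [_ h]] := hf; apply: ler_Rint => //; first exact: itg_energy.
by move=> t; rewrite lerDr sqr_ge0.
Qed.

Let cvg_pairing (v : nat -> R -> R) p q (e : nat -> R) : (forall n, sqint (v n)) ->
  sqint p -> sqint q -> e n @[n --> \oo] --> 0 ->
  (forall n, \int[mu]_t ((v n t - p t) ^+ 2) <= e n) ->
  \int[mu]_t (v n t * q t) @[n --> \oo] --> \int[mu]_t (p t * q t).
Proof.
move=> hv hp hq e0 he; apply/cvgrPdist_le => eps eps0.
set Q := \int[mu]_t (q t ^+ 2).
have Q0 : 0 <= Q by apply: Rintegral_ge0 => t _; exact: sqr_ge0.
have d0 : 0 < eps ^+ 2 / (Q + 1) by rewrite divr_gt0 ?exprn_gt0// ltr_wpDl.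
near=> n; rewrite distrC -RintB; [|exact: sqint_mul..].
rewrite (_ : (fun t => _ - _) = (fun t => (v n t - p t) * q t)); last first.
  by rewrite funeqE => t; rewrite mulrBl.
rewrite -sqrtr_sqr -[leRHS](gtr0_norm eps0) -sqrtr_sqr; apply: ler_wsqrtr.
apply: (le_trans (cauchy_schwarz (sqintB (hv n) hp) hq)); rewrite -/Q.
apply: (@le_trans _ _ (eps ^+ 2 / (Q + 1) * Q)).
  apply: ler_wpM2r => //; apply: (le_trans (he n)).
  apply: (le_trans (ler_norm _)); rewrite -normrN -sub0r; near: n.
  by move/cvgrPdist_le : e0; apply.
by rewrite mulrAC ler_pdivrMr ?ltr_wpDl// ler_wpM2l ?sqr_ge0// lerDl.
Unshelve. all: by end_near. Qed.

(** Norm convergence implies weak convergence. In the inversion formula the L^2 limits of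
    [is_fourier_L2] enter only through such pairings. *)
Lemma cvg_pairing_Re (u : nat -> R -> R[i]) f q : cvg_L2 u f -> sqint q ->
  \int[mu]_t (complex.Re (u n t) * q t) @[n --> \oo] --> \int[mu]_t (complex.Re (f t) * q t).
Proof.
move=> uf hq; have e0 := cvg_L2_energy uf; case: uf => hu hf _.
apply: (cvg_pairing _ _ hq e0) => [n| |n]; [by have /cL2P[] := hu n|by have /cL2P[] := hf|].
have := energy_Re_le (cL2B (hu n) hf); apply: le_trans.
by rewrite le_eqVlt; apply/orP; left; apply/eqP; congr Rintegral; rewrite funeqE => t; case: (u n t) (f t) => [? ?] [].
Qed.

Lemma cvg_pairing_Im (u : nat -> R -> R[i]) f q : cvg_L2 u f -> sqint q ->
  \int[mu]_t (complex.Im (u n t) * q t) @[n --> \oo] --> \int[mu]_t (complex.Im (f t) * q t).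
Proof.
move=> uf hq; have e0 := cvg_L2_energy uf; case: uf => hu hf _.
apply: (cvg_pairing _ _ hq e0) => [n| |n]; [by have /cL2P[] := hu n|by have /cL2P[] := hf|].
have := energy_Im_le (cL2B (hu n) hf); apply: le_trans.
by rewrite le_eqVlt; apply/orP; left; apply/eqP; congr Rintegral; rewrite funeqE => t; case: (u n t) (f t) => [? ?] [].
Qed.

End L2.

(** * Exchange of integrals against a bounded kernel *)

Section PoissonKernel.
Context {R : realType}.
Local Notation mu := (@lebesgue_measure R).
Local Notation itg f := (mu.-integrable [set: R] (EFin \o f)).
Implicit Types (a b s t w : R) (u psi : R -> R).

(** The double integrand is dominated by |psi(w)| |u(s)|, so Fubini's theorem applies. With cosine
    and sine kernels this lets a factor be moved from one side of the Fourier transform to the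
    other. *)
Lemma Rint_fubini_bounded u psi (k : R -> R -> R) : itg u -> itg psi ->
  measurable_fun [set: R * R] (fun z => k z.1 z.2) ->
  (forall w s, `|k w s| <= 1) ->
  itg (fun w => psi w * \int[mu]_s (u s * k w s)) /\
  \int[mu]_w (psi w * \int[mu]_s (u s * k w s)) =
  \int[mu]_s (u s * \int[mu]_w (psi w * k w s)).
Proof.
move=> iu ipsi mk k1.
have mu_ := itg_measurable iu; have mpsi := itg_measurable ipsi.
pose F (z : R * R) := ((psi z.1 * u z.2 * k z.1 z.2)%:E).
have mF : measurable_fun [set: R * R] F.
  apply/measurable_EFinP; apply: measurable_funM => //; apply: measurable_funM.
    by apply: (measurableT_comp mpsi); exact: measurable_fst.
  by apply: (measurableT_comp mu_); exact: measurable_snd.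
have kw w : measurable_fun [set: R] (k w).
  by apply: (measurableT_comp mk (measurable_pair1 w)).
have ks s : measurable_fun [set: R] (k^~ s).
  by apply: (measurableT_comp mk (measurable_pair2 s)).
have iuk w : itg (fun s => u s * k w s).
  apply: (itg_le _ _ (itg_norm iu)); first exact: measurable_funMM.
  by move=> s; rewrite normrM ler_piMr.
have ipk s : itg (fun w => psi w * k w s).
  apply: (itg_le _ _ (itg_norm ipsi)); first exact: measurable_funMM.
  by move=> w; rewrite normrM ler_piMr.
have mFw w : measurable_fun [set: R] (fun s => psi w * u s * k w s).
  apply: measurable_funMM => //; apply: measurable_funMM => //; exact: measurable_cst.
have iF : (mu \x mu)%E.-integrable [set: R * R] F.
  apply: (@integrable12ltyP _ _ _ _ _ mu mu F mF).2.
  apply: (@le_lt_trans _ _ (\int[mu]_w \int[mu]_s (`|psi w|%:E * `|u s|%:E))%E).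
    apply: ge0_le_integral => //.
    - by move=> w _; apply: integral_ge0.
    - apply: (@measurable_fun_fubini_tonelli_F _ _ _ _ _ mu (abse \o F)); last by move=> z; exact: abse_ge0.
      exact: measurableT_comp.
    - apply: (@measurable_fun_fubini_tonelli_F _ _ _ _ _ mu (fun z : R * R => `|psi z.1|%:E * `|u z.2|%:E))%E; last first.
        by move=> z; rewrite -EFinM lee_fin mulr_ge0.
      apply/measurable_EFinP; apply: measurable_funM; apply: measurableT_comp => //.
        by apply: (measurableT_comp mpsi); exact: measurable_fst.
      by apply: (measurableT_comp mu_); exact: measurable_snd.
    - move=> w _; apply: ge0_le_integral => //.
      + by apply/measurable_EFinP; exact: (measurableT_comp _ (mFw w)).
      + by apply/measurable_EFinP; apply: measurable_funM; [exact: measurable_cst|exact: measurableT_comp].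
      + by move=> s _; rewrite -EFinM /F/= lee_fin !normrM ler_piMr ?mulr_ge0.
  under eq_integral => w _.
    rewrite ge0_integralZl ?lee_fin//; last first.
      by apply/measurable_EFinP; exact: measurableT_comp.
    rewrite (itg_fineK (itg_norm iu)) -EFinM. over.
  have := itgZ (\int[mu]_s `|u s|) (itg_norm ipsi).
  move=> /ge0_itgP; under eq_integral do rewrite mulrC; apply.
    by apply: measurable_funMM; [exact: measurable_cst|exact: measurableT_comp].
  by move=> t; rewrite mulr_ge0// Rintegral_ge0.
have FE w : (\int[mu]_s F (w, s) = (psi w * \int[mu]_s (u s * k w s))%:E)%E.
  rewrite EFinM -(itg_fineK (iuk w)) -integralZl//; last exact: iuk.
  by apply: eq_integral => s _; rewrite /F/= -EFinM mulrA.
split.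
  have := integrable_fubini_F iF; apply: eq_integrable => // w _.
  by rewrite /fubini_F FE.
have := Fubini iF; rewrite /Rintegral => /(congr1 fine).
rewrite [X in fine X = _ -> _](_ : _ = \int[mu]_w (psi w * fine (\int[mu]_s (u s * k w s)%:E))%:E)%E; last first.
  by apply: eq_integral => w _; exact: FE.
rewrite [X in _ = fine X -> _](_ : _ = \int[mu]_s (u s * fine (\int[mu]_w (psi w * k w s)%:E))%:E)%E//.
apply: eq_integral => s _; rewrite EFinM fineK ?integrable_fin_num//; last exact: ipk.
rewrite -integralZl//; last exact: ipk.
by apply: eq_integral => w _; rewrite /F/= -EFinM; congr EFin; ring.
Qed.

End PoissonKernel.

(** * The transform of the two-sided exponential *)

Section PoissonTransform.
Context {R : realType}.
Local Notation mu := (@lebesgue_measure R).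
Local Notation itg f := (mu.-integrable [set: R] (EFin \o f)).
Implicit Types (a b c s t w x y : R) (g : R -> R).

Lemma window_two_sided g g1 g2 G1 G2 (n : nat) : continuous g ->
  continuous g1 -> continuous g2 ->
  (forall w, 0 <= w -> g w = g1 w) -> (forall w, w <= 0 -> g w = g2 w) ->
  (forall w, is_derive w 1 G1 (g1 w)) -> (forall w, is_derive w 1 G2 (g2 w)) ->
  \int[mu]_(w in `[- n%:R, n%:R]) g w = (G1 n%:R - G1 0) + (G2 0 - G2 (- n%:R)).
Proof.
move=> cg cg1 cg2 gg1 gg2 dG1 dG2.
have i := continuous_integrable_itv (- n%:R) n%:R cg.
have n0 : (0 : R) <= n%:R by [].
have := Rintegral_itvB i (x := 0); rewrite !bnd_simp oppr_le0 n0 => /(_ isT isT) /eqP.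
rewrite Rintegral_itv_obnd_cbnd; last first.
  by apply: integrableS (continuous_integrable_itv 0 n%:R cg) => //; exact: subset_itv_oc_cc.
rewrite subr_eq => /eqP ->; congr (_ + _).
  rewrite -(Rintegral_FTC dG1 cg1 n0); apply: eq_Rintegral => w /[!inE]/=.
  by rewrite in_itv/= => /andP[w0 _]; exact: gg1.
rewrite -(Rintegral_FTC dG2 cg2) ?oppr_le0//; apply: eq_Rintegral => w /[!inE]/=.
by rewrite in_itv/= => /andP[_ w0]; exact: gg2.
Qed.

(** A family closed under differentiation, which acts linearly on (x, y). Primitives come from
    inverting that 2 x 2 matrix, whose determinant is c^2 + b^2; the coefficients in [window] are
    this inverse for c = -a and c = a. *)
Definition damped c b x y w : R := expR (c * w) * (x * cos (b * w) + y * sin (b * w)).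

Lemma is_derive_damped c b x y w :
  is_derive w 1 (damped c b x y) (damped c b (c * x + b * y) (c * y - b * x) w).
Proof.
have lin (f : R -> R) (d df : R) : is_derive (d * w) 1 f df -> is_derive w 1 (fun s => f (d * s)) (d * df).
  move=> h; have := @is_derive_affine _ f d 0 w df; rewrite addr0 => /(_ h).
  by under eq_fun do rewrite addr0.
have he := lin _ _ _ (is_derive_expR (c * w)).
have hc := is_derive_scalef x (lin _ _ _ (is_derive_cos (b * w))).
have hs := is_derive_scalef y (lin _ _ _ (is_derive_sin (b * w))).
have h := is_derive_mulf he (is_derive_addf hc hs).
by apply: (is_derive_eq h); rewrite /damped; ring.
Qed.

Lemma continuous_damped c b x y : continuous (damped c b x y).
Proof. exact: is_derive_continuous (is_derive_damped c b x y). Qed.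

Lemma damped0 c b x y : damped c b x y 0 = x.
Proof. by rewrite /damped !mulr0 expR0 cos0 sin0 mulr1 mulr0 addr0 mul1r. Qed.

Lemma normr_damped_le c b x y w : `|damped c b x y w| <= expR (c * w) * (`|x| + `|y|).
Proof.
rewrite normrM (ger0_norm (expR_ge0 _)) ler_wpM2l ?expR_ge0//.
rewrite (le_trans (ler_normD _ _))// !normrM lerD// ler_piMr//.
  by rewrite ler_norml cos_geN1 cos_le1.
by rewrite ler_norml sin_geN1 sin_le1.
Qed.

(* [psi a] is the two-sided exponential, whose transform is the Poisson kernel. *)
Definition psi a w : R := expR (- (a * `|w|)).

Lemma continuous_psi a : continuous (psi a).
Proof.
move=> w; apply: (@continuous_comp _ _ _ (fun w => - (a * `|w|)) expR); last exact: continuous_expR.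
apply: cvgN; apply: cvgM; [exact: cvg_cst|exact: norm_continuous].
Qed.

Lemma psi_gt0 a w : 0 < psi a w. Proof. exact: expR_gt0. Qed.

Lemma psi_le1 a w : 0 <= a -> psi a w <= 1.
Proof. by move=> a0; rewrite -expR0 ler_expR oppr_le0 mulr_ge0. Qed.

Section transform.
Variables (a b : R).
Hypothesis a0 : 0 < a.
Let D := a ^+ 2 + b ^+ 2.
Let D0 : 0 < D. Proof. by rewrite ltr_pwDl ?sqr_ge0// exprn_gt0. Qed.

Let g p q w := psi a w * (p * cos (b * w) + q * sin (b * w)).

Let cg p q : continuous (g p q).
Proof.
move=> w; apply: cvgM; first exact: continuous_psi.
have := @continuous_damped 0 b p q w; rewrite /continuous_at /damped.
by under eq_fun do rewrite mul0r expR0 mul1r; rewrite mul0r expR0 mul1r.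
Qed.

Let window p q (n : nat) : \int[mu]_(w in `[- n%:R, n%:R]) g p q w =
  (damped (- a) b (- (a * p + b * q) / D) ((b * p - a * q) / D) n%:R + (a * p + b * q) / D) +
  ((a * p - b * q) / D - damped a b ((a * p - b * q) / D) ((b * p + a * q) / D) (- n%:R)).
Proof.
have h := @window_two_sided (g p q) (damped (- a) b p q) (damped a b p q)
  (damped (- a) b (- (a * p + b * q) / D) ((b * p - a * q) / D))
  (damped a b ((a * p - b * q) / D) ((b * p + a * q) / D)) n (@cg p q)
  (@continuous_damped _ _ _ _) (@continuous_damped _ _ _ _).
apply: (etrans (h _ _ _ _)); last by rewrite !damped0 mulNr opprK.
- by move=> w w0; rewrite /g /psi /damped ger0_norm// mulNr.
- by move=> w w0; rewrite /g /psi /damped ler0_norm// mulrN opprK.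
- move=> w; apply: (is_derive_eq (is_derive_damped _ _ _ _ _)).
  by congr (damped _ _ _ _ _); rewrite /D; field; rewrite gt_eqF.
- move=> w; apply: (is_derive_eq (is_derive_damped _ _ _ _ _)).
  by congr (damped _ _ _ _ _); rewrite /D; field; rewrite gt_eqF.
Qed.

Let decay : expR (- (a * n%:R)) @[n --> \oo] --> 0.
Proof.
have h : a * (n%:R : R) @[n --> \oo] --> +oo.
  apply/cvgryPge => A; near=> n; rewrite mulrC -ler_pdivrMr//.
  by near: n; exact: nbhs_infty_ger.
exact: (@cvg_comp _ _ _ _ (fun x => expR (- x)) _ _ _ h (@cvgr_expR R)).
Unshelve. all: by end_near. Qed.

Let cvg_window p q : itg (g p q) ->
  \int[mu]_w g p q w = 2 * a * p / D.
Proof.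
move=> ig; have := cvg_windows ig; under eq_fun do rewrite window.
move=> h; apply: (cvg_unique _ h) => //.
have d1 x y : damped (- a) b x y n%:R @[n --> \oo] --> 0.
  apply: norm_cvg0; apply: (@squeeze_cvgr _ _ _ _ (cst 0) (fun n : nat => expR (- (a * n%:R)) * (`|x| + `|y|))).
  - by apply: nearW => n; rewrite normr_ge0/= (le_trans (normr_damped_le _ _ _ _ _))// mulNr.
  - exact: cvg_cst.
  - by rewrite -[X in _ --> X](mul0r (`|x| + `|y|)); apply: cvgM; [exact: decay|exact: cvg_cst].
have d2 x y : damped a b x y (- n%:R) @[n --> \oo] --> 0.
  apply: norm_cvg0; apply: (@squeeze_cvgr _ _ _ _ (cst 0) (fun n : nat => expR (- (a * n%:R)) * (`|x| + `|y|))).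
  - by apply: nearW => n; rewrite normr_ge0/= (le_trans (normr_damped_le _ _ _ _ _))// mulrN.
  - exact: cvg_cst.
  - by rewrite -[X in _ --> X](mul0r (`|x| + `|y|)); apply: cvgM; [exact: decay|exact: cvg_cst].
have -> : 2 * a * p / D = 0 + (a * p + b * q) / D + ((a * p - b * q) / D - 0).
  by field; rewrite gt_eqF.
by apply: cvgD; [apply: cvgD; [exact: d1|exact: cvg_cst]|apply: cvgB; [exact: cvg_cst|exact: d2]].
Qed.

Lemma itg_psi : itg (psi a).
Proof.
have cp := @continuous_psi a.
apply: (@ge0_windows_integrable _ _ (2 / a)).
- exact: continuous_measurable.
- by move=> t; exact: ltW (psi_gt0 a t).
- move=> n; have i := continuous_integrable_itv (- n%:R) n%:R cp.
  rewrite -[leLHS]fineK ?integrable_fin_num// lee_fin -/(Rintegral _ _ _).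
  have c0 x y : continuous (damped x 0 y 0) by exact: continuous_damped.
  have E : \int[mu]_(w in `[- n%:R, n%:R]) psi a w =
      (damped (- a) 0 (- a^-1) 0 n%:R - damped (- a) 0 (- a^-1) 0 0) +
      (damped a 0 a^-1 0 0 - damped a 0 a^-1 0 (- n%:R)).
    apply: (@window_two_sided _ (damped (- a) 0 1 0) (damped a 0 1 0)) => // [w w0|w w0|w|w].
    - by rewrite /psi /damped ger0_norm// mulNr !mul0r cos0 mulr1 addr0 mulr1.
    - by rewrite /psi /damped ler0_norm// mulrN opprK !mul0r cos0 mulr1 addr0 mulr1.
    - apply: (is_derive_eq (is_derive_damped _ _ _ _ _)).
      by congr (damped _ _ _ _ _); field; rewrite gt_eqF.
    - apply: (is_derive_eq (is_derive_damped _ _ _ _ _)).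
      by congr (damped _ _ _ _ _); field; rewrite gt_eqF.
  rewrite E !damped0 opprK /damped !mul0r cos0 !mulr1 !addr0.
  have := expR_ge0 (- a * n%:R); have := expR_ge0 (a * - n%:R).
  have ia : 0 < a^-1 by rewrite invr_gt0.
  nra.
Qed.

Let itg_g p q : itg (g p q).
Proof.
apply: (itg_le _ _ (itgZ (`|p| + `|q|) itg_psi)).
  by apply: continuous_measurable; exact: cg.
move=> w; rewrite /g normrM (gtr0_norm (psi_gt0 _ _)) mulrC ler_wpM2r ?(ltW (psi_gt0 _ _))//.
rewrite (le_trans (ler_normD _ _))// !normrM lerD// ler_piMr//.
  by rewrite ler_norml cos_geN1 cos_le1.
by rewrite ler_norml sin_geN1 sin_le1.
Qed.

Lemma Rint_psi_cos : \int[mu]_w (psi a w * cos (b * w)) = 2 * a / (a ^+ 2 + b ^+ 2).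
Proof.
have := cvg_window (itg_g 1 0); rewrite mulr1 => <-; congr Rintegral.
by rewrite funeqE => w; rewrite /g mul1r mul0r addr0.
Qed.

Lemma Rint_psi_sin : \int[mu]_w (psi a w * sin (b * w)) = 0.
Proof.
have := cvg_window (itg_g 0 1); rewrite mulr0 mul0r => <-; congr Rintegral.
by rewrite funeqE => w; rewrite /g mul1r mul0r add0r.
Qed.

End transform.

Lemma sqint_psi a : 0 < a -> sqint (psi a).
Proof.
move=> a0; have mp : measurable_fun [set: R] (psi a).
  by apply: continuous_measurable; exact: continuous_psi.
split=> //; apply: (itg_le _ _ (itg_psi a0)); first exact: measurable_funX.
move=> t; rewrite ger0_norm ?sqr_ge0// expr2 ler_piMr ?psi_le1 ?(ltW a0)//.
exact: ltW (psi_gt0 a t).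
Qed.

End PoissonTransform.

(** * The Poisson kernel as an approximate identity *)

Section ApproximateIdentity.
Context {R : realType}.
Local Notation mu := (@lebesgue_measure R).
Local Notation itg f := (mu.-integrable [set: R] (EFin \o f)).
Implicit Types (p : R -> R) (t s : R).

(* The Poisson kernel [2 a / (a^2 + (2 pi (s - t))^2)] for [a = 1 / (n + 1)]. *)
Definition poisson (n : nat) t s : R :=
  2 * n.+1%:R * cauchy_kernel (2 * pi * n.+1%:R) t s.

Let N0 (n : nat) : (0 : R) < n.+1%:R. Proof. by rewrite ltr0n. Qed.
Let b0 (n : nat) : (0 : R) < 2 * pi * n.+1%:R.
Proof. by rewrite !mulr_gt0// pi_gt0. Qed.

Lemma poisson_ge0 n t s : 0 <= poisson n t s.
Proof. by rewrite !mulr_ge0// (ltW (cauchy_kernel_gt0 _ _ _)). Qed.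

Lemma itg_poisson n t : itg (poisson n t).
Proof. by apply: itgZ; exact: itg_cauchy_kernel. Qed.

Lemma Rint_poisson n t : \int[mu]_s poisson n t s = 1.
Proof.
rewrite RintZ; last exact: itg_cauchy_kernel.
rewrite Rint_cauchy_kernel//; have := pi_gt0 R; have := N0 n.
by move: n.+1%:R (pi : R) => N q N1 q0; field; rewrite !gt_eqF.
Qed.

Lemma sqint_poisson n t : sqint (poisson n t).
Proof.
have mp := itg_measurable (itg_poisson n t).
split=> //; apply: (itg_le _ _ (itgZ (2 * n.+1%:R) (itg_poisson n t))).
  exact: measurable_funX.
move=> s; rewrite ger0_norm ?sqr_ge0// expr2 ler_wpM2r ?poisson_ge0//.
rewrite /poisson ler_piMr ?mulr_ge0// invf_le1 ?cauchy_kernelV_gt0//.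
by rewrite lerDl sqr_ge0.
Qed.

(** With N = n + 1 and v = (s - t)^2, the kernel is at most 1 / (N v). For v >= e^2 the factor 1 +
    e^-2 allows 1 / v to be replaced by the integrable 1 / (1 + v). *)
Lemma poisson_far n t s e : 0 < e -> e <= `|s - t| ->
  poisson n t s <= (1 + e ^- 2) / n.+1%:R * cauchy_kernel 1 t s.
Proof.
move=> e0 est; have Nn := N0 n.
have v0 : e ^+ 2 <= (s - t) ^+ 2.
  by rewrite -(real_normK (num_real (s - t))) ler_pXn2r ?nnegrE ?(ltW e0).
have e20 : 0 < e ^+ 2 by rewrite exprn_gt0.
have pi1 : (1 : R) <= pi by have := pi_ge2 R; lra.
rewrite /poisson /cauchy_kernel mul1r; move: (pi : R) pi1 => q q1; set v := (s - t) ^+ 2 in v0 *.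
have v1 : 0 < v by exact: lt_le_trans v0.
have -> : (2 * q * n.+1%:R * (s - t)) ^+ 2 = 4 * q ^+ 2 * n.+1%:R ^+ 2 * v by rewrite /v; ring.
set N := n.+1%:R in Nn *; clearbody v N.
have den : 0 < 1 + 4 * q ^+ 2 * N ^+ 2 * v.
  by rewrite ltr_pwDl// (mulr_ge0 (mulr_ge0 (mulr_ge0 (ler0n _ _) (sqr_ge0 _)) (sqr_ge0 _)) (ltW v1)).
have step1 : 2 * N / (1 + 4 * q ^+ 2 * N ^+ 2 * v) <= (N * v)^-1.
  rewrite ler_pdivrMr// ler_pdivlMl ?mulr_gt0//.
  have p2 : 1 <= q ^+ 2 :> R by exact: exprn_ege1.
  have : 0 <= (q ^+ 2 - 1) * (N ^+ 2 * v) by rewrite mulr_ge0 ?subr_ge0// mulr_ge0 ?sqr_ge0// ltW.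
  have : 0 <= N ^+ 2 * v by rewrite mulr_ge0 ?sqr_ge0// ltW.
  have -> : N * v * (2 * N) = 2 * (N ^+ 2 * v) by ring.
  by rewrite mulrBl mul1r; lra.
apply: (le_trans step1).
have -> : (1 + e ^- 2) / N * (1 + v)^-1 = ((1 + e ^- 2) / (1 + v)) / N by rewrite mulrAC.
rewrite invfM mulrC ler_pM2r ?invr_gt0// ler_pdivlMr ?ltr_wpDl// mulrDr mulr1 mulVf ?gt_eqF//.
by rewrite addrC lerD2l lef_pV2 ?posrE.
Qed.

(** Near t continuity is used. Far from t, [p] is controlled only in L^2, so |p(s) - p(t)| is
    bounded by p(s)^2 + 1 + |p(t)| and integrated against a kernel of size O(1 / n). *)
Lemma poisson_approx p t : continuous p -> sqint p ->
  \int[mu]_s (p s * poisson n t s) @[n --> \oo] --> p t.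
Proof.
move=> cp hp; apply/cvgrPdist_le => e e0.
have [d d0 dP] : exists2 d, 0 < d & forall s, `|s - t| < d -> `|p s - p t| <= e / 2.
  have e2 : 0 < e / 2 by rewrite divr_gt0.
  have /cvgrPdist_le/(_ _ e2)[d /= d0 dP] := cp t.
  by exists d => // s sd; rewrite distrC; apply: dP; rewrite /= distrC.
pose K := 1 + d ^- 2.
have K0 : 0 < K by rewrite ltr_pwDl// invr_ge0 exprn_ge0// ltW.
(* Integral of the far majorant without its factor K / (n + 1); [pi] is the mass of
   [cauchy_kernel 1 t]. *)
pose M := \int[mu]_s (p s ^+ 2) + (1 + `|p t|) * pi.
have M0 : 0 <= M.
  apply: addr_ge0; first by apply: Rintegral_ge0 => s _; exact: sqr_ge0.
  exact: (mulr_ge0 (addr_ge0 ler01 (normr_ge0 _)) (ltW (pi_gt0 R))).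
have KMe : 0 <= K * M / (e / 2) by exact: (divr_ge0 (mulr_ge0 (ltW K0) M0) (divr_ge0 (ltW e0) (ler0n _ _))).
near=> n.
have ip : itg (fun s => p s * poisson n t s) by apply: sqint_mul => //; exact: sqint_poisson.
have i2 : itg (fun s => p t * poisson n t s) by apply: itgZ; exact: itg_poisson.
have i12 := itgB ip i2.
rewrite distrC -[X in _ - X]mulr1 -(Rint_poisson n t) -(RintZ _ (itg_poisson n t)) -(RintB ip i2).
apply: (le_trans (le_normr_Rintegral measurableT i12)).
pose B s := e / 2 * poisson n t s +
  K / n.+1%:R * (p s ^+ 2 + (1 + `|p t|) * cauchy_kernel 1 t s).
have ic : itg (fun s => (1 + `|p t|) * cauchy_kernel 1 t s).
  by apply: itgZ; exact: itg_cauchy_kernel.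
have ipc : itg (fun s => p s ^+ 2 + (1 + `|p t|) * cauchy_kernel 1 t s) by apply: itgD => //; exact: hp.2.
have iB1 : itg (fun s => e / 2 * poisson n t s) by apply: itgZ; exact: itg_poisson.
have iB2 : itg (fun s => K / n.+1%:R * (p s ^+ 2 + (1 + `|p t|) * cauchy_kernel 1 t s)) by exact: itgZ.
apply: (@le_trans _ _ (\int[mu]_s B s)).
  apply: ler_Rint; [exact: itg_norm|exact: itgD|move=> s].
  rewrite -mulrBl normrM (ger0_norm (poisson_ge0 _ _ _)) /B.
  have c0 := cauchy_kernel_gt0 1 t s.
  have c1 : cauchy_kernel 1 t s <= 1.
    by rewrite invf_le1 ?cauchy_kernelV_gt0// lerDl sqr_ge0.
  have [sd|sd] := ltP `|s - t| d.
    rewrite -[leLHS]addr0 lerD ?ler_wpM2r ?poisson_ge0 ?dP//.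
    by rewrite mulr_ge0 ?divr_ge0 ?(ltW K0)// addr_ge0 ?sqr_ge0 ?mulr_ge0 ?addr_ge0 ?(ltW c0).
  rewrite -[leLHS]add0r; apply: lerD.
    exact: (mulr_ge0 (divr_ge0 (ltW e0) (ler0n _ _)) (poisson_ge0 _ _ _)).
  apply: (@le_trans _ _ (`|p s - p t| * (K / n.+1%:R * cauchy_kernel 1 t s))).
    by rewrite ler_wpM2l// poisson_far.
  rewrite mulrCA ler_wpM2l ?divr_ge0 ?(ltW K0)//.
  apply: (@le_trans _ _ ((`|p s| + `|p t|) * cauchy_kernel 1 t s)).
    by rewrite ler_wpM2r ?(ltW c0)// ler_normB.
  apply: (@le_trans _ _ ((p s ^+ 2 + (1 + `|p t|)) * cauchy_kernel 1 t s)).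
    rewrite ler_wpM2r ?(ltW c0)// addrA lerD2r -(real_normK (num_real (p s))).
    by have := sqr_ge0 (`|p s| - 1); nra.
  by rewrite mulrDl lerD2r ler_piMr ?sqr_ge0.
rewrite /B (RintD iB1 iB2) (RintZ _ (itg_poisson n t)) Rint_poisson mulr1 (RintZ _ ipc).
rewrite (RintD hp.2 ic) (RintZ _ (itg_cauchy_kernel t ltr01)) Rint_cauchy_kernel// divr1 -/M.
rewrite [leRHS](splitr e) lerD2l mulrAC ler_pdivrMr// mulrC -ler_pdivrMl ?divr_gt0// mulrC.
apply: (@le_trans _ _ n%:R); last by rewrite ler_nat.
near: n; exact: nbhs_infty_ger.
Unshelve. all: by end_near. Qed.

End ApproximateIdentity.

(** * Fourier inversion and derivatives of a band-limited function *)

Section Inversion.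
Context {R : realType}.
Local Notation mu := (@lebesgue_measure R).
Local Notation itg f := (mu.-integrable [set: R] (EFin \o f)).
Implicit Types (p q u : R -> R) (f F : R -> R[i]) (s t w : R).

Lemma ae_impl (P Q : R -> Prop) : (forall t, P t -> Q t) ->
  {ae mu, forall t, P t} -> {ae mu, forall t, Q t}.
Proof. by move=> PQ; exact: (@filterS _ _ (ae_filter_ringOfSetsType mu)). Qed.

Lemma ae_and (P Q : R -> Prop) : {ae mu, forall t, P t} -> {ae mu, forall t, Q t} ->
  {ae mu, forall t, P t /\ Q t}.
Proof. by move=> hP hQ; exact: (@filterI _ _ (ae_filter_ringOfSetsType mu) _ _ hP hQ). Qed.

Let tpi : R := 2 * pi.

Let cos1 (x : R) : `|cos x| <= 1. Proof. by rewrite ler_norml cos_geN1 cos_le1. Qed.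
Let sin1 (x : R) : `|sin x| <= 1. Proof. by rewrite ler_norml sin_geN1 sin_le1. Qed.

Let csin (c : R) : continuous (fun w => sin (c * w)).
Proof.
move=> w; apply: (@continuous_comp _ _ _ (fun w => c * w) sin); last exact: continuous_sin.
by apply: cvgM; [exact: cvg_cst|exact: cvg_id].
Qed.

Let ccos (c : R) : continuous (fun w => cos (c * w)).
Proof.
move=> w; apply: (@continuous_comp _ _ _ (fun w => c * w) cos); last exact: continuous_cos.
by apply: cvgM; [exact: cvg_cst|exact: cvg_id].
Qed.

Let itg_bounded u (k : R -> R) : itg u -> measurable_fun [set: R] k ->
  (forall s, `|k s| <= 1) -> itg (fun s => u s * k s).
Proof.
move=> iu mk k1; apply: (itg_le _ _ (itg_norm iu)).
  by apply: measurable_funMM => //; exact: itg_measurable.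
by move=> s; rewrite normrM ler_piMr.
Qed.

Let sqint_bounded p (k : R -> R) : sqint p -> measurable_fun [set: R] k ->
  (forall s, `|k s| <= 1) -> sqint (fun s => p s * k s).
Proof.
move=> [mp ip] mk k1; have m := measurable_funMM mp mk; split=> //.
apply: (itg_le _ _ ip); first exact: measurable_funX.
move=> s; rewrite ger0_norm ?sqr_ge0// exprMn ler_piMr ?sqr_ge0//.
by rewrite -(real_normK (num_real (k s))) expr_le1.
Qed.

Lemma fourier_Re (f : R -> R[i]) w : cintegrable f ->
  complex.Re (fourier f w) =
  \int[mu]_s (complex.Re (f s) * cos (tpi * w * s) + complex.Im (f s) * sin (tpi * w * s)).
Proof.
move=> [_ _]; rewrite /fourier /cintegral /=; congr Rintegral; rewrite funeqE => s.
by rewrite /cexpi cosN sinN; case: (f s) => a b /=; rewrite mulrN opprK.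
Qed.

Lemma fourier_Im (f : R -> R[i]) w : cintegrable f ->
  complex.Im (fourier f w) =
  \int[mu]_s (complex.Im (f s) * cos (tpi * w * s) - complex.Re (f s) * sin (tpi * w * s)).
Proof.
move=> [_ _]; rewrite /fourier /cintegral /=; congr Rintegral; rewrite funeqE => s.
by rewrite /cexpi cosN sinN; case: (f s) => a b /=; rewrite mulrN addrC.
Qed.

Let mk1 t : measurable_fun [set: R * R] (fun z : R * R => cos (tpi * (z.2 - t) * z.1)).
Proof.
apply: (@measurableT_comp _ _ _ _ _ _ cos).
  by apply: continuous_measurable; exact: continuous_cos.
apply: measurable_funM; last exact: measurable_fst.
apply: measurable_funM; first exact: measurable_cst.
by apply: measurable_funB; [exact: measurable_snd|exact: measurable_cst].
Qed.

Let mk2 t : measurable_fun [set: R * R] (fun z : R * R => sin (tpi * (z.2 - t) * z.1)).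
Proof.
apply: (@measurableT_comp _ _ _ _ _ _ sin).
  by apply: continuous_measurable; exact: continuous_sin.
apply: measurable_funM; last exact: measurable_fst.
apply: measurable_funM; first exact: measurable_cst.
by apply: measurable_funB; [exact: measurable_snd|exact: measurable_cst].
Qed.

Let N0 (n : nat) : (0 : R) < n.+1%:R. Proof. by rewrite ltr0n. Qed.
Let a0 (n : nat) : (0 : R) < n.+1%:R^-1. Proof. by rewrite invr_gt0. Qed.

Let psi_n (n : nat) : R -> R := psi n.+1%:R^-1.

Let Rint_psi_poisson n t s : \int[mu]_w (psi_n n w * cos (tpi * (s - t) * w)) = poisson n t s.
Proof.
rewrite Rint_psi_cos// /poisson /cauchy_kernel /tpi.
have := N0 n; move: n.+1%:R (pi : R) => N q N1.
have D0 : 1 + (2 * q * N * (s - t)) ^+ 2 != 0 by rewrite gt_eqF// ltr_pwDl// sqr_ge0.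
have -> : N^-1 ^+ 2 + (2 * q * (s - t)) ^+ 2 = (1 + (2 * q * N * (s - t)) ^+ 2) / N ^+ 2.
  by field; rewrite gt_eqF.
by move: (1 + _) D0 => D D0; field; rewrite D0 gt_eqF.
Qed.

(** The left side is the real part of the damped inverse transform at t. Exchanging the integrals
    leaves the transform of [psi_n] at s - t: its cosine part is the Poisson kernel and its sine
    part vanishes. *)
Lemma fourier_poisson (f : R -> R[i]) n t : cintegrable f ->
  \int[mu]_w (psi_n n w * (complex.Re (fourier f w) * cos (tpi * t * w)
     - complex.Im (fourier f w) * sin (tpi * t * w))) =
  \int[mu]_s (complex.Re (f s) * poisson n t s).
Proof.
move=> hf; have [ip iq] := hf; pose p s := complex.Re (f s); pose q s := complex.Im (f s).
have ipsi : itg (psi_n n) by exact: itg_psi.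
have [i1 e1] := Rint_fubini_bounded (k := fun w s => cos (tpi * (s - t) * w)) ip ipsi (mk1 t) (fun _ _ => cos1 _).
have [i2 e2] := Rint_fubini_bounded (k := fun w s => sin (tpi * (s - t) * w)) iq ipsi (mk2 t) (fun _ _ => sin1 _).
transitivity (\int[mu]_w (psi_n n w * \int[mu]_s (p s * cos (tpi * (s - t) * w)) +
    psi_n n w * \int[mu]_s (q s * sin (tpi * (s - t) * w)))).
  congr Rintegral; rewrite funeqE => w; rewrite -mulrDr; congr (_ * _).
  rewrite (fourier_Re w hf) (fourier_Im w hf).
  have mc c : measurable_fun [set: R] (fun s => cos (c * s)) by apply: continuous_measurable; exact: ccos.
  have ms c : measurable_fun [set: R] (fun s => sin (c * s)) by apply: continuous_measurable; exact: csin.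
  have pc := itg_bounded ip (mc (tpi * w)) (fun _ => cos1 _).
  have ps := itg_bounded ip (ms (tpi * w)) (fun _ => sin1 _).
  have qc := itg_bounded iq (mc (tpi * w)) (fun _ => cos1 _).
  have qs := itg_bounded iq (ms (tpi * w)) (fun _ => sin1 _).
  have kc : measurable_fun [set: R] (fun s => cos (tpi * (s - t) * w)).
    by apply: (measurableT_comp (mk1 t) (measurable_pair1 w)).
  have ks : measurable_fun [set: R] (fun s => sin (tpi * (s - t) * w)).
    by apply: (measurableT_comp (mk2 t) (measurable_pair1 w)).
  rewrite -(RintD (itg_bounded ip kc (fun _ => cos1 _)) (itg_bounded iq ks (fun _ => sin1 _))).
  rewrite mulrC [X in _ - X]mulrC -(RintZ _ (itgD pc qs)) -(RintZ _ (itgB qc ps)).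
  rewrite -RintB; [|exact: itgZ (itgD pc qs)|exact: itgZ (itgB qc ps)].
  congr Rintegral; rewrite funeqE => s.
  have -> : tpi * (s - t) * w = tpi * w * s - tpi * t * w by ring.
  by rewrite cosB sinB /p /q; ring.
rewrite (RintD i1 i2) e1 e2.
rewrite [X in _ + X](_ : _ = 0); last first.
  rewrite (_ : (fun s => _) = (fun=> 0)); first by rewrite Rintegral_cst ?mul0r.
  by rewrite funeqE => s; rewrite Rint_psi_sin// mulr0.
rewrite addr0; congr Rintegral; rewrite funeqE => s.
by rewrite Rint_psi_poisson.
Qed.

Lemma psi_dominated u : itg u ->
  \int[mu]_w (psi_n n w * u w) @[n --> \oo] --> \int[mu]_w u w.
Proof.
move=> iu; apply: fine_cvg; rewrite fineK; last exact: integrable_fin_num.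
have mu_ := itg_measurable iu.
apply: (@dominated_cvg _ _ _ mu setT measurableT
  (fun n => EFin \o (fun w => psi_n n w * u w)) (EFin \o u) (abse \o (EFin \o u))).
- move=> n; apply/measurable_EFinP; apply: measurable_funMM => //.
  by apply: continuous_measurable; exact: continuous_psi.
- move=> w _ /=; apply: cvg_EFin; first by apply: nearW.
  rewrite -[X in _ --> X]mul1r; apply: cvgM; last exact: cvg_cst.
  rewrite -expR0 /psi_n /psi.
  have h : - (n.+1%:R^-1 * `|w|) @[n --> \oo] --> - (0 * `|w|).
    by apply: cvgN; apply: cvgM; [exact: cvg_harmonic|exact: cvg_cst].
  rewrite mul0r oppr0 in h.
  exact: (@cvg_comp _ _ _ _ expR _ _ _ h (@continuous_expR R 0)).
- by [].
- exact: integrable_abse.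
- move=> n w _ /=; rewrite lee_fin normrM ler_piMl//.
  by rewrite gtr0_norm ?psi_gt0// psi_le1// ltW.
Qed.

(** Two limits in succession. For fixed n all test functions are in L^2, so [fourier_poisson] passes
    from the integrable approximations to f and F. Then n tends to infinity, by domination on the
    frequency side and by continuity of f on the other, so the formula holds at every t. *)
Lemma bandlimited_repr sigma f : 0 < sigma -> bandlimited sigma f ->
  exists A B : R -> R, [/\ itg A, itg B,
    forall w, sigma < tpi * `|w| -> A w = 0 /\ B w = 0 &
    forall t, complex.Re (f t) =
      \int[mu]_w (A w * cos (tpi * t * w) + B w * sin (tpi * t * w))].
Proof.
move=> s0 [cf /cL2P[rf jf] [F [u [iu uf uF]] F0]].
have tp0 : 0 < tpi by rewrite mulr_gt0// pi_gt0.
pose s := sigma / tpi; have sp : 0 < s by rewrite divr_gt0.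
(* Cutting F off by the indicator of the band turns vanishing almost everywhere outside into
   vanishing everywhere, and makes a square integrable function integrable. *)
pose I w : R := \1_(`[- s, s]%classic) w.
have mI : measurable_fun [set: R] I by apply: measurable_indic; exact: measurable_itv.
have iI : itg I.
  have c1 : continuous (cst (1 : R) : R -> R) by exact: cst_continuous.
  have mD : measurable (`[- s, s]%classic : set R) by exact: measurable_itv.
  have := (@integrable_mkcond _ _ _ mu _ (EFin \o cst 1) mD).1 (continuous_integrable_itv (- s) s c1).
  by apply: eq_integrable => // w _; rewrite patchE /= /I indicE; case: ifP.
have II w : I w * I w = I w by rewrite /I indicE; case: (_ \in _); rewrite ?mulr0 ?mulr1.
have I01 w : 0 <= I w <= 1 by rewrite /I indicE; case: (_ \in _); rewrite ?lexx ?ler01.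
have [_ /cL2P[rF jF] _] := uF.
pose A w := complex.Re (F w) * I w; pose B w := - (complex.Im (F w) * I w).
have itgI q : sqint q -> itg (fun w => q w * I w).
  move=> [mq iq]; apply: (itg_le (measurable_funMM mq mI) _ (itgD iI iq)) => w.
  rewrite normrM -(real_normK (num_real (q w))).
  have /andP[I0 I1] := I01 w; rewrite (ger0_norm I0).
  have := normr_ge0 (q w); have := II w; nra.
have iA : itg A by exact: itgI.
have iB : itg B by apply: itgN; exact: itgI.
exists A, B; split=> //.
  move=> w ws; suff Iw : I w = 0 by rewrite /A /B Iw !mulr0 oppr0.
  rewrite /I indicE; apply/eqP; rewrite pnatr_eq0 eqb0 notin_setE/= in_itv/= -ler_norml.
  by apply/negP; rewrite -ltNge /s ltr_pdivrMr// mulrC.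
move=> t.
have cL n : \int[mu]_w (psi_n n w * (A w * cos (tpi * t * w) + B w * sin (tpi * t * w))) =
    \int[mu]_s (complex.Re (f s) * poisson n t s).
  have ap0 := a0 n.
  have qc : sqint (fun w => psi_n n w * cos (tpi * t * w)).
    by apply: sqint_bounded => //; [exact: sqint_psi|apply: continuous_measurable; exact: ccos].
  have qs : sqint (fun w => psi_n n w * sin (tpi * t * w)).
    by apply: sqint_bounded => //; [exact: sqint_psi|apply: continuous_measurable; exact: csin].
  have h1 := cvg_pairing_Re uf (sqint_poisson n t).
  have h2 := cvg_pairing_Re uF qc.
  have h3 := cvg_pairing_Im uF qs.
  have [huf _ _] := uF.
  have E m : \int[mu]_w (complex.Re (fourier (u m) w) * (psi_n n w * cos (tpi * t * w))) -
      \int[mu]_w (complex.Im (fourier (u m) w) * (psi_n n w * sin (tpi * t * w))) =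
      \int[mu]_w (complex.Re (u m w) * poisson n t w).
    have /cL2P[rfu jfu] := huf m.
    rewrite -(fourier_poisson n t (iu m)) -(RintB (sqint_mul rfu qc) (sqint_mul jfu qs)).
    by congr Rintegral; rewrite funeqE => w; ring.
  have h23' : \int[mu]_w (complex.Re (u m w) * poisson n t w) @[m --> \oo] -->
      \int[mu]_w (complex.Re (F w) * (psi_n n w * cos (tpi * t * w))) -
      \int[mu]_w (complex.Im (F w) * (psi_n n w * sin (tpi * t * w))).
    by under eq_fun do rewrite -E; apply: cvgB; [exact: h2|exact: h3].
  rewrite -(cvg_unique _ h23' h1)// -(RintB (sqint_mul rF qc) (sqint_mul jF qs)).
  rewrite /Rintegral; congr fine; apply: ae_eq_integral => //.
  - apply/measurable_EFinP; apply: measurable_funMM.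
      by apply: continuous_measurable; exact: continuous_psi.
    apply: measurable_funD; apply: measurable_funMM; try exact: itg_measurable.
      by apply: continuous_measurable; exact: ccos.
    by apply: continuous_measurable; exact: csin.
  - have m := itg_measurable (itgB (sqint_mul rF qc) (sqint_mul jF qs)).
    by apply/measurable_EFinP; exact: m.
  - apply: ae_impl F0 => w Fw _ /=; congr EFin; rewrite /A /B.
    rewrite /I indicE; case: (boolP (w \in _)) => [_|].
      by rewrite !mulr1; ring.
    rewrite notin_setE/= => /negP wI; rewrite Fw//= ?mulr0 ?oppr0 ?mul0r ?addr0 ?mulr0 ?subr0//.
have mc : measurable_fun [set: R] (fun w => cos (tpi * t * w)) by apply: continuous_measurable; exact: ccos.
have ms : measurable_fun [set: R] (fun w => sin (tpi * t * w)) by apply: continuous_measurable; exact: csin.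
have h1 := psi_dominated (itgD (itg_bounded iA mc (fun _ => cos1 _)) (itg_bounded iB ms (fun _ => sin1 _))).
have h2 := @poisson_approx _ _ t cf.1 rf.
have {}h1 : \int[mu]_s (complex.Re (f s) * poisson n t s) @[n --> \oo] -->
    \int[mu]_w (A w * cos (tpi * t * w) + B w * sin (tpi * t * w)).
  by under eq_fun do rewrite -cL; exact: h1.
exact: cvg_unique h2 h1.
Qed.

Lemma is_derive_Rint (h dh : R -> R -> R) (G : R -> R) t :
  (forall s, itg (h s)) -> (forall s w, is_derive s 1 (h^~ w) (dh s w)) ->
  itg G -> (forall s w, `|dh s w| <= G w) ->
  is_derive t 1 (fun s => \int[mu]_w h s w) (\int[mu]_w dh t w).
Proof.
move=> ih dh' iG dhG.
have It : `]t - 1, t + 1[%classic t by rewrite /= in_itv/= ltrBlDr ltrDl ltr01.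
have G0 w : 0 <= G w by apply: le_trans (dhG t w).
have d1E s w : partial1of2 h s w = dh s w.
  by rewrite partial1of2E; have [_] := dh' s w.
have := @derivable_under_integral _ _ _ mu h setT measurableT t (t - 1) (t + 1) It
  (fun s _ => ih s) (fun s w _ _ => let: DeriveDef d _ := dh' s w in d) G G0 iG.
have := @differentiation_under_integral _ _ _ mu h setT measurableT t (t - 1) (t + 1) It
  (fun s _ => ih s) (fun s w _ _ => let: DeriveDef d _ := dh' s w in d) G G0 iG.
move=> d1 d2; apply: DeriveDef.
  by apply: d2 => s w _ _; rewrite d1E.
rewrite -derive1E d1; last by move=> s w _ _; rewrite d1E.
by congr Rintegral; rewrite funeqE => w; rewrite d1E.
Qed.

(** Each derivative under the integral brings a factor 2 pi w, of modulus at most sigma where the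
    coefficients do not vanish. This gives a fixed integrable majorant at each order and the growth
    sigma^m. *)
Theorem bandlimited_tower sigma f : 0 < sigma -> bandlimited sigma f ->
  exists2 U : nat -> R -> R, tower U /\ (forall t, U 0%N t = complex.Re (f t)) &
    exists2 C, 0 <= C & forall m t, `|U m t| <= C * sigma ^+ m.
Proof.
move=> s0 bf; have [A [B [iA iB AB0 fAB]]] := bandlimited_repr s0 bf.
(* Differentiating A cos(2 pi t w) + B sin(2 pi t w) in t replaces (A, B) by 2 pi w (B, -A). *)
pose coef := fix coef (m : nat) : (R -> R) * (R -> R) :=
  if m is m'.+1 then (fun w => tpi * w * (coef m').2 w, fun w => - (tpi * w * (coef m').1 w))
  else (A, B).
pose h m t w := (coef m).1 w * cos (tpi * t * w) + (coef m).2 w * sin (tpi * t * w).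
pose G w := `|A w| + `|B w|.
have iG : itg G by apply: itgD; exact: itg_norm.
have tp0 : 0 < tpi by rewrite mulr_gt0// pi_gt0.
have G0 w : 0 <= G w by rewrite addr_ge0.
have ub (c w : R) m : c <= sigma ^+ m * G w -> tpi * `|w| * c <= sigma ^+ m.+1 * G w.
  move=> cG; have [ws|ws] := ltP sigma (tpi * `|w|).
    have [A0 B0] := AB0 w ws; have Gw : G w = 0 by rewrite /G A0 B0 normr0 addr0.
    by move: cG; rewrite Gw !mulr0 => c0; rewrite mulr_ge0_le0// mulr_ge0// ltW.
  rewrite exprS -[leRHS]mulrA; apply: (@le_trans _ _ (tpi * `|w| * (sigma ^+ m * G w))).
    by rewrite ler_wpM2l// mulr_ge0// ltW.
  by rewrite ler_wpM2r// mulr_ge0// exprn_ge0// ltW.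
have cE m w : `|(coef m).1 w| <= sigma ^+ m * G w /\ `|(coef m).2 w| <= sigma ^+ m * G w.
  elim: m => [|m [ih1 ih2]] /=; first by rewrite expr0 mul1r lerDl lerDr !normr_ge0.
  have nt z : `|tpi * w * z| = tpi * `|w| * `|z|.
    by rewrite (normrM (tpi * w)) (normrM tpi) (gtr0_norm tp0).
  by rewrite normrN !nt; split; exact: ub.
have mA := itg_measurable iA; have mB := itg_measurable iB.
have mtw : measurable_fun [set: R] (fun w => tpi * w).
  by apply: measurable_funMM; [exact: measurable_cst|exact: measurable_id].
have mcoef m : measurable_fun [set: R] (coef m).1 /\ measurable_fun [set: R] (coef m).2.
  elim: m => [//|m [m1 m2]] /=; split; first exact: measurable_funMM.
  by apply: measurableT_comp => //; exact: measurable_funMM.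
have mc (c : R) : measurable_fun [set: R] (fun w => cos (c * w)) by apply: continuous_measurable; exact: ccos.
have ms (c : R) : measurable_fun [set: R] (fun w => sin (c * w)) by apply: continuous_measurable; exact: csin.
have mh m t : measurable_fun [set: R] (h m t).
  by have [m1 m2] := mcoef m; apply: measurable_funD; exact: measurable_funMM.
have hG m t w : `|h m t w| <= 2 * sigma ^+ m * G w.
  have [c1 c2] := cE m w; rewrite (le_trans (ler_normD _ _))// !normrM.
  have h1 : `|(coef m).1 w| * `|cos (tpi * t * w)| <= `|(coef m).1 w| by rewrite ler_piMr.
  have h2 : `|(coef m).2 w| * `|sin (tpi * t * w)| <= `|(coef m).2 w| by rewrite ler_piMr.
  by move: h1 h2 c1 c2; lra.
have ih m t : itg (h m t) by apply: (itg_le _ _ (itgZ (2 * sigma ^+ m) iG)).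
exists (fun m t => \int[mu]_w h m t w); last first.
  exists (2 * \int[mu]_w G w); first by rewrite mulr_ge0// Rintegral_ge0.
  move=> m t; apply: (le_trans (le_normr_Rintegral measurableT (ih m t))).
  rewrite mulrAC -(RintZ _ iG); apply: ler_Rint => //; first exact: itg_norm.
  exact: itgZ.
split; last by move=> t; rewrite fAB.
move=> m t; apply: (@is_derive_Rint (h m) (h m.+1) (fun w => 2 * sigma ^+ m.+1 * G w)) => //.
  move=> s w.
  have hc := is_derive_scalef ((coef m).1 w) (@is_derive_affine _ cos (tpi * w) 0 s _ (is_derive_cos _)).
  have hs := is_derive_scalef ((coef m).2 w) (@is_derive_affine _ sin (tpi * w) 0 s _ (is_derive_sin _)).
  have /is_derive_eq := is_derive_addf hc hs.
  have cm z : tpi * w * z + 0 = tpi * z * w by rewrite addr0 mulrAC.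
  under eq_fun do rewrite !cm.
  by apply; rewrite !cm /h /=; ring.
exact: itgZ.
Qed.

End Inversion.

(** * The complex vector space of band-limited functions *)

Section BandlimitedSpace.
Context {R : realType}.
Local Notation mu := (@lebesgue_measure R).
Local Notation itg f := (mu.-integrable [set: R] (EFin \o f)).
Implicit Types (f g : R -> R[i]) (c z : R[i]) (s t w sigma : R).

Definition csqr (z : R[i]) : R := complex.Re z ^+ 2 + complex.Im z ^+ 2.

Lemma csqr_ge0 z : 0 <= csqr z. Proof. by rewrite addr_ge0 ?sqr_ge0. Qed.

Lemma csqrM (z1 z2 : R[i]) : csqr (z1 * z2) = csqr z1 * csqr z2.
Proof. by case: z1 z2 => [a b] [c d]; rewrite /csqr /=; ring. Qed.

Lemma csqrD_le (z1 z2 : R[i]) : csqr (z1 + z2) <= 2 * (csqr z1 + csqr z2).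
Proof.
case: z1 z2 => [a b] [c d]; rewrite /csqr /=.
have := sqr_ge0 (a - c); have := sqr_ge0 (b - d); nra.
Qed.

Lemma cReM (z1 z2 : R[i]) : complex.Re (z1 * z2) =
  complex.Re z1 * complex.Re z2 - complex.Im z1 * complex.Im z2.
Proof. by case: z1 z2 => [? ?] [? ?]. Qed.

Lemma cImM (z1 z2 : R[i]) : complex.Im (z1 * z2) =
  complex.Re z1 * complex.Im z2 + complex.Im z1 * complex.Re z2.
Proof. by case: z1 z2 => [? ?] [? ?]. Qed.

Lemma cReD (z1 z2 : R[i]) : complex.Re (z1 + z2) = complex.Re z1 + complex.Re z2.
Proof. by case: z1 z2 => [? ?] [? ?]. Qed.

Lemma cImD (z1 z2 : R[i]) : complex.Im (z1 + z2) = complex.Im z1 + complex.Im z2.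
Proof. by case: z1 z2 => [? ?] [? ?]. Qed.

Lemma cReB (z1 z2 : R[i]) : complex.Re (z1 - z2) = complex.Re z1 - complex.Re z2.
Proof. by case: z1 z2 => [? ?] [? ?]. Qed.

Lemma cImB (z1 z2 : R[i]) : complex.Im (z1 - z2) = complex.Im z1 - complex.Im z2.
Proof. by case: z1 z2 => [? ?] [? ?]. Qed.

Lemma complexP (z1 z2 : R[i]) : complex.Re z1 = complex.Re z2 ->
  complex.Im z1 = complex.Im z2 -> z1 = z2.
Proof. by case: z1 z2 => [? ?] [? ?] /= -> ->. Qed.

Lemma itg_csqr f : cL2 f -> itg (fun t => csqr (f t)).
Proof. exact: itg_energy. Qed.

Lemma energy_lin_le c f g : cL2 f -> cL2 g ->
  energy (fun t => c * f t + g t) <= 2 * (csqr c * energy f + energy g).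
Proof.
move=> hf hg; have i1 := itg_csqr hf; have i2 := itg_csqr hg.
have i3 := itgZ (csqr c) i1.
rewrite /energy -(RintZ _ i1) -(RintD i3 i2) -(RintZ _ (itgD i3 i2)).
apply: ler_Rint; [exact: itg_energy (cL2_lin c hf hg)|exact: itgZ (itgD i3 i2)|].
by move=> t; rewrite -/(csqr (c * f t + g t)) (le_trans (csqrD_le _ _))// csqrM.
Qed.

Lemma energy_cvg_L2 (u : nat -> R -> R[i]) f : (forall n, cL2 (u n)) -> cL2 f ->
  energy (fun t => u n t - f t) @[n --> \oo] --> 0 -> cvg_L2 u f.
Proof.
move=> hu hf uf; split=> //.
have -> : (fun n => norm2 (fun t => u n t - f t)) =
    EFin \o (fun n => Num.sqrt (energy (fun t => u n t - f t))).
  by rewrite funeqE => n; rewrite norm2E//; exact: cL2B.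
apply: cvg_EFin; first exact: nearW.
rewrite -(@sqrtr0 R).
exact: (@cvg_comp _ _ _ _ Num.sqrt _ _ _ uf (@sqrt_continuous R 0)).
Qed.

Lemma cvg_L2_lin c (u v : nat -> R -> R[i]) f g : cvg_L2 u f -> cvg_L2 v g ->
  cvg_L2 (fun n t => c * u n t + v n t) (fun t => c * f t + g t).
Proof.
move=> uf vg; have eu := cvg_L2_energy uf; have ev := cvg_L2_energy vg.
case: uf vg => hu hf _ [hv hg _].
apply: energy_cvg_L2 => [n| |]; [exact: cL2_lin|exact: cL2_lin|].
apply: (@squeeze_cvgr _ _ _ _ (cst 0) (fun n => 2 * (csqr c * energy (fun t => u n t - f t) + energy (fun t => v n t - g t)))).
- apply: nearW => n; rewrite energy_ge0 /=.
  have := energy_lin_le c (cL2B (hu n) hf) (cL2B (hv n) hg); apply: le_trans.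
  rewrite le_eqVlt; apply/orP; left; apply/eqP; congr energy.
  by rewrite funeqE => t; ring.
- exact: cvg_cst.
- have -> : 0 = 2 * (csqr c * 0 + 0) :> R by ring.
  apply: cvgM; first exact: cvg_cst.
  by apply: cvgD => //; apply: cvgM => //; exact: cvg_cst.
Qed.

Lemma cintegrable_lin c f g : cintegrable f -> cintegrable g ->
  cintegrable (fun t => c * f t + g t).
Proof.
move=> [rf jf] [rg jg]; split.
  have := itgD (itgB (itgZ (complex.Re c) rf) (itgZ (complex.Im c) jf)) rg.
  by apply: eq_integrable => // t _; rewrite /= cReD cReM.
have := itgD (itgD (itgZ (complex.Re c) jf) (itgZ (complex.Im c) rf)) jg.
by apply: eq_integrable => // t _; rewrite /= cImD cImM.
Qed.

Lemma cintegral_lin c f g : cintegrable f -> cintegrable g ->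
  cintegral (fun t => c * f t + g t) = c * cintegral f + cintegral g.
Proof.
move=> [rf jf] [rg jg]; apply: complexP; rewrite ?cReD ?cReM ?cImD ?cImM /cintegral /=.
  have i1 := itgZ (complex.Re c) rf; have i2 := itgZ (complex.Im c) jf.
  rewrite -(RintZ _ rf) -(RintZ _ jf) -(RintB i1 i2) -(RintD (itgB i1 i2) rg).
  by congr Rintegral; rewrite funeqE => t; rewrite cReD cReM.
have i1 := itgZ (complex.Re c) jf; have i2 := itgZ (complex.Im c) rf.
rewrite -(RintZ _ jf) -(RintZ _ rf) -(RintD i1 i2) -(RintD (itgD i1 i2) jg).
by congr Rintegral; rewrite funeqE => t; rewrite cImD cImM.
Qed.

Lemma cintegrable_cexpi f w : cintegrable f ->
  cintegrable (fun t => f t * cexpi (- (2 * pi * w * t))).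
Proof.
move=> [rf jf].
have mc : measurable_fun [set: R] (fun t => cos (- (2 * pi * w * t))).
  apply: continuous_measurable => t; apply: (@continuous_comp _ _ _ (fun t => - (2 * pi * w * t)) cos); last exact: continuous_cos.
  by apply: cvgN; apply: cvgM; [exact: cvg_cst|exact: cvg_id].
have ms : measurable_fun [set: R] (fun t => sin (- (2 * pi * w * t))).
  apply: continuous_measurable => t; apply: (@continuous_comp _ _ _ (fun t => - (2 * pi * w * t)) sin); last exact: continuous_sin.
  by apply: cvgN; apply: cvgM; [exact: cvg_cst|exact: cvg_id].
have bc (p : R -> R) : itg p -> itg (fun t => p t * cos (- (2 * pi * w * t))).
  move=> ip; apply: (itg_le _ _ (itg_norm ip)); first exact: measurable_funMM (itg_measurable ip) mc.
  by move=> t; rewrite normrM ler_piMr// ler_norml cos_geN1 cos_le1.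
have bs (p : R -> R) : itg p -> itg (fun t => p t * sin (- (2 * pi * w * t))).
  move=> ip; apply: (itg_le _ _ (itg_norm ip)); first exact: measurable_funMM (itg_measurable ip) ms.
  by move=> t; rewrite normrM ler_piMr// ler_norml sin_geN1 sin_le1.
split.
  by have := itgB (bc _ rf) (bs _ jf); apply: eq_integrable => // t _; rewrite /= cReM.
by have := itgD (bs _ rf) (bc _ jf); apply: eq_integrable => // t _; rewrite /= cImM.
Qed.

Lemma fourier_lin c f g w : cintegrable f -> cintegrable g ->
  fourier (fun t => c * f t + g t) w = c * fourier f w + fourier g w.
Proof.
move=> hf hg; rewrite /fourier -cintegral_lin; [|exact: cintegrable_cexpi..].
by congr cintegral; rewrite funeqE => t; rewrite mulrDl mulrA.
Qed.

Lemma bandlimited_lin sigma c f g : bandlimited sigma f -> bandlimited sigma g ->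
  bandlimited sigma (fun t => c * f t + g t).
Proof.
move=> [[crf cjf] hf [F [u [iu uf uF]] F0]] [[crg cjg] hg [G [v [iv vg vG]] G0]]; split.
- split=> t.
    under eq_fun do rewrite cReD cReM.
    by apply: cvgD; [apply: cvgB; apply: cvgM; [exact: cvg_cst|exact: crf|exact: cvg_cst|exact: cjf]|exact: crg].
  under eq_fun do rewrite cImD cImM.
  by apply: cvgD; [apply: cvgD; apply: cvgM; [exact: cvg_cst|exact: cjf|exact: cvg_cst|exact: crf]|exact: cjg].
- exact: cL2_lin.
- exists (fun t => c * F t + G t).
    exists (fun n t => c * u n t + v n t); split.
    + by move=> n; exact: cintegrable_lin.
    + exact: cvg_L2_lin.
    + have := cvg_L2_lin c uF vG; congr cvg_L2; rewrite funeqE => n.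
      by rewrite funeqE => w; rewrite fourier_lin.
  by apply: ae_impl (ae_and F0 G0) => w [Fw Gw] hw; rewrite Fw// Gw// mulr0 addr0.
Qed.

Lemma bandlimited0 sigma : bandlimited sigma (fun=> 0 : R[i]).
Proof.
have z0 : sqint (fun=> 0 : R).
  split; first exact: measurable_cst.
  by under eq_fun do rewrite expr0n; exact: integrable0.
have L0 : cL2 (fun=> 0 : R[i]) by apply/cL2P.
have c0 : cvg_L2 (fun n : nat => fun=> 0 : R[i]) (fun=> 0).
  apply: energy_cvg_L2 => //.
  rewrite (_ : (fun n => _) = (fun=> 0)); first exact: cvg_cst.
  rewrite funeqE => n; rewrite /energy; under eq_Rintegral do rewrite subrr/= expr0n addr0.
  by rewrite Rintegral_cst// mul0r.
split=> //; first by split; exact: cst_continuous.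
exists (fun=> 0); last by apply: ae_impl (aeW mu (fun=> I)) => w.
exists (fun n => fun=> 0); split=> //.
  by move=> n; split; exact: integrable0.
rewrite (_ : (fun n => _) = (fun n => fun=> 0))//; rewrite funeqE => n; rewrite funeqE => w.
rewrite /fourier /cintegral; apply: complexP => /=.
  by under eq_Rintegral do rewrite !mul0r subrr; rewrite Rintegral_cst// mul0r.
by under eq_Rintegral do rewrite !mul0r addr0; rewrite Rintegral_cst// mul0r.
Qed.

Definition ctower (U V : nat -> R -> R) f := [/\ tower U, tower V &
  forall t, f t = U 0%N t +i* V 0%N t].

Lemma ctower_cderiv U V f n t : ctower U V f -> cderiv n f t = U n t +i* V n t.
Proof.
move=> [tU tV fUV]; rewrite /cderiv; congr (_ +i* _).
  by rewrite -(tower_derive1n n tU); congr (derive1n n _ t); rewrite funeqE => s; rewrite fUV.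
by rewrite -(tower_derive1n n tV); congr (derive1n n _ t); rewrite funeqE => s; rewrite fUV.
Qed.

Lemma bernstein_bandlimited sigma f : 0 < sigma -> bandlimited sigma f ->
  exists U V, ctower U V f /\ forall n, [/\ sqint (U n), sqint (V n),
    \int[mu]_t (U n.+1 t ^+ 2) <= sigma ^+ 2 * \int[mu]_t (U n t ^+ 2) &
    \int[mu]_t (V n.+1 t ^+ 2) <= sigma ^+ 2 * \int[mu]_t (V n t ^+ 2)].
Proof.
move=> s0 bf; have [U [tU U0] [C C0 UC]] := bandlimited_tower s0 bf.
(* The imaginary part of f is the real part of - i f, so the result on real parts covers it. *)
have bif := bandlimited_lin (- 'i%C) bf (bandlimited0 sigma).
have [V [tV V0] [D D0 VD]] := bandlimited_tower s0 bif.
have {}V0 t : V 0%N t = complex.Im (f t).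
  by rewrite V0; case: (f t) => a b /=; rewrite oppr0 mul0r sub0r mulN1r opprK addr0.
exists U, V; split; first by split=> // t; rewrite U0 V0; case: (f t).
have [_ /cL2P[[_ rf] [_ jf]] _] := bf.
have iU : itg (fun t => U 0%N t ^+ 2) by move: rf; apply: eq_integrable => // t _; rewrite /= U0.
have iV : itg (fun t => V 0%N t ^+ 2) by move: jf; apply: eq_integrable => // t _; rewrite /= V0.
move=> n; have [iUn Un] := bernstein n tU s0 C0 UC iU.
have [iVn Vn] := bernstein n tV s0 D0 VD iV.
by split=> //; split=> //; apply: continuous_measurable; exact: tower_continuous.
Qed.

End BandlimitedSpace.

(** * Piecewise Hermite interpolation *)

Section HermiteInterpolation.
Variable F : numFieldType.
Implicit Types (p q : {poly F}) (a b : F).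

(** Induction on k for both p and p'. If p = (X - a)^k q and (X - a)^k divides p', then X - a
    divides k q, and k is invertible in characteristic zero. *)
Lemma derivn_zero_dvdp k p a : (forall j, (j < k)%N -> p^`(j).[a] = 0) ->
  (('X - a%:P) ^+ k %| p)%R.
Proof.
elim: k p => [|k ih] p h; first by rewrite expr0 dvd1p.
have /dvdpP[q pq] : ('X - a%:P) ^+ k %| p by apply: ih => j jk; apply: h; exact: ltnW.
have h' : ('X - a%:P) ^+ k %| p^`() by apply: ih => j jk; rewrite -derivSn; exact: h.
case: k ih h pq h' => [|k] ih h pq h'.
  by rewrite expr1 dvdp_XsubCl; apply/rootP; have := h 0%N isT; rewrite derivn0.
have Xa0 : ('X - a%:P : {poly F}) != 0 by rewrite polyXsubC_eq0.
move: h'; rewrite pq derivM deriv_exp derivXsubC mul1r /= dvdp_addr; last exact: dvdp_mull.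
rewrite mulrnAr -mulrnAl [_ ^+ k.+1 in X in X %| _]exprS dvdp_mul2r ?expf_neq0//.
rewrite -scaler_nat dvdpZr ?pnatr_eq0// => qX.
by rewrite [_ ^+ k.+2]exprS dvdp_mul.
Qed.

Lemma hermite_unique k p a b : a != b -> (size p <= 2 * k)%N ->
  (forall j, (j < k)%N -> p^`(j).[a] = 0 /\ p^`(j).[b] = 0) -> p = 0.
Proof.
move=> ab sp h.
have pa : ('X - a%:P) ^+ k %| p by apply: derivn_zero_dvdp => j /h[].
have pb : ('X - b%:P) ^+ k %| p by apply: derivn_zero_dvdp => j /h[].
have co : coprimep (('X - a%:P) ^+ k) (('X - b%:P) ^+ k).
  apply: coprimep_expl; apply: coprimep_expr; rewrite coprimep_XsubC root_XsubC.
  by rewrite eq_sym.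
have := pa; have := Gauss_dvdp p co; rewrite pa pb /= => dv _.
apply/eqP; apply: contraTT sp => p0; rewrite -ltnNge.
have := dvdp_leq p0 dv; apply: leq_trans.
rewrite size_mul ?expf_neq0 ?polyXsubC_eq0// !size_exp_XsubC; lia.
Qed.

(** Interpolation is a square linear system in the 2k coefficients, with trivial kernel by
    [hermite_unique]. *)
Lemma hermite_exists k a b (c d : nat -> F) : a != b ->
  exists2 p : {poly F}, (size p <= 2 * k)%N &
    forall j, (j < k)%N -> p^`(j).[a] = c j /\ p^`(j).[b] = d j.
Proof.
move=> ab.
pose M : 'M[F]_(k + k) := \matrix_(i, j)
  match fintype.split j with inl j => ('X^i)^`(j).[a] | inr j => ('X^i)^`(j).[b] end.
have hM (v : 'rV[F]_(k + k)) j : (v *m M) 0 j =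
    match fintype.split j with inl j => (rVpoly v)^`(j).[a] | inr j => (rVpoly v)^`(j).[b] end.
  rewrite mxE; have -> : rVpoly v = \sum_i v 0 i *: 'X^i.
    rewrite {1}(row_sum_delta v) linear_sum/=; apply: eq_bigr => i _.
    by rewrite linearZ/= rVpoly_delta.
  case E : (fintype.split j) => [l|l]; rewrite linear_sum/= horner_sum;
    by apply: eq_bigr => i _; rewrite linearZ/= hornerZ mxE E.
have uM : M \in unitmx.
  rewrite unitmxE unitfE; apply/negP => /det0P[v v0 vM]; case/negP: v0.
  have p0 : rVpoly v = 0.
    apply: (@hermite_unique k _ a b) => //; first by rewrite mul2n -addnn size_poly.
    move=> j jk; have := hM v (lshift k (Ordinal jk)); have := hM v (rshift k (Ordinal jk)).
    rewrite vM !mxE; rewrite (unsplitK (inl _ (Ordinal jk))) (unsplitK (inr _ (Ordinal jk))).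
    by [].
  by rewrite -(rVpolyK v) p0 linear0.
pose cd : 'rV[F]_(k + k) := \row_j match fintype.split j with inl j => c j | inr j => d j end.
exists (rVpoly (cd *m invmx M)); first by rewrite mul2n -addnn size_poly.
move=> j jk; have := hM (cd *m invmx M) (lshift k (Ordinal jk)).
have := hM (cd *m invmx M) (rshift k (Ordinal jk)).
rewrite mulmxKV// !mxE (unsplitK (inl _ (Ordinal jk))) (unsplitK (inr _ (Ordinal jk))).
by move=> -> ->.
Qed.

End HermiteInterpolation.

(** * Interpolation error on one interval *)

Section RealParts.
Context {R : realType}.
Local Notation mu := (@lebesgue_measure R).
Implicit Types (P : {poly R}) (p : {poly R[i]}) (U u : nat -> R -> R) (a b t : R).

Definition Repoly p : {poly R} := \poly_(i < size p) complex.Re p`_i.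
Definition Impoly p : {poly R} := \poly_(i < size p) complex.Im p`_i.

Lemma size_Repoly p : (size (Repoly p) <= size p)%N. Proof. exact: size_poly. Qed.
Lemma size_Impoly p : (size (Impoly p) <= size p)%N. Proof. exact: size_poly. Qed.

Let coefRe p i : (Repoly p)`_i = complex.Re p`_i.
Proof. by rewrite coef_poly; case: ltnP => // ip; rewrite nth_default. Qed.

Let coefIm p i : (Impoly p)`_i = complex.Im p`_i.
Proof. by rewrite coef_poly; case: ltnP => // ip; rewrite nth_default. Qed.

Let ReMn (z : R[i]) n : complex.Re (z *+ n) = complex.Re z *+ n.
Proof. by elim: n => [//|n ih]; rewrite !mulrSr cReD ih. Qed.

Let ImMn (z : R[i]) n : complex.Im (z *+ n) = complex.Im z *+ n.
Proof. by elim: n => [//|n ih]; rewrite !mulrSr cImD ih. Qed.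

Let derivnRe p n : (Repoly p)^`(n) = Repoly p^`(n).
Proof. by apply/polyP => i; rewrite coefRe !coef_derivn coefRe ReMn. Qed.

Let derivnIm p n : (Impoly p)^`(n) = Impoly p^`(n).
Proof. by apply/polyP => i; rewrite coefIm !coef_derivn coefIm ImMn. Qed.

Let rsum (n : nat) (h : 'I_n -> R[i]) :
  complex.Re (\sum_i h i) = \sum_i complex.Re (h i).
Proof. by apply: (big_morph _ cReD). Qed.

Let isum (n : nat) (h : 'I_n -> R[i]) :
  complex.Im (\sum_i h i) = \sum_i complex.Im (h i).
Proof. by apply: (big_morph _ cImD). Qed.

(** Since the nodes are real, a complex Hermite problem splits into two real ones. *)
Lemma horner_real p n t : p^`(n).[t%:C] = (Repoly p)^`(n).[t] +i* (Impoly p)^`(n).[t].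
Proof.
rewrite derivnRe derivnIm; set q := p^`(n).
rewrite horner_coef (horner_coef_wide _ (size_Repoly q)) (horner_coef_wide _ (size_Impoly q)).
apply: complexP => /=.
  by rewrite rsum; apply: eq_bigr => i _; rewrite coefRe -rmorphXn/= cReM/= mulr0 subr0.
by rewrite isum; apply: eq_bigr => i _; rewrite coefIm -rmorphXn/= cImM/= mulr0 add0r.
Qed.

Lemma is_derive_horner P t : is_derive t 1 (horner P) P^`().[t].
Proof. by apply: DeriveDef; [exact: derivable_horner|rewrite derivE derive1E]. Qed.

Lemma tower_horner P : tower (fun n t => P^`(n).[t]).
Proof. by move=> n t; rewrite derivnS; exact: is_derive_horner. Qed.

(** Repeated integration by parts: the boundary terms vanish, and each step lowers the degree of [P]
    until nothing is left. *)
Lemma deriv_orthogonal u a b P m : tower u -> a <= b ->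
  (forall l, (l < m)%N -> u l a = 0 /\ u l b = 0) -> (size P <= m)%N ->
  \int[mu]_(t in `[a, b]) (u m t * P.[t]) = 0.
Proof.
move=> tu ab; elim: m P => [|m ih] P h sP.
  move: sP; rewrite leqn0 size_poly_eq0 => /eqP ->.
  by under eq_Rintegral do rewrite horner0 mulr0; rewrite Rintegral_cst// mul0r.
have dF t : is_derive t 1 (fun s => u m s * P.[s]) (u m.+1 t * P.[t] + u m t * P^`().[t]).
  by have := is_derive_mulf (tu m t) (is_derive_horner P t).
have cu n : continuous (u n) by exact: tower_continuous.
have cP Q : continuous (fun t => Q.[t] : R).
  by apply: is_derive_continuous => t; exact: is_derive_horner.
have c1 : continuous (fun t => u m.+1 t * P.[t]).
  by move=> t; apply: cvgM; [exact: cu|exact: cP].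
have c2 : continuous (fun t => u m t * P^`().[t]).
  by move=> t; apply: cvgM; [exact: cu|exact: cP].
have cF : continuous (fun t => u m.+1 t * P.[t] + u m t * P^`().[t]).
  by move=> t; apply: cvgD; [exact: c1|exact: c2].
have := Rintegral_FTC dF cF ab; have [-> ->] := h m (ltnSn m).
rewrite !mul0r subrr RintegralD//; [|exact: continuous_integrable_itv..].
rewrite ih ?addr0// => [l lm|]; first by apply: h; exact: ltnW.
have [->|P0] := eqVneq P 0; first by rewrite deriv0 size_poly0.
by rewrite -ltnS (leq_trans (lt_size_deriv P0)).
Qed.

Lemma hermite_interval_estimate K (nu : R) a b U P : is_wirtinger_cimmino K.+1 nu ->
  a < b -> tower U -> (size P <= 2 * K.+1)%N ->
  (forall l, (l <= K)%N -> P^`(l).[a] = U l a /\ P^`(l).[b] = U l b) ->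
  nu ^+ 2 * \int[mu]_(t in `[a, b]) ((U K t - P^`(K).[t]) ^+ 2) <=
  (b - a) ^+ 2 * \int[mu]_(t in `[a, b]) (U K.+1 t ^+ 2).
Proof.
move=> wn ab tU sP hP.
pose u n t := - 1 * P^`(n).[t] + U n t.
have tu : tower u by apply: tower_lin => //; exact: tower_horner.
have u0 l : (l <= K)%N -> u l a = 0 /\ u l b = 0.
  by move=> /hP[pa pb]; rewrite /u pa pb !mulN1r !addNr.
have cu n : continuous (u n) by exact: tower_continuous.
have cP n : continuous (fun t => P^`(n).[t]) by exact: (@tower_continuous _ _ n (tower_horner P)).
have -> : \int[mu]_(t in `[a, b]) ((U K t - P^`(K).[t]) ^+ 2) = \int[mu]_(t in `[a, b]) (u K t ^+ 2).
  by congr Rintegral; rewrite funeqE => t; rewrite /u mulN1r addrC.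
apply: (le_trans (wirtinger_inequality wn ab tu u0)); rewrite ler_wpM2l ?sqr_ge0//.
have sq n : continuous (fun t => u n t ^+ 2) by move=> t; apply: cvgM; exact: cu.
have c1 : continuous (fun t => 2 * (u K.+1 t * P^`(K.+1).[t])).
  by move=> t; apply: cvgM; [exact: cvg_cst|apply: cvgM; [exact: cu|exact: cP]].
have c1' : continuous (fun t => u K.+1 t * P^`(K.+1).[t]).
  by move=> t; apply: cvgM; [exact: cu|exact: cP].
have c2 : continuous (fun t => P^`(K.+1).[t] ^+ 2) by move=> t; apply: cvgM; exact: cP.
have c12 : continuous (fun t => u K.+1 t ^+ 2 + 2 * (u K.+1 t * P^`(K.+1).[t])).
  by move=> t; apply: cvgD; [exact: sq|exact: c1].
have -> : \int[mu]_(t in `[a, b]) (U K.+1 t ^+ 2) =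
    \int[mu]_(t in `[a, b]) (u K.+1 t ^+ 2 + 2 * (u K.+1 t * P^`(K.+1).[t]) + P^`(K.+1).[t] ^+ 2).
  by congr Rintegral; rewrite funeqE => t; rewrite /u; ring.
rewrite RintegralD//; [|exact: continuous_integrable_itv..].
rewrite RintegralD//; [|exact: continuous_integrable_itv..].
rewrite RintegralZl//; last exact: continuous_integrable_itv.
(* The cross term vanishes: P^(K+1) has at most K+1 coefficients and [u] has zeros of order K+1 at
   both ends. What remains is Pythagoras. *)
rewrite (deriv_orthogonal tu (ltW ab)) ?mulr0 ?addr0.
- by rewrite lerDl Rintegral_ge0// => t _; exact: sqr_ge0.
- by move=> l lK; apply: u0.
- have sD (Q : {poly R}) n : (size Q^`(n) <= size Q - n)%N.
    elim: n => [|n ih]; first by rewrite derivn0 subn0.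
    rewrite derivnS subnS; have [->|Q0] := eqVneq Q^`(n) 0; first by rewrite deriv0 size_poly0.
    by have := lt_size_deriv Q0; have := ih; lia.
  by have := sD P K.+1; move: sP; lia.
Qed.

End RealParts.

(** * Summation over the cells of the partition *)

Section Nodes.
Context {R : realType}.
Local Notation mu := (@lebesgue_measure R).
Local Notation itg f := (mu.-integrable [set: R] (EFin \o f)).
Variable x : int -> R.
Hypothesis hx : forall i, x i < x (i + 1).
Hypothesis hcover : \bigcup_(i in [set: int]) `[x i, x (i + 1)]%classic = [set: R].
Implicit Types (i j : int) (s t : R).

Lemma node_addn i (n : nat) : x i <= x (i + n%:Z).
Proof.
elim: n => [|n ih]; first by rewrite addr0.
by rewrite (le_trans ih)// -[n.+1]addn1 PoszD addrA ltW.
Qed.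

Lemma node_le i j : i <= j -> x i <= x j.
Proof.
move=> ij; have -> : j = i + `|j - i|%N by lia.
exact: node_addn.
Qed.

Lemma node_cover t : exists i, x i <= t < x (i + 1).
Proof.
have : [set: R] t by []; rewrite -hcover => -[i _] /=; rewrite in_itv/= => /andP[ti].
rewrite le_eqVlt => /predU1P[->|ti1]; first by exists (i + 1); rewrite lexx hx.
by exists i; rewrite ti.
Qed.

Lemma node_mem i j t : x i <= t < x (i + 1) -> x j <= t <= x (j + 1) ->
  j = i \/ (j + 1 = i /\ t = x i).
Proof.
move=> /andP[it ti] /andP[jt tj].
have ji : j <= i.
  rewrite leNgt; apply/negP => ij; have : x (i + 1) <= x j by apply: node_le; rewrite lezD1.
  by rewrite leNgt (le_lt_trans jt).
have [->|ij] := eqVneq j i; [by left|right].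
have ij1 : j + 1 <= i by rewrite lezD1 lt_neqAle ij.
have tE : t = x i by apply/le_anti; rewrite it (le_trans tj)// node_le.
split=> //; apply/le_anti; rewrite ij1/= leNgt; apply/negP => ji1.
have : x (j + 1) < x i.
  by apply: lt_le_trans (hx _) (node_le _); rewrite lezD1.
by rewrite ltNge -tE tj.
Qed.

(** A sum over all of [int] is meaningful only through its finite support, which must be located
    first. Neighbouring closed cells share a node, so two indices can contribute. *)
Lemma hermite_sumE k (f : R -> R[i]) i t : x i <= t < x (i + 1) ->
  let F j := (hermite k (x j) (x (j + 1)) f)^`(k.-1).[t%:C] *
     (\1_(`[x j, x (j + 1)]) t)%:C in
  hermite_sum k x f t = F (i - 1) + F i.
Proof.
move=> it F; rewrite /hermite_sum.
transitivity (\sum_(j \in [set i - 1; i]) F j).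
  apply/esym/fsbig_widen => // j /= [_ /not_orP[ji1 ji]].
  rewrite /F indicE memNset ?mulr0//= in_itv/= => jt.
  have [//|[ji' _]] := node_mem it jt.
  by apply: ji1; rewrite -ji' addrK.
rewrite fsbigU0//.
  by rewrite !fsbig_set1.
by move=> j /= [-> /eqP]; rewrite -subr_eq0 addrAC subrr sub0r oppr_eq0.
Qed.

Lemma hermite_sum_in k (f : R -> R[i]) i t : x i < t < x (i + 1) ->
  hermite_sum k x f t = (hermite k (x i) (x (i + 1)) f)^`(k.-1).[t%:C].
Proof.
move=> /andP[it ti]; rewrite (@hermite_sumE _ _ i) ?(ltW it)//=.
rewrite indicE memNset ?mulr0 ?add0r; last first.
  by rewrite /= in_itv/= subrK => /andP[_]; rewrite leNgt it.
by rewrite indicE mem_set ?mulr1//= in_itv/= (ltW it) (ltW ti).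
Qed.

Section estimate.
Variables (K : nat) (nu delta : R) (U : nat -> R -> R) (P : int -> {poly R}) (S : R -> R).
Hypothesis wn : is_wirtinger_cimmino K.+1 nu.
Hypothesis hdelta : forall i, x (i + 1) - x i <= delta.
Hypothesis tU : tower U.
Hypothesis sP : forall i, (size (P i) <= 2 * K.+1)%N.
Hypothesis hP : forall i l, (l <= K)%N ->
  (P i)^`(l).[x i] = U l (x i) /\ (P i)^`(l).[x (i + 1)] = U l (x (i + 1)).
Hypothesis hS : forall i t, x i < t < x (i + 1) -> S t = (P i)^`(K).[t].
Hypothesis itgU : itg (fun t => U K.+1 t ^+ 2).

(** Half-open, so that consecutive cells are disjoint and integrals add up exactly. *)
Let seg i (n : nat) : set R := `[x i, x (i + n%:Z)[%classic.

Let segS i n : seg i n.+1 = seg i n `|` `[x (i + n%:Z), x (i + n%:Z + 1)[%classic.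
Proof.
rewrite /seg -[n.+1]addn1 PoszD addrA; apply/seteqP; split=> t /=; rewrite !in_itv/=.
  by move=> /andP[-> ->]; have [h|h] := ltP t (x (i + n)); [left|right].
move=> [/andP[-> h]|/andP[h ->]]; first by rewrite (lt_trans h).
by rewrite (le_trans (node_addn i n)).
Qed.

Let mseg i n : measurable (seg i n). Proof. exact: measurable_itv. Qed.

Let seg_cover : \bigcup_n seg (- n%:Z) (n + n) = [set: R].
Proof.
rewrite -subTset => t _; have [i /andP[it ti]] := node_cover t.
exists (`|i| + 1)%N => //=; rewrite /seg /= in_itv/= PoszD; apply/andP; split.
  by apply: le_trans it; apply: node_le; have := ler_norm (- i); rewrite normrN; lia.
apply: (lt_le_trans ti); apply: node_le; have := ler_norm i; lia.
Qed.

Let seg_homo : nondecreasing_seq (fun n : nat => seg (- n%:Z) (n + n)).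
Proof.
move=> n m nm; apply/subsetPset => t; rewrite /seg /= !in_itv/= => /andP[h1 h2].
apply/andP; split; first by apply: le_trans h1; apply: node_le; lia.
by apply: (lt_le_trans h2); apply: node_le; lia.
Qed.

Let mpiece i : measurable_fun `]x i, x (i + 1)[%classic S.
Proof.
apply: (@eq_measurable_fun _ _ _ _ _ (fun t => (P i)^`(K).[t])).
  by move=> t; rewrite inE/= in_itv/= => /hS.
by apply: continuous_measurable; exact: (@tower_continuous _ _ K (tower_horner (P i))).
Qed.

Let mcell i : measurable_fun `[x i, x (i + 1)[%classic S.
Proof.
rewrite -(@setU1itv _ _ _ _ false); last by rewrite bnd_simp.
apply/measurable_funU => //; split; last exact: mpiece.
exact: measurable_fun_set1.
Qed.

(** [S] is prescribed on the open cells only; the remaining nodes are singletons, on which any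
    function is measurable. *)
Lemma measurable_piecewise : measurable_fun [set: R] S.
Proof.
rewrite -seg_cover; apply/measurable_fun_bigcup => n; first exact: mseg.
elim: (n + n)%N (- n%:Z) => [|m ih] i.
  by rewrite /seg addr0 set_itvco0//; exact: measurable_fun_set0.
rewrite segS; apply/measurable_funU; [exact: mseg|exact: measurable_itv|].
by split; [exact: ih|exact: mcell].
Qed.

Let c := (delta / nu) ^+ 2.

Let cell_le i :
  (\int[mu]_(t in `[x i, x (i + 1)[) ((U K t - S t) ^+ 2)%:E <=
   \int[mu]_(t in `[x i, x (i + 1)[) (c * U K.+1 t ^+ 2)%:E)%E.
Proof.
have [nu0 _ _] := wn.
have mU n : measurable_fun [set: R] (U n) by apply: continuous_measurable; exact: tower_continuous.
have mD : measurable_fun [set: R] (fun t => ((U K t - S t) ^+ 2)%:E).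
  by apply/measurable_EFinP/measurable_funX/measurable_funB => //; exact: measurable_piecewise.
have cP : continuous (fun t => (P i)^`(K).[t]) by exact: (@tower_continuous _ _ K (tower_horner (P i))).
have cD : continuous (fun t => (U K t - (P i)^`(K).[t]) ^+ 2).
  by move=> t; apply: cvgM; apply: cvgB; try exact: tower_continuous; exact: cP.
have cU : continuous (fun t => c * U K.+1 t ^+ 2).
  by move=> t; apply: cvgM; [exact: cvg_cst|apply: cvgM; exact: tower_continuous].
(* Single points are null: the cell is opened to replace [S] by its polynomial, then closed for the
   estimate on a compact interval. *)
rewrite -integral_itv_obnd_cbnd; last exact: measurable_funTS.
have -> : (\int[mu]_(t in `]x i, x (i + 1)[) ((U K t - S t) ^+ 2)%:E =
    \int[mu]_(t in `]x i, x (i + 1)[) ((U K t - (P i)^`(K).[t]) ^+ 2)%:E)%E.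
  by apply: eq_integral => t; rewrite inE/= in_itv/= => /hS ->.
rewrite integral_itv_bndo_bndc; last by apply/measurable_EFinP; exact: continuous_measurable.
rewrite integral_itv_obnd_cbnd; last by apply/measurable_EFinP; exact: continuous_measurable.
rewrite integral_itv_bndo_bndc; last by apply/measurable_EFinP; exact: continuous_measurable.
have i1 := continuous_integrable_itv (x i) (x (i + 1)) cD.
have i2 := continuous_integrable_itv (x i) (x (i + 1)) cU.
rewrite -[leLHS]fineK ?integrable_fin_num// -[leRHS]fineK ?integrable_fin_num//.
rewrite lee_fin -!/(Rintegral _ _ _) RintegralZl//; last first.
  by apply: continuous_integrable_itv => t; apply: cvgM; exact: tower_continuous.
have h := hermite_interval_estimate wn (hx i) tU (sP i) (hP i).
rewrite -(ler_pM2l (exprn_gt0 2 nu0)); apply: (le_trans h); rewrite mulrA.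
have -> : nu ^+ 2 * c = delta ^+ 2 by rewrite /c expr_div_n mulrC divfK// expf_neq0// gt_eqF.
rewrite ler_wpM2r//; first by apply: Rintegral_ge0 => t _; exact: sqr_ge0.
rewrite ler_pXn2r ?nnegrE ?subr_ge0 ?(ltW (hx i))//.
by apply: le_trans (hdelta i); rewrite subr_ge0 ltW.
Qed.

Let seg_le i n :
  (\int[mu]_(t in seg i n) ((U K t - S t) ^+ 2)%:E <=
   \int[mu]_(t in seg i n) (c * U K.+1 t ^+ 2)%:E)%E.
Proof.
have mU m : measurable_fun [set: R] (U m) by apply: continuous_measurable; exact: tower_continuous.
have mD : measurable_fun [set: R] (fun t => ((U K t - S t) ^+ 2)%:E).
  by apply/measurable_EFinP/measurable_funX/measurable_funB => //; exact: measurable_piecewise.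
have mE : measurable_fun [set: R] (fun t => (c * U K.+1 t ^+ 2)%:E).
  have m : measurable_fun [set: R] (fun t => c * U K.+1 t ^+ 2).
    by apply: measurable_funMM; [exact: measurable_cst|exact: measurable_funX].
  by apply/measurable_EFinP; exact: m.
elim: n => [|n ih]; first by rewrite /seg addr0 set_itvco0// !integral_set0.
have dj : [disjoint seg i n & `[x (i + n%:Z), x (i + n%:Z + 1)[%classic].
  apply/disj_setPS => t [] /=; rewrite /seg /= !in_itv/= => /andP[_ h] /andP[h' _].
  by move: h; rewrite ltNge h'.
rewrite segS !ge0_integral_setU//; try exact: mseg; try exact: measurable_funTS.
- by apply: leeD => //; exact: cell_le.
- by move=> t _; rewrite lee_fin mulr_ge0 ?sqr_ge0.
- by move=> t _; rewrite lee_fin sqr_ge0.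
Qed.

Lemma piecewise_estimate : sqint (fun t => U K t - S t) /\
  \int[mu]_t ((U K t - S t) ^+ 2) <= (delta / nu) ^+ 2 * \int[mu]_t (U K.+1 t ^+ 2).
Proof.
have mU m : measurable_fun [set: R] (U m) by apply: continuous_measurable; exact: tower_continuous.
have mD : measurable_fun [set: R] (fun t => U K t - S t).
  by apply: measurable_funB => //; exact: measurable_piecewise.
have mD2 : measurable_fun [set: R] (fun t => (U K t - S t) ^+ 2) by exact: measurable_funX.
have icU := itgZ c itgU.
have le : (\int[mu]_t ((U K t - S t) ^+ 2)%:E <= (c * \int[mu]_t (U K.+1 t ^+ 2))%:E)%E.
  rewrite -(RintZ _ itgU) -(itg_fineK icU).
  have h := @ge0_nondecreasing_set_cvg_integral _ _ _ (fun n : nat => seg (- n%:Z) (n + n) : set (measurableTypeR R))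
     (EFin \o (fun t => (U K t - S t) ^+ 2)) mu seg_homo.
  rewrite seg_cover in h.
  have mDn n : measurable_fun (seg (- n%:Z) (n + n)) (EFin \o (fun t => (U K t - S t) ^+ 2)).
    by apply: measurable_funTS; apply/measurable_EFinP; exact: mD2.
  have {}h := h (fun n => mseg _ _) mDn (fun n t _ => sqr_ge0 _).
  rewrite -(cvg_lim _ h)//; apply: lime_le; first by apply/cvg_ex; eexists; exact: h.
  apply: nearW => n; apply: (le_trans (seg_le _ _)).
  apply: ge0_subset_integral => //; [exact: mseg|exact: (measurable_int mu icU)|].
  by move=> t _; rewrite lee_fin mulr_ge0 ?sqr_ge0.
have iD : itg (fun t => (U K t - S t) ^+ 2).
  apply/(ge0_itgP mD2); first by move=> t; exact: sqr_ge0.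
  exact: le_lt_trans le (ltry _).
by split=> //; rewrite -lee_fin -itg_fineK.
Qed.

End estimate.

End Nodes.

(** * Orthogonal projection *)

Section InnerProduct.
Context {R : realType}.
Local Notation mu := (@lebesgue_measure R).
Local Notation itg f := (mu.-integrable [set: R] (EFin \o f)).
Implicit Types (f g h : R -> R[i]) (c z w : R[i]) (s t : R).

(** The real part of [inner]. It is enough for norms and nearest points; [orth_projP] recovers
    complex orthogonality. *)
Definition rinner f g : R :=
  \int[mu]_t (complex.Re (f t) * complex.Re (g t) + complex.Im (f t) * complex.Im (g t)).

Lemma itg_rinner f g : cL2 f -> cL2 g ->
  itg (fun t => complex.Re (f t) * complex.Re (g t) + complex.Im (f t) * complex.Im (g t)).
Proof. by move=> /cL2P[rf jf] /cL2P[rg jg]; apply: itgD; exact: sqint_mul. Qed.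

Lemma rinner_self f : rinner f f = energy f. Proof. by []. Qed.

Lemma rinnerC f g : rinner f g = rinner g f.
Proof. by congr Rintegral; rewrite funeqE => t; rewrite [X in X + _]mulrC [X in _ + X]mulrC. Qed.

Lemma rinnerDl f g h : cL2 f -> cL2 g -> cL2 h ->
  rinner (fun t => f t + g t) h = rinner f h + rinner g h.
Proof.
move=> hf hg hh; rewrite /rinner -(RintD (itg_rinner hf hh) (itg_rinner hg hh)).
by congr Rintegral; rewrite funeqE => t; rewrite cReD cImD; ring.
Qed.

Lemma rinnerZl c f h : rinner (fun t => c * f t) h = rinner f (fun t => conjc c * h t).
Proof.
congr Rintegral; rewrite funeqE => t; rewrite !cReM !cImM.
by case: c => a b /=; ring.
Qed.

Lemma rinnerNl f h : cL2 f -> cL2 h -> rinner (fun t => - f t) h = - rinner f h.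
Proof.
move=> hf hh; rewrite -[RHS]mulN1r -(RintZ _ (itg_rinner hf hh)).
by congr Rintegral; rewrite funeqE => t; case: (f t) (h t) => [a b] [a' b'] /=; ring.
Qed.

Lemma cL2D f g : cL2 f -> cL2 g -> cL2 (fun t => f t + g t).
Proof. by move=> hf hg; have := cL2_lin 1 hf hg; under eq_fun do rewrite mul1r. Qed.

Lemma cL20 : cL2 (fun=> 0 : R[i]).
Proof. by have [] := @bandlimited0 R 1. Qed.

Lemma cL2Z c f : cL2 f -> cL2 (fun t => c * f t).
Proof. by move=> hf; have := cL2_lin c hf cL20; under eq_fun do rewrite addr0. Qed.

Lemma cL2N f : cL2 f -> cL2 (fun t => - f t).
Proof. by move=> hf; have := cL2Z (-1) hf; under eq_fun do rewrite mulN1r. Qed.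

Lemma rinnerBl f g h : cL2 f -> cL2 g -> cL2 h ->
  rinner (fun t => f t - g t) h = rinner f h - rinner g h.
Proof.
by move=> hf hg hh; rewrite (rinnerDl hf (cL2N hg) hh) (rinnerNl hg hh).
Qed.

Lemma energyZ c f : cL2 f -> energy (fun t => c * f t) = csqr c * energy f.
Proof.
move=> hf; rewrite -(RintZ _ (itg_energy hf)); congr Rintegral; rewrite funeqE => t.
by rewrite -!/(csqr _) csqrM.
Qed.

Lemma energyD f g : cL2 f -> cL2 g ->
  energy (fun t => f t + g t) = energy f + 2 * rinner f g + energy g.
Proof.
move=> hf hg; have hfg := cL2D hf hg.
rewrite -!rinner_self (rinnerDl hf hg hfg) (rinnerC f) (rinnerC g) (rinnerDl hf hg hf) (rinnerDl hf hg hg).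
by rewrite (rinnerC g f); ring.
Qed.

Lemma energy0 f : (forall t, f t = 0) -> energy f = 0.
Proof.
move=> f0; rewrite /energy; under eq_Rintegral do rewrite f0/= expr0n addr0.
by rewrite Rintegral_cst// mul0r.
Qed.

Lemma energyN f : energy (fun t => - f t) = energy f.
Proof.
congr Rintegral; rewrite funeqE => t; case: (f t) => a b /=; ring.
Qed.

Lemma energyBC f g : energy (fun t => f t - g t) = energy (fun t => g t - f t).
Proof. by rewrite -energyN; congr energy; rewrite funeqE => t; rewrite opprB. Qed.

Lemma energyB f g : cL2 f -> cL2 g ->
  energy (fun t => f t - g t) = energy f - 2 * rinner f g + energy g.
Proof.
move=> hf hg; rewrite (energyD hf (cL2N hg)) energyN rinnerC (rinnerNl hg hf) rinnerC.
by rewrite mulrN.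
Qed.

Lemma rinner_cauchy_schwarz f g : cL2 f -> cL2 g -> rinner f g ^+ 2 <= energy f * energy g.
Proof.
move=> hf hg; apply: quadratic_discriminant => s.
have := energy_ge0 (fun t => f t + s%:C * g t).
rewrite (energyD hf (cL2Z _ hg)) (energyZ _ hg) rinnerC rinnerZl.
rewrite (_ : rinner g _ = s * rinner f g).
  by rewrite /csqr/= expr0n/= addr0 mulrA.
rewrite rinnerC -(RintZ _ (itg_rinner hf hg)); congr Rintegral; rewrite funeqE => t.
by case: (f t) (g t) => [a b] [a' b'] /=; ring.
Qed.

Definition nrm f : R := Num.sqrt (energy f).

Lemma nrm_ge0 f : 0 <= nrm f. Proof. exact: sqrtr_ge0. Qed.

Lemma nrm_sqr f : nrm f ^+ 2 = energy f. Proof. by rewrite sqr_sqrtr// energy_ge0. Qed.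

Lemma norm2_nrm f : cL2 f -> norm2 f = (nrm f)%:E. Proof. exact: norm2E. Qed.

Lemma nrm_le f (b : R) : 0 <= b -> (nrm f <= b) = (energy f <= b ^+ 2).
Proof. by move=> b0; rewrite -nrm_sqr ler_pXn2r ?nnegrE ?nrm_ge0. Qed.

Lemma rinner_le f g : cL2 f -> cL2 g -> `|rinner f g| <= nrm f * nrm g.
Proof.
move=> hf hg; rewrite -sqrtr_sqr -sqrtrM ?energy_ge0//; apply: ler_wsqrtr.
exact: rinner_cauchy_schwarz.
Qed.

Lemma nrmD f g : cL2 f -> cL2 g -> nrm (fun t => f t + g t) <= nrm f + nrm g.
Proof.
move=> hf hg; have h1 := nrm_ge0 f; have h2 := nrm_ge0 g.
rewrite nrm_le ?addr_ge0// (energyD hf hg) -!nrm_sqr.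
have := le_trans (ler_norm _) (rinner_le hf hg); nra.
Qed.

Lemma nrmBC f g : nrm (fun t => f t - g t) = nrm (fun t => g t - f t).
Proof. by rewrite /nrm energyBC. Qed.

Lemma nrm_triangle g f h : cL2 f -> cL2 g -> cL2 h ->
  nrm (fun t => f t - h t) <= nrm (fun t => f t - g t) + nrm (fun t => g t - h t).
Proof.
move=> hf hg hh; have := nrmD (cL2B hf hg) (cL2B hg hh).
by under eq_fun do rewrite addrA subrK.
Qed.

Lemma nrm_lin c f g : cL2 f -> cL2 g ->
  nrm (fun t => c * f t + g t) <= Num.sqrt (csqr c) * nrm f + nrm g.
Proof.
move=> hf hg; have := nrmD (cL2Z c hf) hg; rewrite {2}/nrm (energyZ c hf).
by rewrite sqrtrM// csqr_ge0.
Qed.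

Lemma nrm_eq0_ae f g : cL2 f -> cL2 g -> nrm (fun t => f t - g t) = 0 <-> eq_ae f g.
Proof.
move=> hf hg; have hfg := cL2B hf hg; have i := itg_energy hfg.
have ie : (\int[mu]_t `|(csqr (f t - g t))%:E|)%E = (energy (fun t => f t - g t))%:E.
  rewrite /energy -itg_fineK//; apply: eq_integral => t _.
  by rewrite -/(csqr _) /= ger0_norm ?csqr_ge0.
have mD : measurable_fun [set: R] (fun t => (csqr (f t - g t))%:E) := measurable_int mu i.
have zE z : csqr z = 0 -> z = 0.
  move=> /eqP; rewrite /csqr paddr_eq0 ?sqr_ge0// !sqrf_eq0 => /andP[/eqP h1 /eqP h2].
  exact: complexP.
have aeE := ae_eq_integral_abs mu measurableT mD.
split=> [e0|fg].
  have /aeE : (\int[mu]_t `|(csqr (f t - g t))%:E|)%E = 0%E.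
    by rewrite ie -nrm_sqr e0 expr0n.
  apply: ae_impl => t /(_ I)[] /zE /eqP; rewrite subr_eq0 => /eqP //.
have : ae_eq mu [set: R] (fun t => (csqr (f t - g t))%:E) (cst 0%E).
  by apply: ae_impl fg => t -> _; rewrite subrr /csqr/= expr0n addr0.
by move=> /aeE; rewrite ie => -[e0]; rewrite /nrm e0 sqrtr0.
Qed.

End InnerProduct.

(* The closure of a space [D] of square integrable functions on which point
   evaluation is bounded: this bound replaces the Riesz-Fischer theorem, since a
   Cauchy sequence in [D] converges pointwise. *)
Section Closure.
Context {R : realType}.
Local Notation mu := (@lebesgue_measure R).
Local Notation itg f := (mu.-integrable [set: R] (EFin \o f)).
Implicit Types (f g h p G : R -> R[i]) (c z w : R[i]) (s t e : R).

Variables (D : set (R -> R[i])) (C : R).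
Hypothesis D0 : D (fun=> 0).
Hypothesis Dlin : forall c f g, D f -> D g -> D (fun t => c * f t + g t).
Hypothesis DL2 : forall f, D f -> cL2 f.
Hypothesis Dpoint : forall f t, D f -> csqr (f t) <= C * energy f.

Definition L2closure : set (R -> R[i]) :=
  [set g | cL2 g /\ forall e : R, 0 < e ->
     exists2 f, D f & nrm (fun t => g t - f t) < e].

Local Notation M := L2closure.

Lemma closure_L2 g : M g -> cL2 g. Proof. by case. Qed.

Lemma sub_closure f : D f -> M f.
Proof.
move=> Df; split; first exact: DL2.
by move=> e e0; exists f => //; rewrite /nrm energy0 ?sqrtr0// => t; exact: subrr.
Qed.

Let DB f g : D f -> D g -> D (fun t => f t - g t).
Proof.
move=> Df Dg; have := Dlin (-1) Dg Df.
by under eq_fun do rewrite mulN1r addrC.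
Qed.

Lemma closure_lin c g h : M g -> M h -> M (fun t => c * g t + h t).
Proof.
move=> [lg hg] [lh hh]; split; first exact: cL2_lin.
move=> e e0; set r := Num.sqrt (csqr c).
have r0 : 0 <= r by exact: sqrtr_ge0.
have [|f Df gf] := hg (e / 2 / (r + 1)); first by rewrite !divr_gt0// ltr_wpDl.
have [|f' Df' hf'] := hh (e / 2); first by rewrite divr_gt0.
exists (fun t => c * f t + f' t); first exact: Dlin.
have := nrm_lin c (cL2B lg (DL2 Df)) (cL2B lh (DL2 Df')).
rewrite (_ : (fun t => _ + _) = (fun t => c * g t + h t - (c * f t + f' t))); last first.
  by rewrite funeqE => t; ring.
move=> /le_lt_trans; apply; rewrite -/r [ltRHS](splitr e); apply: ler_ltD => //.
apply: (@le_trans _ _ (r * (e / 2 / (r + 1)))); first by rewrite ler_wpM2l// ltW.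
by rewrite mulrCA ler_piMr ?divr_ge0// ?(ltW e0)// ler_pdivrMr ?mul1r ?lerDl// ltr_wpDl.
Qed.

Lemma closureB g h : M g -> M h -> M (fun t => g t - h t).
Proof.
move=> hg hh; have := closure_lin (-1) hh hg.
by under eq_fun do rewrite mulN1r addrC.
Qed.

Let fatou_le (v : nat -> R -> R) (p : R -> R) (b : R) :
  (forall n, measurable_fun [set: R] (v n)) -> (forall n t, 0 <= v n t) ->
  (forall t, v n t @[n --> \oo] --> p t) ->
  (forall n, (\int[mu]_t (v n t)%:E <= b%:E)%E) -> (\int[mu]_t (p t)%:E <= b%:E)%E.
Proof.
move=> mv v0 vp vb.
have mv' n : measurable_fun [set: R] (EFin \o v n) by apply/measurable_EFinP.
have v0' n t : [set: R] t -> (0 <= (EFin \o v n) t)%E by move=> _; rewrite lee_fin.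
have := fatou mu measurableT mv' v0'.
have -> : (\int[mu]_t limn_einf (fun n => (EFin \o v n) t) = \int[mu]_t (p t)%:E)%E.
  apply: eq_integral => t _.
  have vt : (EFin \o v n) t @[n --> \oo] --> (p t)%:E by apply: cvg_EFin; [exact: nearW|exact: vp].
  by rewrite is_cvg_limn_einfE ?(cvg_lim _ vt)//; apply/cvg_ex; eexists; exact: vt.
move=> /le_trans; apply; rewrite limn_einf_lim; apply: lime_le; first exact: is_cvg_einfs.
apply: nearW => n; apply: le_trans (vb n); apply: ereal_inf_lbound.
by exists n => /=.
Qed.

(** [Dpoint] makes the sequence Cauchy at every point, and Fatou's lemma carries the bounds on
    differences over to the pointwise limit. *)
Lemma cauchy_limit (u : nat -> R -> R[i]) (e : nat -> R) : (forall n, D (u n)) ->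
  e n @[n --> \oo] --> 0 ->
  (forall n m, (n <= m)%N -> nrm (fun t => u n t - u m t) <= e n) ->
  exists2 p, M p & forall n, nrm (fun t => u n t - p t) <= e n.
Proof.
move=> Du e0 ue.
have eg0 n : 0 <= e n by apply: le_trans (nrm_ge0 _) (ue n n (leqnn n)).
have uD n m : D (fun t => u n t - u m t) by exact: DB.
have C0 : 0 <= `|C| by [].
have pt n m t : (n <= m)%N -> csqr (u n t - u m t) <= `|C| * e n ^+ 2.
  move=> nm; apply: (le_trans (Dpoint t (uD n m))); rewrite -nrm_sqr.
  apply: (le_trans (ler_wpM2r (sqr_ge0 _) (ler_norm C))); rewrite ler_wpM2l//.
  by rewrite ler_pXn2r ?nnegrE ?nrm_ge0//; exact: ue.
have cau (v : nat -> R -> R) : (forall n m t, (v n t - v m t) ^+ 2 <= csqr (u n t - u m t)) ->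
    forall t, cvgn (v^~ t).
  move=> vu t; apply/cauchy_cvgP/cauchy_exP => eps eps0.
  have [N _ hN] : \forall n \near \oo, `|C| * e n ^+ 2 < eps ^+ 2.
    have : `|C| * e n ^+ 2 @[n --> \oo] --> `|C| * 0 ^+ 2.
      by apply: cvgM; [exact: cvg_cst|apply: cvgM].
    rewrite expr0n mulr0 => /cvgrPdist_lt /(_ _ (exprn_gt0 2 eps0)).
    by apply: filterS => n; rewrite sub0r normrN ger0_norm// mulr_ge0 ?sqr_ge0.
  exists (v N t); exists N => // n /= Nn; rewrite /ball/= -(ger0_norm (ltW eps0)).
  rewrite -ltr_sqr ?nnegrE// !real_normK ?num_real//.
  exact: le_lt_trans (le_trans (vu N n t) (pt _ _ t Nn)) (hN N (leqnn N)).
have cRe t : cvgn (fun n => complex.Re (u n t)).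
  apply: (cau (fun n t => complex.Re (u n t))) => n m s; case: (u n s) (u m s) => [a b] [a' b'].
  by rewrite /csqr /= lerDl sqr_ge0.
have cIm t : cvgn (fun n => complex.Im (u n t)).
  apply: (cau (fun n t => complex.Im (u n t))) => n m s; case: (u n s) (u m s) => [a b] [a' b'].
  by rewrite /csqr /= lerDr sqr_ge0.
pose p t : R[i] := limn (fun n => complex.Re (u n t)) +i* limn (fun n => complex.Im (u n t)).
have mRe n : measurable_fun [set: R] (fun t => complex.Re (u n t)).
  by have /cL2P[[]] := DL2 (Du n).
have mIm n : measurable_fun [set: R] (fun t => complex.Im (u n t)).
  by have /cL2P[_ []] := DL2 (Du n).
have mpRe : measurable_fun [set: R] (fun t => complex.Re (p t)).
  by apply: (measurable_fun_cvg mRe) => t _; exact: cRe.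
have mpIm : measurable_fun [set: R] (fun t => complex.Im (p t)).
  by apply: (measurable_fun_cvg mIm) => t _; exact: cIm.
have mc (f g : R -> R[i]) : measurable_fun [set: R] (fun t => complex.Re (f t)) ->
    measurable_fun [set: R] (fun t => complex.Im (f t)) ->
    measurable_fun [set: R] (fun t => complex.Re (g t)) ->
    measurable_fun [set: R] (fun t => complex.Im (g t)) ->
    measurable_fun [set: R] (fun t => csqr (f t - g t)).
  move=> m1 m2 m3 m4.
  rewrite /csqr; under eq_fun do rewrite cReB cImB.
  by apply: measurable_funD; apply: measurable_funX; apply: measurable_funB.
have le n : (\int[mu]_t (csqr (u n t - p t))%:E <= (e n ^+ 2)%:E)%E.
  apply: (@fatou_le (fun m t => csqr (u n t - u (m + n)%N t))).
  - by move=> m; exact: mc.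
  - by move=> m t; exact: csqr_ge0.
  - move=> t.
    pose w m := (complex.Re (u n t) - complex.Re (u m t)) ^+ 2 +
      (complex.Im (u n t) - complex.Im (u m t)) ^+ 2.
    have wl : w m @[m --> \oo] --> csqr (u n t - p t).
      rewrite /csqr cReB cImB.
      by apply: cvgD; apply: cvgM; apply: cvgB; try exact: cvg_cst; [exact: cRe|exact: cRe|exact: cIm|exact: cIm].
    have -> : (fun m => csqr (u n t - u (m + n)%N t)) = (fun m => w (m + n)%N).
      by rewrite funeqE => m; rewrite /w /csqr cReB cImB.
    by move: wl; rewrite -(cvg_shiftn n).
  - move=> m; have := ue n (m + n)%N (leq_addl _ _).
    rewrite nrm_le// => h; rewrite (itg_fineK (itg_csqr (DL2 (uD n (m + n)%N)))).
    by rewrite lee_fin.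
have hup n : cL2 (fun t => u n t - p t).
  have m1 := mc _ _ (mRe n) (mIm n) mpRe mpIm.
  have i1 : itg (fun t => csqr (u n t - p t)).
    apply/(ge0_itgP m1); first by move=> t; exact: csqr_ge0.
    exact: le_lt_trans (le n) (ltry _).
  have mr : measurable_fun [set: R] (fun t => complex.Re (u n t - p t)).
    by under eq_fun do rewrite cReB; exact: measurable_funB.
  have mi : measurable_fun [set: R] (fun t => complex.Im (u n t - p t)).
    by under eq_fun do rewrite cImB; exact: measurable_funB.
  apply/cL2P; split; split=> //; apply: (itg_le (measurable_funX _ _) _ i1) => // t.
    by rewrite ger0_norm ?sqr_ge0// lerDl sqr_ge0.
  by rewrite ger0_norm ?sqr_ge0// lerDr sqr_ge0.
have np n : nrm (fun t => u n t - p t) <= e n.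
  by rewrite nrm_le// -lee_fin /energy -(itg_fineK (itg_energy (hup n))); exact: le.
have Lp : cL2 p.
  have := cL2B (DL2 (Du 0%N)) (hup 0%N); congr cL2; rewrite funeqE => t.
  by rewrite opprB addrC subrK.
exists p => //; split=> // eps eps0.
have [N _ hN] : \forall n \near \oo, e n < eps.
  move/cvgrPdist_lt : e0 => /(_ _ eps0); apply: filterS => n.
  by rewrite sub0r normrN ger0_norm.
by exists (u N) => //; rewrite nrmBC; exact: le_lt_trans (np N) (hN N (leqnn N)).
Qed.

(** Point evaluation is controlled on [D] only, so each u_n is first replaced by an element of [D]
    at distance less than 1 / (n + 1). *)
Lemma closure_complete (u : nat -> R -> R[i]) (e : nat -> R) : (forall n, M (u n)) ->
  e n @[n --> \oo] --> 0 ->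
  (forall n m, (n <= m)%N -> nrm (fun t => u n t - u m t) <= e n) ->
  exists2 p, M p & nrm (fun t => u n t - p t) @[n --> \oo] --> 0.
Proof.
move=> Mu e0 ue.
have /choice[h hD] n : exists f, D f /\ nrm (fun t => u n t - f t) < n.+1%:R^-1.
  by have [_ /(_ n.+1%:R^-1)[|f Df uf]] := Mu n; [rewrite invr_gt0|exists f].
have hL n : cL2 (h n) by apply: DL2; have [] := hD n.
have uL n : cL2 (u n) by have [] := Mu n.
have i0 : (n.+1%:R^-1 : R) @[n --> \oo] --> 0 by exact: cvg_harmonic.
pose e' n : R := n.+1%:R^-1 + (e n + n.+1%:R^-1).
have e'0 : e' n @[n --> \oo] --> 0.
  rewrite -[0]addr0 -[X in _ + X]addr0.
  by apply: cvgD => //; exact: cvgD.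
have [n|//|n m nm|p Mp hp] := @cauchy_limit h e' => //; first by have [] := hD n.
  have [_ un] := hD n; have [_ um] := hD m.
  apply: (le_trans (nrm_triangle (hL n) (uL n) (hL m))); apply: lerD.
    by rewrite nrmBC ltW.
  apply: (le_trans (nrm_triangle (uL n) (uL m) (hL m))); apply: lerD; first exact: ue.
  by apply: (le_trans (ltW um)); rewrite lef_pV2 ?posrE// ler_nat.
exists p => //; apply: (@squeeze_cvgr _ _ _ _ (cst 0) (fun n => n.+1%:R^-1 + e' n)).
- apply: nearW => n; rewrite nrm_ge0 /=; have [_ un] := hD n; have Lp := closure_L2 Mp.
  by apply: (le_trans (nrm_triangle (uL n) (hL n) Lp)); apply: lerD => //; exact: ltW.
- exact: cvg_cst.
- by rewrite -[0]addr0; exact: cvgD.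
Qed.

Let iorth f := forall h, M h -> rinner f h = 0.

Let le_eps (a b : R) (r : nat -> R) : r n @[n --> \oo] --> 0 -> (forall n, a <= b + r n) -> a <= b.
Proof.
move=> r0 h; have : b + r n @[n --> \oo] --> b + 0 by apply: cvgD => //; exact: cvg_cst.
rewrite addr0 => br; apply: (@ler_cvg_to _ _ _ _ (cst a) (fun n => b + r n)) br _.
  exact: cvg_cst.
exact: nearW.
Qed.

(** The nearest point of [M] is the limit of a minimising sequence taken in [D] itself, to which
    [cauchy_limit] applies; it is Cauchy by the parallelogram law. *)
Let proj_ex G : cL2 G -> exists2 p, M p & iorth (fun t => G t - p t).
Proof.
move=> LG.
pose E := [set energy (fun t => G t - h t) | h in D].
have E0 : has_inf E.
  split; first by exists (energy (fun t => G t - 0)); exists (fun=> 0).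
  by exists 0 => _ [h _ <-]; exact: energy_ge0.
set d := inf E.
have dE h : D h -> d <= energy (fun t => G t - h t).
  by move=> Dh; apply: ge_inf; [have [] := E0|exists h].
have d0 : 0 <= d by apply: lb_le_inf; [have [] := E0|move=> _ [h _ <-]; exact: energy_ge0].
pose r n : R := Num.sqrt n.+1%:R^-1.
have r0 n : 0 <= r n by exact: sqrtr_ge0.
have rE n : r n ^+ 2 = n.+1%:R^-1 by rewrite sqr_sqrtr.
have rc : r n @[n --> \oo] --> 0.
  rewrite -(@sqrtr0 R).
  exact: (@cvg_comp _ _ _ (fun n => n.+1%:R^-1) Num.sqrt _ _ _ (@cvg_harmonic R) (@sqrt_continuous R 0)).
have rkc k : k * r n @[n --> \oo] --> 0.
  by rewrite -[0](mulr0 k); apply: cvgM => //; exact: cvg_cst.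
have /choice[h hh] n : exists f, D f /\ energy (fun t => G t - f t) < d + n.+1%:R^-1.
  have [|_ [f Df <-] fd] := @inf_adherent _ E n.+1%:R^-1 _ E0; first by rewrite invr_gt0.
  by exists f.
have hD n : D (h n) by have [] := hh n.
have hL n : cL2 (h n) by exact: DL2.
have hn n m : (n <= m)%N -> nrm (fun t => h n t - h m t) <= 2 * r n.
  move=> nm; rewrite nrm_le ?mulr_ge0//.
  pose a t := G t - h n t; pose b t := G t - h m t.
  have La : cL2 a by exact: cL2B.
  have Lb : cL2 b by exact: cL2B.
  have -> : (fun t => h n t - h m t) = (fun t => b t - a t).
    by rewrite funeqE => t; rewrite /a /b; ring.
  (* The midpoint of h_n and h_m is in [D], and a + b is twice the difference between [G] and this
     midpoint. *)
  have : 4 * d <= energy (fun t => b t + a t).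
    have Dm : D (fun t => 2^-1 * (h n t + h m t)).
      have := Dlin 1 (hD n) (hD m); under eq_fun do rewrite mul1r.
      by move=> /(Dlin 2^-1)/(_ D0); under eq_fun do rewrite addr0.
    have -> : (fun t => b t + a t) = (fun t => 2 * (G t - 2^-1 * (h n t + h m t))).
      rewrite funeqE => t; rewrite /a /b mulrBr mulVKf ?pnatr_eq0//; ring.
    rewrite energyZ; last exact: cL2B LG (DL2 Dm).
    have -> : csqr (2 : R[i]) = 4 by (rewrite /csqr /=; ring).
    by rewrite ler_wpM2l// dE.
  rewrite (energyD Lb La) (energyB Lb La) exprMn rE.
  have [_] := hh n; have [_] := hh m; rewrite -/a -/b.
  have : (m.+1%:R^-1 : R) <= n.+1%:R^-1 by rewrite lef_pV2 ?posrE// ler_nat.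
  move: m.+1%:R^-1 n.+1%:R^-1 (rinner b a) (energy a) (energy b) => x1 x2 y1 y2 y3.
  move: (d) => y4.
  lra.
have [p Mp hp] := cauchy_limit hD (rkc 2) hn.
have Lp := closure_L2 Mp.
have Gp : energy (fun t => G t - p t) <= d.
  rewrite -(sqr_sqrtr d0) -nrm_le ?sqrtr_ge0//; apply: (le_eps (rkc 3)) => n.
  apply: (le_trans (nrm_triangle LG (hL n) Lp)).
  have -> : Num.sqrt d + 3 * r n = (Num.sqrt d + r n) + 2 * r n by ring.
  apply: lerD => //; rewrite nrm_le ?addr_ge0 ?sqrtr_ge0//.
  have [_ /ltW/le_trans] := hh n; apply; rewrite sqrrD sqr_sqrtr// rE.
  by rewrite lerD2r lerDl mulrn_wge0// mulr_ge0// sqrtr_ge0.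
have orthD f : D f -> rinner (fun t => G t - p t) f = 0.
  move=> Df; have Lf := DL2 Df; apply/eqP; rewrite -sqrf_eq0 eq_le sqr_ge0 andbT -sqrrN.
  (* The distance to p + s f is minimal at s = 0: a nonnegative quadratic in s without constant term
     has no linear term. *)
  rewrite -[leRHS](mul0r (energy f)); apply: quadratic_discriminant => s.
  have : d <= energy (fun t => G t - (p t + s%:C * f t)).
    rewrite -[leLHS](sqr_sqrtr d0) -nrm_sqr ler_pXn2r ?nnegrE ?nrm_ge0 ?sqrtr_ge0//.
    have Lpf : cL2 (fun t => p t + s%:C * f t) by apply: cL2D => //; exact: cL2Z.
    (* p + s f is known only to be a limit, whereas [d] bounds distances to [D]; hence the detour
       through h_n + s f. *)
    apply: (le_eps (rkc 2)) => n.
    have Dn : D (fun t => h n t + s%:C * f t).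
      by have := Dlin s%:C Df (hD n); under eq_fun do rewrite addrC.
    apply: (@le_trans _ _ (nrm (fun t => G t - (h n t + s%:C * f t)))).
      by rewrite /nrm ler_wsqrtr// dE.
    apply: (le_trans (nrm_triangle LG Lpf (DL2 Dn))); rewrite lerD2l.
    have -> : (fun t => p t + s%:C * f t - (h n t + s%:C * f t)) = (fun t => p t - h n t).
      by rewrite funeqE => t; ring.
    by rewrite nrmBC.
  have -> : (fun t => G t - (p t + s%:C * f t)) = (fun t => (G t - p t) + (- s)%:C * f t).
    by rewrite funeqE => t; rewrite rmorphN/=; ring.
  have LGp := cL2B LG Lp.
  rewrite (energyD LGp (cL2Z _ Lf)) (energyZ _ Lf) rinnerC rinnerZl rinnerC.
  have -> : rinner (fun t => conjc (- s)%:C * (G t - p t)) f = - s * rinner (fun t => G t - p t) f.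
    rewrite -(RintZ _ (itg_rinner LGp Lf)); congr Rintegral; rewrite funeqE => t.
    by case: (G t - p t) (f t) => [a b] [a' b'] /=; ring.
  have -> : csqr (- s)%:C = s ^+ 2 by rewrite /csqr /= expr0n addr0 sqrrN.
  by move=> /(le_trans Gp); rewrite -addrA lerDl; have e0 := energy_ge0 f; lra.
exists p => // f Mf; have [Lf cf] := Mf; have LGp := cL2B LG Lp.
apply/eqP; rewrite -normr_le0; apply: (le_eps (rkc (nrm (fun t => G t - p t)))) => n.
have [|g Dg fg] := cf (r n); first by rewrite sqrtr_gt0 invr_gt0.
have Lg := DL2 Dg.
have -> : rinner (fun t => G t - p t) f = rinner (fun t => G t - p t) (fun t => f t - g t).
  by rewrite rinnerC [RHS]rinnerC (rinnerBl Lf Lg LGp) [X in _ - X]rinnerC (orthD _ Dg) subr0.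
rewrite add0r; apply: (le_trans (rinner_le LGp (cL2B Lf Lg))).
by rewrite ler_wpM2l ?nrm_ge0// ltW.
Qed.

Lemma inner_rinner f g : inner f g = rinner f g +i* rinner f (fun t => 'i * g t).
Proof.
apply: complexP => /=; congr Rintegral; rewrite funeqE => t.
  by rewrite cReM; case: (g t) => [a b] /=; rewrite mulrN opprK.
by rewrite cImM; case: (g t) => [a b] /=; ring.
Qed.

(** The imaginary part of the inner product with h is its real part against i h, and [M] is stable
    under multiplication by i. *)
Lemma orth_projP G p : is_orth_proj M G p <-> M p /\ iorth (fun t => G t - p t).
Proof.
split=> -[Mp h]; split=> // f Mf.
  by have := h f Mf; rewrite inner_rinner => -[].
rewrite inner_rinner (h _ Mf) h//.
by have := closure_lin 'i Mf (sub_closure D0); under eq_fun do rewrite addr0.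
Qed.

Lemma orth_proj_spec G : cL2 G -> is_orth_proj M G (orth_proj M G).
Proof.
move=> LG; have [p Mp Gp] := proj_ex LG.
by apply: (xgetPex _ (P := [set p | is_orth_proj M G p])); exists p; exact/orth_projP.
Qed.

Lemma orth_proj_lin c G H p q : cL2 G -> cL2 H ->
  is_orth_proj M G p -> is_orth_proj M H q ->
  is_orth_proj M (fun t => c * G t + H t) (fun t => c * p t + q t).
Proof.
move=> LG LH /orth_projP[Mp Gp] /orth_projP[Mq Hq]; apply/orth_projP; split.
  exact: closure_lin.
move=> h Mh; have Lp := closure_L2 Mp; have Lq := closure_L2 Mq; have Lh := closure_L2 Mh.
have -> : (fun t => c * G t + H t - (c * p t + q t)) = (fun t => c * (G t - p t) + (H t - q t)).
  by rewrite funeqE => t; ring.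
rewrite (rinnerDl (cL2Z _ (cL2B LG Lp)) (cL2B LH Lq) Lh) (Hq _ Mh) addr0 rinnerZl; apply: Gp.
by have := closure_lin (conjc c) Mh (sub_closure D0); under eq_fun do rewrite addr0.
Qed.

Lemma orth_proj_id G : M G -> is_orth_proj M G G.
Proof.
move=> MG; apply/orth_projP; split=> // h Mh.
rewrite /rinner; under eq_Rintegral do rewrite subrr/= !mul0r addr0.
by rewrite Rintegral_cst// mul0r.
Qed.

Lemma orth_proj_le G p : cL2 G -> is_orth_proj M G p -> nrm p <= nrm G.
Proof.
move=> LG /orth_projP[Mp Gp]; have Lp := closure_L2 Mp.
apply: ler_wsqrtr.
have -> : G = (fun t => (G t - p t) + p t) by rewrite funeqE => t; rewrite subrK.
by rewrite (energyD (cL2B LG Lp) Lp) (Gp _ Mp) mulr0 addr0 lerDr energy_ge0.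
Qed.

End Closure.

(** * The iteration *)

Section BandlimitedDerivatives.
Context {R : realType}.
Local Notation mu := (@lebesgue_measure R).
Local Notation itg f := (mu.-integrable [set: R] (EFin \o f)).
Implicit Types (f g h : R -> R[i]) (c z w : R[i]) (s t a b sigma : R) (U V : nat -> R -> R).

Lemma ctower_lin c f g U V U' V' : ctower U V f -> ctower U' V' g ->
  ctower (fun n t => complex.Re c * U n t + (- complex.Im c * V n t + U' n t))
    (fun n t => complex.Re c * V n t + (complex.Im c * U n t + V' n t))
    (fun t => c * f t + g t).
Proof.
move=> [tU tV fE] [tU' tV' gE]; split.
- exact: (tower_lin (complex.Re c) tU (tower_lin (- complex.Im c) tV tU')).
- exact: (tower_lin (complex.Re c) tV (tower_lin (complex.Im c) tU tV')).
by move=> t; rewrite fE gE; case: c => a b /=; congr (_ +i* _); ring.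
Qed.

(** Since (u^2)' >= - (u^2 + u'^2), u(t)^2 exceeds u(s)^2 by at most [B] for s >= t. Averaging over
    s in [t, t + 1] adds one more integral of u^2. *)
Lemma sobolev_bound (u u' : R -> R) t : (forall s, is_derive s 1 u (u' s)) -> continuous u' ->
  sqint u -> sqint u' ->
  u t ^+ 2 <= 2 * \int[mu]_s (u s ^+ 2) + \int[mu]_s (u' s ^+ 2).
Proof.
move=> du cu' [mu_ iu] [mu' iu']; have cu := is_derive_continuous du.
have cq : continuous (fun s => u s ^+ 2) by move=> s; apply: cvgM; exact: cu.
set B := \int[mu]_s (u s ^+ 2) + \int[mu]_s (u' s ^+ 2).
have tt : t <= t + 1 by rewrite lerDl.
have step s : t <= s -> u t ^+ 2 <= u s ^+ 2 + B.
  move=> ts.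
  have dF (r : R) : is_derive r (1 : R) (fun s => u s * u s) (u' r * u r + u r * u' r) := is_derive_mulf (du r) (du r).
  have c1 : continuous (fun r => u' r * u r + u r * u' r).
    by move=> r; apply: cvgD; apply: cvgM; [exact: cu'|exact: cu|exact: cu|exact: cu'].
  have c2 : continuous (fun r => - (u r ^+ 2 + u' r ^+ 2)).
    by move=> r; apply: cvgN; apply: cvgD; [exact: cq|apply: cvgM; exact: cu'].
  have := Rintegral_FTC dF c1 ts.
  have : \int[mu]_(r in `[t, s]) (- (u r ^+ 2 + u' r ^+ 2)) <= \int[mu]_(r in `[t, s]) (u' r * u r + u r * u' r).
    apply: le_Rintegral => //; [exact: continuous_integrable_itv|exact: continuous_integrable_itv|].
    by move=> r _; have := sqr_ge0 (u r + u' r); nra.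
  have iB := itgD iu iu'.
  have := ge0_Rintegral_subset (measurable_itv `[t, s]) iB (fun r => addr_ge0 (sqr_ge0 _) (sqr_ge0 _)).
  rewrite (RintD iu iu') -/B.
  have -> : \int[mu]_(r in `[t, s]) (- (u r ^+ 2 + u' r ^+ 2)) = - \int[mu]_(r in `[t, s]) (u r ^+ 2 + u' r ^+ 2).
    under eq_Rintegral do rewrite -mulN1r.
    by rewrite RintegralZl ?mulN1r//; exact: itg_subset.
  by rewrite -!expr2; lra.
have cE : continuous (fun s => u s ^+ 2 + B) by move=> s; apply: cvgD; [exact: cq|exact: cvg_cst].
have icst (r : R) : mu.-integrable `[t, t + 1] (EFin \o fun=> r).
  by apply: continuous_integrable_itv; exact: cst_continuous.
have : \int[mu]_(s in `[t, t + 1]) (u t ^+ 2) <= \int[mu]_(s in `[t, t + 1]) (u s ^+ 2 + B).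
  apply: le_Rintegral => //; first exact: continuous_integrable_itv.
  by move=> s; rewrite /= in_itv/= => /andP[ts _]; exact: step.
have m1 : fine (mu `[t, t + 1]) = 1 by rewrite lebesgue_measure_itv/= lte_fin ltrDl ltr01 -EFinB /= addrAC subrr add0r.
rewrite RintegralD//; last exact: continuous_integrable_itv.
rewrite !Rintegral_cst// m1 !mulr1 => /le_trans; apply.
have := ge0_Rintegral_subset (measurable_itv `[t, t + 1]) iu (fun r => sqr_ge0 _).
by rewrite /B; lra.
Qed.

Lemma cderiv_lin sigma n c f g : 0 < sigma -> bandlimited sigma f -> bandlimited sigma g ->
  cderiv n (fun t => c * f t + g t) = (fun t => c * cderiv n f t + cderiv n g t).
Proof.
move=> s0 /(bernstein_bandlimited s0)[U [V [hU _]]] /(bernstein_bandlimited s0)[U' [V' [hU' _]]].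
rewrite funeqE => t; rewrite (ctower_cderiv n t (ctower_lin c hU hU')).
rewrite (ctower_cderiv n t hU) (ctower_cderiv n t hU').
by case: c => a b /=; congr (_ +i* _); ring.
Qed.

Lemma cderiv_L2 sigma n f : 0 < sigma -> bandlimited sigma f -> cL2 (cderiv n f).
Proof.
move=> s0 /(bernstein_bandlimited s0)[U [V [hU /(_ n)[Un Vn _ _]]]].
rewrite (_ : cderiv n f = fun t => U n t +i* V n t); first exact/cL2P.
by rewrite funeqE => t; exact: ctower_cderiv.
Qed.

Lemma energy_ctower n f U V : ctower U V f -> sqint (U n) -> sqint (V n) ->
  energy (cderiv n f) = \int[mu]_t (U n t ^+ 2) + \int[mu]_t (V n t ^+ 2).
Proof.
move=> hU [_ Un] [_ Vn]; rewrite -(RintD Un Vn); congr Rintegral; rewrite funeqE => t.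
by rewrite (ctower_cderiv n t hU).
Qed.

(** Bernstein's inequality absorbs the derivative in [sobolev_bound], whence 2 + sigma^2. This is
    the bounded point evaluation required for closures. *)
Lemma cderiv_point_le sigma n f t : 0 < sigma -> bandlimited sigma f ->
  csqr (cderiv n f t) <= (2 + sigma ^+ 2) * energy (cderiv n f).
Proof.
move=> s0 /(bernstein_bandlimited s0)[U [V [hU h]]].
have [Un Vn bU bV] := h n; have [Un1 Vn1 _ _] := h n.+1; have [tU tV _] := hU.
rewrite (energy_ctower hU Un Vn) (ctower_cderiv n t hU) /csqr /=.
have := sobolev_bound t (tU n) (@tower_continuous _ _ n.+1 tU) Un Un1.
have := sobolev_bound t (tV n) (@tower_continuous _ _ n.+1 tV) Vn Vn1.
lra.
Qed.

Lemma is_hermite_unique k a b f (p q : {poly R[i]}) : a != b ->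
  is_hermite k a b f p -> is_hermite k a b f q -> p = q.
Proof.
move=> ab [sp hp] [sq hq]; apply/eqP; rewrite -subr_eq0; apply/eqP.
apply: (@hermite_unique _ k _ a%:C b%:C).
- by rewrite (inj_eq (fmorph_inj _)).
- by rewrite (leq_trans (size_polyD _ _))// size_polyN geq_max sp.
- move=> j jk; rewrite !derivnB !hornerD !hornerN.
  by have [-> ->] := hp j jk; have [-> ->] := hq j jk; rewrite !subrr.
Qed.

Lemma hermite_spec k a b f : a != b -> is_hermite k a b f (hermite k a b f).
Proof.
move=> ab; apply: (xgetPex _ (P := [set p | is_hermite k a b f p])).
have [|p sp hp] := @hermite_exists R[i] k a%:C b%:C (fun j => cderiv j f a) (fun j => cderiv j f b).
  by rewrite (inj_eq (fmorph_inj _)).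
by exists p.
Qed.

Lemma hermite_lin sigma k a b c f g : 0 < sigma -> bandlimited sigma f -> bandlimited sigma g ->
  a != b -> hermite k a b (fun t => c * f t + g t) = c *: hermite k a b f + hermite k a b g.
Proof.
move=> s0 bf bg ab; apply: (is_hermite_unique ab (hermite_spec _ _ ab)).
have [sp hp] := hermite_spec k f ab; have [sq hq] := hermite_spec k g ab; split.
  by rewrite (leq_trans (size_polyD _ _))// geq_max sq (leq_trans (size_scale_leq _ _)).
move=> j jk; rewrite !derivnD !derivnZ !hornerD !hornerZ (cderiv_lin _ _ s0 bf bg).
by have [-> ->] := hp j jk; have [-> ->] := hq j jk.
Qed.

End BandlimitedDerivatives.

(** * The interpolation error on the line *)

Section HermiteSum.
Context {R : realType}.
Local Notation mu := (@lebesgue_measure R).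
Variables (sigma nu delta : R) (K : nat) (x : int -> R).
Hypothesis sigma0 : 0 < sigma.
Hypothesis hx : forall i, x i < x (i + 1).
Hypothesis hcover : \bigcup_(i in [set: int]) `[x i, x (i + 1)]%classic = [set: R].
Hypothesis wn : is_wirtinger_cimmino K.+1 nu.
Hypothesis hdelta : forall i, x (i + 1) - x i <= delta.
Implicit Types (f g : R -> R[i]) (c : R[i]) (s t : R).

Let xne i : x i != x (i + 1). Proof. by rewrite lt_eqF. Qed.

Lemma hermite_sum_lin c f g : bandlimited sigma f -> bandlimited sigma g ->
  hermite_sum K.+1 x (fun t => c * f t + g t) =
  (fun t => c * hermite_sum K.+1 x f t + hermite_sum K.+1 x g t).
Proof.
move=> bf bg; rewrite funeqE => t; have [i it] := node_cover hx hcover t.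
rewrite !(hermite_sumE hx _ _ it)/= !(hermite_lin _ _ sigma0 bf bg)//.
by rewrite !derivnD !derivnZ !hornerD !hornerZ; ring.
Qed.

(** Real and imaginary parts are estimated separately. The sum is square integrable because both
    f^(K) and the error are. *)
Lemma hermite_sum_estimate f : bandlimited sigma f ->
  cL2 (hermite_sum K.+1 x f) /\
  energy (fun t => cderiv K f t - hermite_sum K.+1 x f t) <=
    (delta * sigma / nu) ^+ 2 * energy (cderiv K f).
Proof.
move=> bf; have [U [V [hU h]]] := bernstein_bandlimited sigma0 bf.
have [UK VK bU bV] := h K; have [[mU1 iU1] [mV1 iV1] _ _] := h K.+1.
have [tU tV _] := hU; have [nu0 _ _] := wn.
pose p i := hermite K.+1 (x i) (x (i + 1)) f.
have hp i := hermite_spec K.+1 f (xne i).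
have hpt i n t : (p i)^`(n).[t%:C] = (Repoly (p i))^`(n).[t] +i* (Impoly (p i))^`(n).[t].
  exact: horner_real.
have hl i l : (l <= K)%N -> [/\ (Repoly (p i))^`(l).[x i] = U l (x i),
    (Repoly (p i))^`(l).[x (i + 1)] = U l (x (i + 1)),
    (Impoly (p i))^`(l).[x i] = V l (x i) &
    (Impoly (p i))^`(l).[x (i + 1)] = V l (x (i + 1))].
  move=> lK; have [_ /(_ l lK)] := hp i.
  by rewrite -/(p i) !hpt !(ctower_cderiv l _ hU) => -[[-> ->] [-> ->]].
set S := hermite_sum K.+1 x f.
have hS i t : x i < t < x (i + 1) -> S t = (p i)^`(K).[t%:C].
  by move=> it; rewrite /S (hermite_sum_in hx _ _ it).
have [sU eU] := piecewise_estimate hx hcover (S := fun t => complex.Re (S t)) wn hdelta tU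
  (fun i => leq_trans (size_Repoly _) (proj1 (hp i)))
  (fun i l lK => let: And4 h1 h2 _ _ := hl i l lK in conj h1 h2)
  (fun i t it => congr1 (@complex.Re R) (eq_trans (hS i t it) (hpt i K t))) iU1.
have [sV eV] := piecewise_estimate hx hcover (S := fun t => complex.Im (S t)) wn hdelta tV
  (fun i => leq_trans (size_Impoly _) (proj1 (hp i)))
  (fun i l lK => let: And4 _ _ h1 h2 := hl i l lK in conj h1 h2)
  (fun i t it => congr1 (@complex.Im R) (eq_trans (hS i t it) (hpt i K t))) iV1.
have E t : cderiv K f t - S t = (U K t - complex.Re (S t)) +i* (V K t - complex.Im (S t)).
  by rewrite (ctower_cderiv K t hU); case: (S t).
have LD : cL2 (fun t => cderiv K f t - S t).
  by apply/cL2P; under eq_fun do rewrite E; under [X in _ /\ sqint X]eq_fun do rewrite E.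
split.
  have := cL2B (cderiv_L2 K sigma0 bf) LD; congr cL2; rewrite funeqE => t.
  by rewrite opprB addrC subrK.
rewrite /energy; under eq_Rintegral do rewrite E/=.
have [_ i1] := sU; have [_ i2] := sV.
rewrite (RintD i1 i2) -/(energy _) (energy_ctower hU UK VK).
have -> : (delta * sigma / nu) ^+ 2 = (delta / nu) ^+ 2 * sigma ^+ 2.
  by rewrite -exprMn; congr (_ ^+ 2); rewrite mulrAC.
apply: (le_trans (lerD eU eV)); rewrite -mulrDr -mulrA ler_wpM2l ?sqr_ge0// mulrDr.
exact: lerD.
Qed.

End HermiteSum.

(** * The extended operator and convergence of the iteration *)

Section BoundedExtension.
Context {R : realType}.
Local Notation mu := (@lebesgue_measure R).
Variables (sigma nu delta : R) (K : nat) (x : int -> R).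
Hypothesis sigma0 : 0 < sigma.
Hypothesis hx : forall i, x i < x (i + 1).
Hypothesis hcover : \bigcup_(i in [set: int]) `[x i, x (i + 1)]%classic = [set: R].
Hypothesis wn : is_wirtinger_cimmino K.+1 nu.
Hypothesis hdelta : forall i, x (i + 1) - x i <= delta.
Implicit Types (f g h p r : R -> R[i]) (c : R[i]) (s t e : R).

Let D : set (R -> R[i]) := [set h | exists2 f, bandlimited sigma f & h = cderiv K f].
Local Notation M := (bandlimited_deriv_closure sigma K).
Local Notation A := (approx_op sigma K.+1 x).
Let q := delta * sigma / nu.

Let D0 : D (fun=> 0).
Proof.
exists (fun=> 0); first exact: bandlimited0.
have b0 := @bandlimited0 R sigma; have := cderiv_lin K 0 sigma0 b0 b0.
rewrite (_ : (fun t => 0 * 0 + 0) = (fun=> 0)); last by rewrite funeqE => t; rewrite mul0r addr0.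
have [U [V [[tU tV UV] _]]] := bernstein_bandlimited sigma0 b0.
have hU : ctower (fun _ _ => 0 : R) (fun _ _ => 0 : R) (fun=> 0).
  by split=> // n t; exact: is_derive_cst.
by move=> _; rewrite funeqE => t; rewrite (ctower_cderiv K t hU).
Qed.

Let Dlin c f g : D f -> D g -> D (fun t => c * f t + g t).
Proof.
move=> [f' bf ->] [g' bg ->]; exists (fun t => c * f' t + g' t).
  exact: bandlimited_lin.
by rewrite (cderiv_lin K c sigma0 bf bg).
Qed.

Let DL2 f : D f -> cL2 f. Proof. by case=> f' bf ->; exact: cderiv_L2 bf. Qed.

Let Dpoint f t : D f -> csqr (f t) <= (2 + sigma ^+ 2) * energy f.
Proof. by case=> f' bf ->; exact: cderiv_point_le. Qed.

Let ME : M = L2closure D.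
Proof.
apply/seteqP; split=> g [Lg cg]; split=> // e e0.
  have [f bf] := cg e e0; rewrite norm2_nrm ?lte_fin; last first.
    exact: cL2B Lg (cderiv_L2 K sigma0 bf).
  by exists (cderiv K f) => //; exists f.
have [_ [f bf ->]] := cg e e0; exists f => //; rewrite norm2_nrm//.
exact: cL2B Lg (cderiv_L2 K sigma0 bf).
Qed.

Let ML2 g : M g -> cL2 g. Proof. by case. Qed.

Let Mlin c g h : M g -> M h -> M (fun t => c * g t + h t).
Proof. by rewrite ME; exact: closure_lin. Qed.

Let MB g h : M g -> M h -> M (fun t => g t - h t).
Proof. by rewrite ME; exact: closureB. Qed.

Let Mcderiv f : bandlimited sigma f -> M (cderiv K f).
Proof. by move=> bf; rewrite ME; apply: sub_closure => //; exists f. Qed.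

Let q0 : 0 <= q.
Proof.
have [nu0 _ _] := wn; rewrite divr_ge0// ?(ltW nu0)// mulr_ge0 ?(ltW sigma0)//.
by apply: le_trans (hdelta 0); rewrite subr_ge0 ltW.
Qed.

Let err_sum f : bandlimited sigma f ->
  nrm (fun t => cderiv K f t - hermite_sum K.+1 x f t) <= q * nrm (cderiv K f).
Proof.
move=> bf; have qn : 0 <= q * nrm (cderiv K f) := mulr_ge0 q0 (nrm_ge0 _).
rewrite (nrm_le _ qn) [leRHS]exprMn nrm_sqr.
by have [] := hermite_sum_estimate sigma0 hx hcover wn hdelta bf.
Qed.

Let sumL2 f : bandlimited sigma f -> cL2 (hermite_sum K.+1 x f).
Proof. by move=> bf; have [] := hermite_sum_estimate sigma0 hx hcover wn hdelta bf. Qed.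

Let A_spec f : bandlimited sigma f -> is_orth_proj M (hermite_sum K.+1 x f) (A f).
Proof.
by move=> bf; rewrite /approx_op /= ME; apply: (orth_proj_spec D0 Dlin DL2 Dpoint); exact: sumL2.
Qed.

Let MA f : bandlimited sigma f -> M (A f). Proof. by move=> /A_spec[]. Qed.

Let orth_lin c G H p r : cL2 G -> cL2 H -> is_orth_proj M G p -> is_orth_proj M H r ->
  is_orth_proj M (fun t => c * G t + H t) (fun t => c * p t + r t).
Proof. by rewrite ME; exact: (orth_proj_lin D0 Dlin DL2). Qed.

Let orth_le G p : cL2 G -> is_orth_proj M G p -> nrm p <= nrm G.
Proof. by rewrite ME; exact: (orth_proj_le D0 Dlin DL2). Qed.

Let orth_B G H p r : cL2 G -> cL2 H -> is_orth_proj M G p -> is_orth_proj M H r ->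
  nrm (fun t => p t - r t) <= nrm (fun t => G t - H t).
Proof.
move=> LG LH Gp Hr; apply: orth_le; first exact: cL2B.
have := orth_lin (-1) LH LG Hr Gp.
by congr is_orth_proj; rewrite funeqE => t; rewrite mulN1r addrC.
Qed.

Lemma approx_op_error f : bandlimited sigma f ->
  nrm (fun t => cderiv K f t - A f t) <= q * nrm (cderiv K f).
Proof.
move=> bf; apply: le_trans (err_sum bf); have Lc := cderiv_L2 K sigma0 bf.
apply: (orth_B Lc (sumL2 bf) _ (A_spec bf)).
by have := Mcderiv bf; rewrite ME; apply: (orth_proj_id D0 Dlin DL2).
Qed.

(** The interpolation sum differs from f^(K) by at most q times its norm, so its norm is at most 1 +
    q times that of f^(K); projecting does not increase it. *)
Let A_diff f g : bandlimited sigma f -> bandlimited sigma g ->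
  nrm (fun t => A f t - A g t) <= (1 + q) * nrm (fun t => cderiv K f t - cderiv K g t).
Proof.
move=> bf bg; apply: (le_trans (orth_B (sumL2 bf) (sumL2 bg) (A_spec bf) (A_spec bg))).
have bfg := bandlimited_lin (-1) bg bf.
have e1 := hermite_sum_lin K sigma0 hx hcover (-1) bg bf; have e2 := cderiv_lin K (-1) sigma0 bg bf.
have -> : (fun t => hermite_sum K.+1 x f t - hermite_sum K.+1 x g t) = hermite_sum K.+1 x (fun t => -1 * g t + f t).
  by rewrite e1 funeqE => t; rewrite mulN1r addrC.
have -> : (fun t => cderiv K f t - cderiv K g t) = cderiv K (fun t => -1 * g t + f t).
  by rewrite e2 funeqE => t; rewrite mulN1r addrC.
have Lc := cderiv_L2 K sigma0 bfg; have Ls := sumL2 bfg; have := err_sum bfg.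
have := nrmD Lc (cL2B Ls Lc); under eq_fun do rewrite addrC subrK.
by rewrite [X in _ + X]nrmBC mulrDl mul1r => /le_trans h1 h2; apply: h1; rewrite lerD2l.
Qed.

(** Stated in norm since [orth_proj] chooses a representative, so both sides may differ on a null
    set. *)
Let A_lin c f g : bandlimited sigma f -> bandlimited sigma g ->
  nrm (fun t => A (fun t => c * f t + g t) t - (c * A f t + A g t)) = 0.
Proof.
move=> bf bg; have bfg := bandlimited_lin c bf bg.
have h := orth_lin c (sumL2 bf) (sumL2 bg) (A_spec bf) (A_spec bg).
apply/le_anti; rewrite nrm_ge0 andbT.
apply: (le_trans (orth_B (sumL2 bfg) (cL2_lin c (sumL2 bf) (sumL2 bg)) (A_spec bfg) h)).
rewrite (hermite_sum_lin K sigma0 hx hcover c bf bg) /nrm energy0 ?sqrtr0// => t.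
exact: subrr.
Qed.

(* Pairs in the closure of the graph of [f^(K) |-> A f]. *)
Let is_ext g p := M p /\ forall e, 0 < e -> exists f,
  [/\ bandlimited sigma f, nrm (fun t => g t - cderiv K f t) < e & nrm (fun t => p t - A f t) < e].

Let le_eps (a b k : R) : 0 <= k -> (forall e, 0 < e -> a <= b + k * e) -> a <= b.
Proof.
move=> k0 h; apply/ler_addgt0Pr => e e0; have k1 : 0 < k + 1 by rewrite ltr_wpDl.
apply: (le_trans (h (e / (k + 1)) (divr_gt0 e0 k1))); rewrite lerD2l mulrCA ler_piMr ?(ltW e0)//.
by rewrite ler_pdivrMr// mul1r lerDl.
Qed.

Let nrm_subr0 f g : cL2 f -> cL2 g -> nrm f <= nrm (fun t => f t - g t) + nrm g.
Proof.
by move=> Lf Lg; have := nrmD (cL2B Lf Lg) Lg; under eq_fun do rewrite subrK.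
Qed.

Let ext_A f : bandlimited sigma f -> is_ext (cderiv K f) (A f).
Proof.
have n0 g : nrm (fun t => g t - g t) = 0.
  by rewrite /nrm energy0 ?sqrtr0// => t; exact: subrr.
by move=> bf; split; [exact: MA|move=> e e0; exists f; rewrite !n0].
Qed.

Let ext_exists g : M g -> exists p, is_ext g p.
Proof.
move=> [Lg cg].
have i0 : (n.+1%:R^-1 : R) @[n --> \oo] --> 0 by exact: cvg_harmonic.
have /choice[f hf] n : exists f, bandlimited sigma f /\ nrm (fun t => g t - cderiv K f t) < n.+1%:R^-1.
  have [|f bf] := cg n.+1%:R^-1; first by rewrite invr_gt0.
  rewrite norm2_nrm ?lte_fin => [h|]; first by exists f.
  exact: cL2B Lg (cderiv_L2 K sigma0 bf).
have bf n : bandlimited sigma (f n) by have [] := hf n.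
have Lc n := cderiv_L2 K sigma0 (bf n).
pose r n : R := (1 + q) * (n.+1%:R^-1 + n.+1%:R^-1).
have [|||p] := closure_complete (u := fun n => A (f n)) (e := r) Dlin DL2 Dpoint.
- by move=> n; rewrite -ME; exact: MA.
- have ii := cvgD i0 i0; rewrite addr0 in ii.
  have : (1 + q) * (n.+1%:R^-1 + n.+1%:R^-1) @[n --> \oo] --> (1 + q) * 0.
    by apply: cvgM; [exact: cvg_cst|exact: ii].
  by rewrite mulr0.
- move=> n m nm; apply: (le_trans (A_diff (bf n) (bf m))); rewrite ler_wpM2l ?addr_ge0//.
  apply: (le_trans (nrm_triangle (Lc n) Lg (Lc m))); apply: lerD.
    by rewrite nrmBC ltW//; have [] := hf n.
  have [_ /ltW/le_trans] := hf m; apply.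
  by rewrite lef_pV2 ?posrE// ler_nat.
rewrite -ME => Mp Ap; exists p; split=> // e e0.
have [N1 _ h1] : \forall n \near \oo, n.+1%:R^-1 < e.
  move/cvgrPdist_lt : i0 => /(_ _ e0); apply: filterS => n.
  by rewrite sub0r normrN ger0_norm.
have [N2 _ h2] : \forall n \near \oo, nrm (fun t => A (f n) t - p t) < e.
  move/cvgrPdist_lt : Ap => /(_ _ e0); apply: filterS => n.
  by rewrite sub0r normrN ger0_norm// nrm_ge0.
exists (f (maxn N1 N2)); split=> //.
  by have [_ /lt_trans] := hf (maxn N1 N2); apply; apply: h1; exact: leq_maxl.
by rewrite nrmBC; apply: h2; exact: leq_maxr.
Qed.

Let ext_lin c g h p r : M g -> M h -> is_ext g p -> is_ext h r ->
  is_ext (fun t => c * g t + h t) (fun t => c * p t + r t).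
Proof.
move=> Mg Mh [Mp gp] [Mr hr]; split; first exact: Mlin.
move=> e e0; set k := Num.sqrt (csqr c).
have k0 : 0 <= k by exact: sqrtr_ge0.
have k1 : 0 < k + 1 by rewrite ltr_wpDl.
have e1 : 0 < e / (k + 1) by exact: divr_gt0.
have [f [bf gf pf]] := gp _ e1; have [f' [bf' hf' rf']] := hr _ e1.
have bff := bandlimited_lin c bf bf'.
have est a b : a < e / (k + 1) -> b < e / (k + 1) -> k * a + b < e.
  move=> ha hb; have -> : e = k * (e / (k + 1)) + e / (k + 1).
    by rewrite -[X in _ + X]mul1r -mulrDl mulrCA divff ?mulr1// gt_eqF.
  by apply: ler_ltD => //; rewrite ler_wpM2l// ltW.
have lin_sub u v u' v' : (fun t => c * u t + v t - (c * u' t + v' t)) =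
    (fun t => c * (u t - u' t) + (v t - v' t)) :> (R -> R[i]).
  by rewrite funeqE => t; rewrite mulrBr opprD addrACA.
exists (fun t => c * f t + f' t); split=> //.
  rewrite (cderiv_lin K c sigma0 bf bf').
  rewrite lin_sub.
  apply: le_lt_trans (nrm_lin _ _ _) (est _ _ gf hf').
    exact: cL2B (ML2 Mg) (cderiv_L2 K sigma0 bf).
  exact: cL2B (ML2 Mh) (cderiv_L2 K sigma0 bf').
have LA := ML2 (MA bf); have LA' := ML2 (MA bf').
have := nrm_triangle (cL2_lin c (ML2 Mp) (ML2 Mr)) (cL2_lin c LA LA') (ML2 (MA bff)).
rewrite [X in _ + X]nrmBC (A_lin c bf bf') addr0 => /le_lt_trans; apply.
rewrite lin_sub.
by apply: le_lt_trans (nrm_lin _ _ _) (est _ _ pf rf'); [exact: cL2B (ML2 Mp) LA|exact: cL2B (ML2 Mr) LA'].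
Qed.

Let ext_error g p : M g -> is_ext g p -> nrm (fun t => g t - p t) <= q * nrm g.
Proof.
move=> Mg [Mp gp]; have Lg := ML2 Mg; have Lp := ML2 Mp.
(* One [e] for g against f^(K), one for A f against p, and q e for replacing the norm of f^(K) by
   that of g. *)
apply: (@le_eps _ _ (2 + q)); first by rewrite addr_ge0.
move=> e e0; have [f [bf gf pf]] := gp e e0; have Lf := cderiv_L2 K sigma0 bf.
have LA := ML2 (MA bf).
have h1 := nrm_triangle Lg Lf Lp; have h2 := nrm_triangle Lf LA Lp.
have h3 := approx_op_error bf; have h4 := nrm_subr0 Lf Lg.
rewrite nrmBC in h4; move: h2; rewrite [X in _ + X]nrmBC => h2.
have h5 : q * nrm (cderiv K f) <= q * (e + nrm g).
  by rewrite ler_wpM2l//; apply: (le_trans h4); rewrite lerD2r ltW.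
by rewrite mulrDr in h5; lra.
Qed.

Let ext_bound g p : M g -> is_ext g p -> nrm p <= (1 + q) * nrm g.
Proof.
move=> Mg gp; have := ext_error Mg gp; have [Mp _] := gp.
have := nrm_subr0 (ML2 Mp) (ML2 Mg); rewrite nrmBC mulrDl mul1r; lra.
Qed.

(** By linearity p - r is paired with the zero function in the closed graph, and [ext_bound] makes
    its norm 0. *)
Let ext_unique g p r : M g -> is_ext g p -> is_ext g r -> eq_ae p r.
Proof.
move=> Mg gp gr; have [Mp _] := gp; have [Mr _] := gr.
apply/(nrm_eq0_ae (ML2 Mp) (ML2 Mr)); apply/le_anti; rewrite nrm_ge0 andbT.
have := ext_bound (Mlin (-1) Mg Mg) (ext_lin (-1) Mg Mg gr gp).
rewrite [X in _ <= _ * X](_ : _ = 0).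
  by rewrite mulr0; congr (nrm _ <= _); rewrite funeqE => t; rewrite mulN1r addrC.
by rewrite /nrm energy0 ?sqrtr0// => t; rewrite mulN1r addNr.
Qed.

Let T g := xget (fun=> 0) [set p | is_ext g p].

Let T_ext g : M g -> is_ext g (T g).
Proof.
by move=> Mg; apply: (xgetPex _ (P := [set p | is_ext g p])); exact: ext_exists.
Qed.

Let is_bounded_ext_T : is_bounded_ext sigma K.+1 x T.
Proof.
split=> [g Mg|c g h Mg Mh||f bf].
- by have [] := T_ext Mg.
- exact: ext_unique (Mlin c Mg Mh) (T_ext (Mlin c Mg Mh)) (ext_lin c Mg Mh (T_ext Mg) (T_ext Mh)).
- exists (1 + q) => g Mg; have [MT _] := T_ext Mg.
  by rewrite (norm2_nrm (ML2 MT)) (norm2_nrm (ML2 Mg)) -EFinM lee_fin; exact: ext_bound (T_ext Mg).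
- exact: ext_unique (Mcderiv bf) (T_ext (Mcderiv bf)) (ext_A bf).
Qed.

(** [approx_op_ext] is an unspecified bounded extension: [T] shows that one exists, and this lemma
    transfers [ext_error] to whichever is chosen. Linearity and agreement with A hold almost
    everywhere only, hence the comparisons through norms equal to 0. *)
Let bounded_ext_ext S g : is_bounded_ext sigma K.+1 x S -> M g -> is_ext g (S g).
Proof.
move=> [MS Slin [C SC] SA] Mg; split; first exact: MS.
move=> e e0; have C1 : 0 < `|C| + 1 by rewrite ltr_wpDl.
have e1 : 0 < e / (`|C| + 1) by exact: divr_gt0.
have [_ /(_ _ e1)[f bf]] := Mg; have Mf := Mcderiv bf; have Lf := ML2 Mf; have Lg := ML2 Mg.
rewrite norm2_nrm ?lte_fin; last exact: cL2B.
move=> gf; exists f; split=> //.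
  by apply: (lt_le_trans gf); rewrite ler_pdivrMr// ler_peMr ?(ltW e0)// lerDr.
have LSg := ML2 (MS _ Mg); have LSf := ML2 (MS _ Mf); have LA := ML2 (MA bf).
have := nrm_triangle LSg LSf LA.
have /(nrm_eq0_ae LSf LA) -> := SA _ bf.
rewrite addr0 => /le_lt_trans; apply.
have Mfg := Mlin (-1) Mf Mg; have LSfg := ML2 (MS _ Mfg).
have Lfg := cL2_lin (-1) LSf LSg.
have -> : (fun t => S g t - S (cderiv K f) t) = (fun t => -1 * S (cderiv K f) t + S g t).
  by rewrite funeqE => t; rewrite mulN1r addrC.
have := nrm_subr0 Lfg LSfg.
rewrite nrmBC (nrm_eq0_ae LSfg Lfg).2 ?add0r; last exact: Slin.
move=> /le_lt_trans; apply.
have := SC _ Mfg; rewrite (norm2_nrm LSfg) (norm2_nrm (ML2 Mfg)) -EFinM lee_fin => /le_lt_trans; apply.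
have -> : (fun t => -1 * cderiv K f t + g t) = (fun t => g t - cderiv K f t).
  by rewrite funeqE => t; rewrite mulN1r addrC.
apply: (@le_lt_trans _ _ (`|C| * nrm (fun t => g t - cderiv K f t))).
  by rewrite ler_wpM2r ?nrm_ge0// ler_norm.
apply: (@le_lt_trans _ _ (`|C| * (e / (`|C| + 1)))); first by rewrite ler_wpM2l// ltW.
by rewrite mulrCA gtr_pMr// ltr_pdivrMr// mul1r ltrDl.
Qed.

Lemma approx_op_ext_error g : M g -> M (approx_op_ext sigma K.+1 x g) /\
  nrm (fun t => g t - approx_op_ext sigma K.+1 x g t) <= q * nrm g.
Proof.
move=> Mg; have S : is_bounded_ext sigma K.+1 x (approx_op_ext sigma K.+1 x).
  by apply: (xgetPex _ (P := [set T | is_bounded_ext sigma K.+1 x T])); exists T; exact: is_bounded_ext_T.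
by have h := bounded_ext_ext S Mg; split; [have [] := h|exact: ext_error].
Qed.

Lemma recon_error f n : bandlimited sigma f -> M (recon sigma K.+1 x f n) /\
  nrm (fun t => cderiv K f t - recon sigma K.+1 x f n t) <= q ^+ n.+1 * nrm (cderiv K f).
Proof.
move=> bf; elim: n => [|n [Mn ih]] /=.
  by rewrite expr1; split; [exact: MA|exact: approx_op_error].
have Mg := MB (Mcderiv bf) Mn; have [MT hT] := approx_op_ext_error Mg; split.
  by have := Mlin 1 Mn MT; under eq_fun do rewrite mul1r.
under eq_fun do rewrite opprD addrA.
by apply: (le_trans hT); rewrite exprS -mulrA ler_wpM2l.
Qed.

Lemma recon_cvg f : q < 1 -> bandlimited sigma f -> cvg_L2 (recon sigma K.+1 x f) (cderiv K f).
Proof.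
move=> q1 bf; apply: energy_cvg_L2.
- by move=> n; have [/ML2] := recon_error n bf.
- exact: ML2 (Mcderiv bf).
have qn : q ^+ n.+1 * nrm (cderiv K f) @[n --> \oo] --> 0.
  rewrite -[0](mul0r (nrm (cderiv K f))); apply: cvgM; last exact: cvg_cst.
  have : q ^+ n @[n --> \oo] --> 0 by apply: cvg_expr; rewrite ger0_norm.
  by rewrite -(cvg_shiftS (fun n => q ^+ n)).
apply: (@squeeze_cvgr _ _ _ _ (cst 0) (fun n => (q ^+ n.+1 * nrm (cderiv K f)) * (q ^+ n.+1 * nrm (cderiv K f)))).
- apply: nearW => n; rewrite energy_ge0 energyBC -expr2 -nrm_le ?mulr_ge0 ?exprn_ge0 ?nrm_ge0//.
  by have [] := recon_error n bf.
- exact: cvg_cst.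
- by rewrite -[0](mulr0 0); exact: cvgM.
Qed.

Lemma bandlimited_samples0 h : q < 1 -> bandlimited sigma h ->
  (forall j i, (j <= K)%N -> cderiv j h (x i) = 0) -> h = fun=> 0.
Proof.
move=> q1 bh h0.
have S0 : hermite_sum K.+1 x h = fun=> 0.
  rewrite funeqE => t; have [i it] := node_cover hx hcover t.
  have H0 j : hermite K.+1 (x j) (x (j + 1)) h = 0.
    have ne : x j != x (j + 1) by rewrite lt_eqF.
    apply: (is_hermite_unique ne (hermite_spec _ _ ne)); split; first by rewrite size_poly0.
    by move=> l lK; rewrite derivn_poly0 ?size_poly0// !horner0 !h0.
  by rewrite (hermite_sumE hx _ _ it)/= !H0 derivn_poly0 ?size_poly0// !horner0 !mul0r addr0.
have E0 : energy (cderiv K h) = 0.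
  have := err_sum bh; rewrite S0; under eq_fun do rewrite subr0.
  move=> hq; rewrite -nrm_sqr; have := nrm_ge0 (cderiv K h).
  rewrite le_eqVlt => /predU1P[<-|n0]; first by rewrite expr0n.
  by move: hq; rewrite -subr_le0 -{1}[nrm _]mul1r -mulrBl pmulr_lle0// subr_le0 leNgt q1.
have [U [V [hU _]]] := bernstein_bandlimited sigma0 bh; have [tU tV hE] := hU.
(* The point bound turns zero energy into vanishing at every point. *)
have UVK t : U K t = 0 /\ V K t = 0.
  have := cderiv_point_le K t sigma0 bh; rewrite E0 mulr0 (ctower_cderiv K t hU) /csqr /=.
  have := sqr_ge0 (U K t); have := sqr_ge0 (V K t) => h1 h2 h3.
  by split; apply/eqP; rewrite -sqrf_eq0; apply/eqP; lra.
(* Descent in the order of differentiation: each lower derivative is constant, and its sample at the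
   node [x 0] is zero. *)
have UV j t : (j <= K)%N -> U (K - j)%N t = 0 /\ V (K - j)%N t = 0.
  elim: j t => [|j ih] t jK; first by rewrite subn0.
  have jK' : (j <= K)%N by exact: ltnW.
  have eK : (K - j)%N = (K - j.+1).+1 by rewrite subnSK.
  have [U0 V0] : U (K - j.+1)%N (x 0) = 0 /\ V (K - j.+1)%N (x 0) = 0.
    by have := h0 (K - j.+1)%N 0 (leq_subr _ _); rewrite (ctower_cderiv _ _ hU) => -[-> ->].
  split.
    rewrite -[RHS]U0; apply: (@is_derive_0_is_cst R (U (K - j.+1)%N)) => s.
    by have := tU (K - j.+1)%N s; rewrite -eK; have [-> _] := ih s jK'.
  rewrite -[RHS]V0; apply: (@is_derive_0_is_cst R (V (K - j.+1)%N)) => s.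
  by have := tV (K - j.+1)%N s; rewrite -eK; have [_ ->] := ih s jK'.
by rewrite funeqE => t; rewrite hE; have := UV K t (leqnn K); rewrite subnn => -[-> ->].
Qed.

End BoundedExtension.

Theorem theorem4p1 (R : realType) (sigma : R) (k : nat) (x : int -> R)
    (nu delta : R) (f : R -> R[i])
    (hsigma : 0 < sigma) (hk : (1 <= k)%N)
    (hx : forall i, x i < x (i + 1))
    (hcover : \bigcup_(i in [set: int]) `[x i, x (i + 1)]%classic = [set: R])
    (hnu : is_wirtinger_cimmino k nu)
    (hdelta : ereal_sup (range (fun i => (x (i + 1) - x i)%:E)) = delta%:E)
    (hlt : delta < nu / sigma)
    (hf : bandlimited sigma f) :
  [/\ forall g, bandlimited sigma g ->
        (forall j i, (j < k)%N -> cderiv j g (x i) = cderiv j f (x i)) ->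
        g = f,
      cvg_L2 (recon sigma k x f) (cderiv k.-1 f) &
      forall n : nat,
        (norm2 (fun t => cderiv k.-1 f t - recon sigma k x f n t)%R <=
         ((delta * sigma / nu) ^+ n.+1)%:E * norm2 (cderiv k.-1 f))%E].
Proof.
case: k hk hnu => // K _ hnu.
have hd i : x (i + 1) - x i <= delta.
  by rewrite -lee_fin -hdelta; apply: ereal_sup_ubound; exists i.
have [nu0 _ _] := hnu.
have q1 : delta * sigma / nu < 1 by rewrite ltr_pdivrMr// mul1r -ltr_pdivlMr.
split=> [g hg gf||n].
- have := bandlimited_samples0 hsigma hx hcover hnu hd q1 (bandlimited_lin (-1) hf hg).
  rewrite funeqE => h; rewrite funeqE => t; apply/eqP; rewrite -subr_eq0 addrC -mulN1r h//.
  by move=> j i jK; rewrite (cderiv_lin j (-1) hsigma hf hg) gf// mulN1r addNr.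
- exact: (recon_cvg hsigma hx hcover hnu hd q1 hf).
- have [Mn hn] := recon_error hsigma hx hcover hnu hd n hf.
  have Lf : cL2 (cderiv K f) := cderiv_L2 K hsigma hf.
  rewrite (norm2_nrm Lf) norm2_nrm; last by apply: cL2B => //; case: Mn.
  by rewrite -EFinM lee_fin.
Qed.
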